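(* Assume that the system $g(p,x)\in C$ enjoys Robinson stability at $(\bar p,\bar x)$, and that one of the following holds: (i) condition (C1) holds, and either ${\cal P}=P$ or $K$ is polyhedral; (ii) strict complementarity holds for the system $g(\bar p,x)\in C$ at $(\bar x,-f(\bar z))$, and the following condition holds: (C2) for all $0\ne u\in{\cal K}_{\Gamma(\bar p)}(\bar x,-f(\bar z))$ and all $\lambda\in\bar\Lambda$, either $\langle{\cal F}_\lambda u,u\rangle>0$ or $\langle{\cal F}_\lambda u,\widetilde u\rangle<0$ for some $\widetilde u\in{\cal K}_{\Gamma(\bar p)}(\bar x,-f(\bar z))$. Then $S$ is isolatedly calm at $(\bar p,\bar x)$, i.e., there exist $\ell>0$ and neighborhoods $Q$ of $\bar p$ and $U$ of $\bar x$ such that $S(p)\cap U\subset\{\bar x\}+\ell\|p-\bar p\|{\cal B}_X$ for all $p\in Q$.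
   Context: Notation: $X=\mathbb R^n$, $P=\mathbb R^m$, $Y=\mathbb R^l$, $Z:=P\times X$, and $E$ is finite-dimensional. Dual spaces are distinguished from primal ones, and $A^*$ is the adjoint of a linear map $A$, and $\operatorname{rge}A$ its range. For a closed convex cone $K$, $K^*:=\{\mu:\langle\mu,y\rangle\le0\ \forall y\in K\}$ and $\operatorname{lin}K:=K\cap(-K)$; $\operatorname{ri}$ is the relative interior. For a closed set $\Omega$ and $\bar z\in\Omega$: the tangent cone is $T_\Omega(\bar z):=\{w:\exists\, t_k\downarrow0,\ w_k\to w \text{ with } \bar z+t_kw_k\in\Omega\}$; the regular normal cone is $N_\Omega(\bar z):=\{z^*:\limsup_{z\to\bar z,\,z\in\Omega}\langle z^*,z-\bar z\rangle/\|z-\bar z\|\le0\}$; and the critical cone is ${\cal K}_\Omega(\bar z,z^* ):=T_\Omega(\bar z)\cap\{z^*\}^\perp$. ${\cal B}_X$ is the closed unit ball. Setting: $g\colon P\times X\to Y$ is $C^2$ around $\bar z=(\bar p,\bar x)$. The set $C\subset Y$ is closed and $C^2$-cone reducible at $g(\bar z)$ to a closed convex cone $K\subset E$: there exist a neighborhood $V$ of $g(\bar z)$ and a $C^2$ map $h\colon V\to E$ with $h(g(\bar z))=0$, $\nabla h(g(\bar z))$ surjective, and $C\cap V=\{y\in V:h(y)\in K\}$. Set $\Gamma(p):=\{x:g(p,x)\in C\}$ and $G:=h\circ g$ near $\bar z$. The map $f\colon P\times X\to X^*$ is $C^1$ around $\bar z$, and $S(p):=\{x:0\in f(p,x)+N_{\Gamma(p)}(x)\}$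 with $\bar x\in S(\bar p)$. Robinson stability of $g(p,x)\in C$ at $(\bar p,\bar x)$: there are $\kappa\ge0$ and neighborhoods $W$ of $\bar p$ and $U$ of $\bar x$ with ${\rm dist}(x;\Gamma(p))\le\kappa\,{\rm dist}(g(p,x);C)$ on $W\times U$. Strict complementarity for $g(\bar p,x)\in C$ at $(\bar x,-f(\bar z))$: there is $\lambda\in\operatorname{ri}N_C(g(\bar z))$ with $\nabla_xg(\bar z)^*\lambda=-f(\bar z)$. ${\cal P}:=\{q\in P:\nabla_pG(\bar z)q\in\operatorname{rge}\nabla_xG(\bar z)+\operatorname{lin}K\}$. Multipliers: for $\lambda\in N_C(g(\bar z))$, $(\nabla h(g(\bar z))^* )^{-1}\lambda$ denotes the unique $\mu\in E^*$ with $\nabla h(g(\bar z))^*\mu=\lambda$. For $z^*\in Z^*$, set $\Lambda(\bar z,z^* ):=\{\lambda\in N_C(g(\bar z)):\nabla g(\bar z)^*\lambda=z^*\}$, and for $v\in Z$, $$\Lambda(\bar z,z^*;v):=\arg\max_{\lambda\in\Lambda(\bar z,z^* )}\Big(\langle\lambda,\nabla^2g(\bar z)(v,v)\rangle+\nabla^2\langle(\nabla h(g(\bar z))^* )^{-1}\lambda,h(\cdot)\rangle(g(\bar z))\big(\nabla g(\bar z)v,\nabla g(\bar z)v\big)\Big).$$ Further, $\bar\Lambda:=\{\lambda\in N_C(g(\bar z)):f(\bar z)+\nabla_xg(\bar z)^*\lambda=0\}$. For $\lambda\in N_C(g(\bar z))$, define ${\cal H}^x_\lambda u:=\nabla_xg(\bar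 z)^*\nabla^2\langle(\nabla h(g(\bar z))^* )^{-1}\lambda,h(\cdot)\rangle(g(\bar z))\nabla_xg(\bar z)u$ and ${\cal F}_\lambda u:=\nabla_xf(\bar z)u+\nabla^2_x\langle\lambda,g(\cdot)\rangle(\bar z)u+{\cal H}^x_\lambda u$ for $u\in X$. Condition (C1): for every $0\ne u\in{\cal K}_{\Gamma(\bar p)}(\bar x,-f(\bar z))$, every $\lambda\in\bar\Lambda$, and every $\hat\lambda\in\Lambda(\bar z,\nabla g(\bar z)^*\lambda;(0,u))$, either $\langle{\cal F}_{\hat\lambda}u,u\rangle>0$ or $\langle{\cal F}_{\hat\lambda}u,\widetilde u\rangle<0$ for some $\widetilde u\in{\cal K}_{\Gamma(\bar p)}(\bar x,-f(\bar z))$. *)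

(* Defs.v *)
From Stdlib Require Import Reals ClassicalEpsilon.
From mathcomp Require Import ssreflect ssrfun ssrbool eqtype ssrnat seq fintype bigop.

Set Implicit Arguments.
Unset Strict Implicit.
Unset Printing Implicit Defensive.

Local Open Scope R_scope.

Definition vec (n : nat) := 'I_n -> R.
Definition mat (b a : nat) := 'I_b -> 'I_a -> R.
Definition tensor (b a : nat) := 'I_b -> 'I_a -> 'I_a -> R.

Definition vsum {n : nat} (F : 'I_n -> R) : R := \big[Rplus/R0]_(i < n) F i.

Definition vzero {n : nat} : vec n := fun _ => 0.
Definition vadd {n : nat} (u v : vec n) : vec n := fun i => u i + v i.
Definition vopp {n : nat} (u : vec n) : vec n := fun i => - u i.
Definition vsub {n : nat} (u v : vec n) : vec n := fun i => u i - v i.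
Definition vscale {n : nat} (t : R) (u : vec n) : vec n := fun i => t * u i.
Definition vdot {n : nat} (u v : vec n) : R := vsum (fun i => u i * v i).
Definition vnorm {n : nat} (u : vec n) : R := sqrt (vdot u u).

Definition mulmv {b a : nat} (A : mat b a) (v : vec a) : vec b :=
  fun i => vsum (fun j => A i j * v j).
(* A^* w  (adjoint = transpose, duals identified with R^k via the dot product) *)
Definition mulTmv {b a : nat} (A : mat b a) (w : vec b) : vec a :=
  fun j => vsum (fun i => A i j * w i).
Definition matmul {c b a : nat} (A : mat c b) (B : mat b a) : mat c a :=
  fun i k => vsum (fun j => A i j * B j k).

(* For T = second derivative of a map into R^b and mu in R^b:
   the Hessian matrix of the scalar function <mu, F(.)>. *)
Definition hess {b a : nat} (T : tensor b a) (mu : vec b) : mat a a :=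
  fun j k => vsum (fun i => mu i * T i j k).

(* Products Z = P x X = R^m x R^n, realised as R^(m+n) *)
Definition vjoin {m n : nat} (p : vec m) (x : vec n) : vec (m + n) :=
  fun k => match split k with inl i => p i | inr j => x j end.
Definition vfst {m n : nat} (z : vec (m + n)) : vec m := fun i => z (lshift n i).
Definition vsnd {m n : nat} (z : vec (m + n)) : vec n := fun j => z (rshift m j).
Definition uncurry2 {m n k : nat} (F : vec m -> vec n -> vec k) : vec (m + n) -> vec k :=
  fun z => F (vfst z) (vsnd z).

Definition jac_p {b m n : nat} (J : mat b (m + n)) : mat b m := fun i j => J i (lshift n j).
Definition jac_x {b m n : nat} (J : mat b (m + n)) : mat b n := fun i j => J i (rshift m j).
Definition hess_x {b m n : nat} (T : tensor b (m + n)) (lam : vec b) : mat n n :=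
  fun j k => vsum (fun i => lam i * T i (rshift m j) (rshift m k)).

Definition ball {n : nat} (c : vec n) (r : R) : vec n -> Prop :=
  fun x => vnorm (vsub x c) < r.

Definition has_jac {a b : nat} (F : vec a -> vec b) (J : mat b a) (x : vec a) : Prop :=
  forall eps, 0 < eps -> exists delta, 0 < delta /\
    forall h : vec a, vnorm h < delta ->
      vnorm (vsub (vsub (F (vadd x h)) (F x)) (mulmv J h)) <= eps * vnorm h.

Definition has_jac2 {a b : nat} (DF : vec a -> mat b a) (T : tensor b a) (x : vec a) : Prop :=
  forall eps, 0 < eps -> exists delta, 0 < delta /\
    forall h : vec a, vnorm h < delta ->
      forall i j, Rabs (DF (vadd x h) i j - DF x i j - vsum (fun k => T i j k * h k))
                  <= eps * vnorm h.

Definition mat_cont_at {a b : nat} (DF : vec a -> mat b a) (x : vec a) : Prop :=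
  forall eps, 0 < eps -> exists delta, 0 < delta /\
    forall y, vnorm (vsub y x) < delta -> forall i j, Rabs (DF y i j - DF x i j) < eps.

Definition tensor_cont_at {a b : nat} (T : vec a -> tensor b a) (x : vec a) : Prop :=
  forall eps, 0 < eps -> exists delta, 0 < delta /\
    forall y, vnorm (vsub y x) < delta ->
      forall i j k, Rabs (T y i j k - T x i j k) < eps.

Definition C1_on {a b : nat} (F : vec a -> vec b) (DF : vec a -> mat b a)
  (U : vec a -> Prop) : Prop :=
  forall x, U x -> has_jac F (DF x) x /\ mat_cont_at DF x.

Definition C2_on {a b : nat} (F : vec a -> vec b) (DF : vec a -> mat b a)
  (D2F : vec a -> tensor b a) (U : vec a -> Prop) : Prop :=
  forall x, U x ->
    has_jac F (DF x) x /\ has_jac2 DF (D2F x) x /\ tensor_cont_at D2F x.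

Definition C1_around {a b : nat} (F : vec a -> vec b) (DF : vec a -> mat b a) (x0 : vec a) :=
  exists r, 0 < r /\ C1_on F DF (ball x0 r).
Definition C2_around {a b : nat} (F : vec a -> vec b) (DF : vec a -> mat b a)
  (D2F : vec a -> tensor b a) (x0 : vec a) :=
  exists r, 0 < r /\ C2_on F DF D2F (ball x0 r).

Definition is_closed {n : nat} (A : vec n -> Prop) : Prop :=
  forall y, (forall eps, 0 < eps -> exists a, A a /\ vnorm (vsub a y) < eps) -> A y.

Definition convex_set {n : nat} (A : vec n -> Prop) : Prop :=
  forall a b t, A a -> A b -> 0 <= t <= 1 -> A (vadd (vscale t a) (vscale (1 - t) b)).

Definition closed_convex_cone {n : nat} (K : vec n -> Prop) : Prop :=
  is_closed K /\ convex_set K /\ K vzero /\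
  (forall t a, 0 <= t -> K a -> K (vscale t a)).

Definition polyhedral {n : nat} (K : vec n -> Prop) : Prop :=
  exists (k : nat) (A : 'I_k -> vec n) (c : 'I_k -> R),
    forall y, K y <-> (forall i, vdot (A i) y <= c i).

Definition lin_space {n : nat} (K : vec n -> Prop) : vec n -> Prop :=
  fun y => K y /\ K (vopp y).

Definition aff_hull {n : nat} (A : vec n -> Prop) : vec n -> Prop :=
  fun b => exists (k : nat) (pts : 'I_k -> vec n) (c : 'I_k -> R),
    vsum c = 1 /\ (forall i, A (pts i)) /\ b = (fun j => vsum (fun i => c i * pts i j)).

Definition rel_int {n : nat} (A : vec n -> Prop) : vec n -> Prop :=
  fun a => A a /\ exists eps, 0 < eps /\
    forall b, aff_hull A b -> vnorm (vsub b a) < eps -> A b.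

Definition vseq_cv {n : nat} (w : nat -> vec n) (w0 : vec n) : Prop :=
  forall eps, 0 < eps -> exists N, forall k, (N <= k)%nat -> vnorm (vsub (w k) w0) < eps.

Definition tangent_cone {n : nat} (A : vec n -> Prop) (z : vec n) : vec n -> Prop :=
  fun w => exists (t : nat -> R) (wk : nat -> vec n),
    (forall k, 0 < t k) /\ Un_cv t 0 /\ vseq_cv wk w /\
    (forall k, A (vadd z (vscale (t k) (wk k)))).

Definition normal_cone {n : nat} (A : vec n -> Prop) (z : vec n) : vec n -> Prop :=
  fun zs => A z /\ forall eps, 0 < eps -> exists delta, 0 < delta /\
    forall z', A z' -> vnorm (vsub z' z) < delta ->
      vdot zs (vsub z' z) <= eps * vnorm (vsub z' z).

Definition critical_cone {n : nat} (A : vec n -> Prop) (z zs : vec n) : vec n -> Prop :=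
  fun w => tangent_cone A z w /\ vdot zs w = 0.

Definition is_glb (E : R -> Prop) (m : R) : Prop :=
  (forall x, E x -> m <= x) /\ (forall b, (forall x, E x -> b <= x) -> b <= m).

Definition Rinf (E : R -> Prop) : R :=
  match excluded_middle_informative (exists m, is_glb E m) with
  | left H => proj1_sig (constructive_indefinite_description _ H)
  | right _ => 0
  end.

Definition dist {n : nat} (A : vec n -> Prop) (y : vec n) : R :=
  Rinf (fun r => exists a, A a /\ r = vnorm (vsub y a)).

(* (A^* )^{-1} lam : the (unique, when A is surjective) mu with A^* mu = lam *)
Definition preimT {b a : nat} (A : mat b a) (lam : vec a) : vec b :=
  match excluded_middle_informative (exists mu, mulTmv A mu = lam) with
  | left H => proj1_sig (constructive_indefinite_description _ H)
  | right _ => vzero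
  end.

Definition Gamma {m n l : nat} (g : vec m -> vec n -> vec l) (C : vec l -> Prop)
  (p : vec m) : vec n -> Prop := fun x => C (g p x).

Definition Ssol {m n l : nat} (g : vec m -> vec n -> vec l) (C : vec l -> Prop)
  (f : vec m -> vec n -> vec n) (p : vec m) : vec n -> Prop :=
  fun x => normal_cone (Gamma g C p) x (vopp (f p x)).

(* Robinson stability of g(p,x) in C at (pbar, xbar)
   (dist to an empty set is +infinity, hence the nonemptiness requirement) *)
Definition robinson_stable {m n l : nat} (g : vec m -> vec n -> vec l) (C : vec l -> Prop)
  (pbar : vec m) (xbar : vec n) : Prop :=
  exists kappa r1 r2, 0 <= kappa /\ 0 < r1 /\ 0 < r2 /\
    forall p x, ball pbar r1 p -> ball xbar r2 x ->
      (exists a, Gamma g C p a) /\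
      dist (Gamma g C p) x <= kappa * dist C (g p x).

Definition Lam {l k : nat} (C : vec l -> Prop) (ybar : vec l) (Dgz : mat l k)
  (zs : vec k) : vec l -> Prop :=
  fun lam => normal_cone C ybar lam /\ mulTmv Dgz lam = zs.

Definition lam_obj {l k d : nat} (Dgz : mat l k) (D2gz : tensor l k)
  (Dhy : mat d l) (D2hy : tensor d l) (lam : vec l) (v : vec k) : R :=
  vdot v (mulmv (hess D2gz lam) v) +
  vdot (mulmv Dgz v) (mulmv (hess D2hy (preimT Dhy lam)) (mulmv Dgz v)).

Definition Lam_dir {l k d : nat} (C : vec l -> Prop) (ybar : vec l) (Dgz : mat l k)
  (D2gz : tensor l k) (Dhy : mat d l) (D2hy : tensor d l) (zs v : vec k) : vec l -> Prop :=
  fun lam => Lam C ybar Dgz zs lam /\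
    forall lam', Lam C ybar Dgz zs lam' ->
      lam_obj Dgz D2gz Dhy D2hy lam' v <= lam_obj Dgz D2gz Dhy D2hy lam v.

Definition Lambar {m n l : nat} (C : vec l -> Prop) (ybar : vec l) (Dgz : mat l (m + n))
  (fz : vec n) : vec l -> Prop :=
  fun lam => normal_cone C ybar lam /\ vadd fz (mulTmv (jac_x Dgz) lam) = vzero.

Definition Hx {m n l d : nat} (Dgz : mat l (m + n)) (Dhy : mat d l) (D2hy : tensor d l)
  (lam : vec l) (u : vec n) : vec n :=
  mulTmv (jac_x Dgz) (mulmv (hess D2hy (preimT Dhy lam)) (mulmv (jac_x Dgz) u)).

Definition Fop {m n l d : nat} (Dfz : mat n (m + n)) (Dgz : mat l (m + n))
  (D2gz : tensor l (m + n)) (Dhy : mat d l) (D2hy : tensor d l)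
  (lam : vec l) (u : vec n) : vec n :=
  vadd (vadd (mulmv (jac_x Dfz) u) (mulmv (hess_x D2gz lam) u)) (Hx Dgz Dhy D2hy lam u).

(* Main.v *)
(** With G = h o g, suppose solutions x_k of the problem for p_k satisfy
    p_k - pbar = o(t_k), where t_k = |x_k - xbar| -> 0, and let u be a limit of
    (x_k - xbar)/t_k.  Robinson stability yields bounded multipliers mu_k in the polar of K,
    orthogonal to G(p_k, x_k), hence a limit multiplier mu, and u is a critical direction.
    Testing the stationarity equation at x_k with a critical direction a gives
    <F_mu u, a> >= 0 in the limit.  Testing it with u_k, and expanding
    <mu'_k - mu_k, G(p_k, x_k)> <= 0 to second order, gives <F_mu u, u> <= 0 as soon as
    there are multipliers mu'_k of the unperturbed problem with mu'_k -> mu and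
    <mu'_k - mu_k, D_p G (p_k - pbar)> = o(t_k^2).  If calP = P one may take mu'_k = mu; in the
    polyhedral case and under strict complementarity an error bound for the multiplier set
    gives |mu'_k - mu_k| = O(t_k).  The same expansion shows that mu is a directional
    maximiser, which contradicts (C1); (C2) is contradicted directly. *)

From Stdlib Require Import Reals Lra Classical ClassicalEpsilon FunctionalExtensionality.
From mathcomp Require Import ssreflect ssrfun ssrbool eqtype ssrnat seq fintype bigop.
From mathcomp Require filter.
From mathcomp Require Import Rstruct.
Require Import Defs.

Set Implicit Arguments.
Unset Strict Implicit.
Unset Printing Implicit Defensive.

Local Open Scope R_scope.

(** * Euclidean vectors *)

(** Everything is reduced to G = h o g with multipliers in the polar of K. As Dh(ybar) is
    surjective, lambda = Dh^* mu identifies [polar K] with the normal cone of C at ybar, and the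
    curvature term of F_lambda is absorbed in the second derivative of <mu, G>. As G vanishes at the
    reference point, K is both constraint set and tangent cone. The obstacle is the parameter term:
    q_k = (p_k - pbar)/t_k tends to 0 without a rate, yet the second-order expansion divides it by
    t_k once more. What can be exploited is that mu_k violates the unperturbed stationarity equation
    only by O(t_k). Comparison multipliers that vary with k do not settle the directional
    maximality, which compares with mu itself; in the polyhedral case it rests instead on mu being
    exactly complementary to G(p_k, x_k). *)

Lemma vsum_ext n (F G : 'I_n -> R) : (forall i, F i = G i) -> vsum F = vsum G.
Proof. by move=> e; apply: eq_bigr => i _. Qed.

Lemma vsumD n (F G : 'I_n -> R) : vsum (fun i => F i + G i) = vsum F + vsum G.
Proof. exact: big_split. Qed.

Lemma vsumZ n c (F : 'I_n -> R) : vsum (fun i => c * F i) = c * vsum F.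
Proof. by rewrite /vsum big_distrr. Qed.

Lemma vsumB n (F G : 'I_n -> R) : vsum (fun i => F i - G i) = vsum F - vsum G.
Proof.
have -> : vsum F - vsum G = vsum F + (-1) * vsum G by ring.
by rewrite -vsumZ -vsumD; apply: vsum_ext => i; ring.
Qed.

Lemma vsum0 n (F : 'I_n -> R) : (forall i, F i = 0) -> vsum F = 0.
Proof. by move=> F0; apply: big1 => i _. Qed.

Lemma vsum_exch n m (F : 'I_n -> 'I_m -> R) :
  vsum (fun i => vsum (fun j => F i j)) = vsum (fun j => vsum (fun i => F i j)).
Proof. exact: exchange_big. Qed.

Lemma vsum_le n (F G : 'I_n -> R) : (forall i, F i <= G i) -> vsum F <= vsum G.
Proof.
move=> FG; rewrite /vsum; apply: (big_ind2 (fun a b => a <= b)) => //; first lra.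
by move=> a b c e *; lra.
Qed.

Lemma vsum_ge0 n (F : 'I_n -> R) : (forall i, 0 <= F i) -> 0 <= vsum F.
Proof.
move=> F0; have <- : vsum (fun _ : 'I_n => 0) = 0 by exact: vsum0.
exact: vsum_le.
Qed.

Lemma vsum_ge_term n (F : 'I_n -> R) j : (forall i, 0 <= F i) -> F j <= vsum F.
Proof.
move=> F0; rewrite /vsum (bigD1 j) //=.
set S := (X in _ <= _ X); suff: 0 <= S by change (0 <= S -> F j <= F j + S); lra.
rewrite /S.
by apply: big_ind => [|a b|i _]; [exact: Rle_refl | exact: Rplus_le_le_0_compat | exact: F0].
Qed.

Lemma vsum_abs n (F : 'I_n -> R) : Rabs (vsum F) <= vsum (fun i => Rabs (F i)).
Proof.
rewrite /vsum; apply: (big_ind2 (fun a b => Rabs a <= b)).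
- by rewrite Rabs_R0; lra.
- by move=> a b c e ab ce; have := Rabs_triang a c; lra.
- by move=> i _; lra.
Qed.

Definition vdelta {n} (i : 'I_n) : vec n := fun j => if j == i then 1 else 0.

Lemma vsum_delta n (i : 'I_n) (F : 'I_n -> R) : vsum (fun j => F j * vdelta i j) = F i.
Proof.
rewrite /vsum (bigD1 i) //= big1 => [|j ji]; rewrite /vdelta.
  by rewrite eqxx; ring.
by rewrite (negbTE ji); ring.
Qed.

Lemma vsum_split m n (F : 'I_(m + n) -> R) :
  vsum F = vsum (fun i => F (lshift n i)) + vsum (fun j => F (rshift m j)).
Proof. exact: big_split_ord. Qed.

Lemma vec_ext n (u v : vec n) : (forall i, u i = v i) -> u = v.
Proof. exact: functional_extensionality. Qed.

Ltac vring := apply: vec_ext => ?; rewrite /vadd /vsub /vscale /vopp /vzero; ring.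

Lemma vdotC n (u v : vec n) : vdot u v = vdot v u.
Proof. by apply: vsum_ext => i; ring. Qed.

Lemma vdotDr n (u v w : vec n) : vdot u (vadd v w) = vdot u v + vdot u w.
Proof. by rewrite -vsumD; apply: vsum_ext => i; rewrite /vadd; ring. Qed.

Lemma vdotBr n (u v w : vec n) : vdot u (vsub v w) = vdot u v - vdot u w.
Proof. by rewrite -vsumB; apply: vsum_ext => i; rewrite /vsub; ring. Qed.

Lemma vdotZr n c (u v : vec n) : vdot u (vscale c v) = c * vdot u v.
Proof. by rewrite -vsumZ; apply: vsum_ext => i; rewrite /vscale; ring. Qed.

Lemma vdotNr n (u v : vec n) : vdot u (vopp v) = - vdot u v.
Proof.
have -> : vopp v = vscale (-1) v by vring.
by rewrite vdotZr; ring.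
Qed.

Lemma vdot0r n (u : vec n) : vdot u vzero = 0.
Proof. by apply: vsum0 => i; rewrite /vzero; ring. Qed.

Lemma vdotDl n (u v w : vec n) : vdot (vadd v w) u = vdot v u + vdot w u.
Proof. by rewrite !(vdotC _ u) vdotDr. Qed.

Lemma vdotBl n (u v w : vec n) : vdot (vsub v w) u = vdot v u - vdot w u.
Proof. by rewrite !(vdotC _ u) vdotBr. Qed.

Lemma vdotZl n c (u v : vec n) : vdot (vscale c v) u = c * vdot v u.
Proof. by rewrite !(vdotC _ u) vdotZr. Qed.

Lemma vdotNl n (u v : vec n) : vdot (vopp v) u = - vdot v u.
Proof. by rewrite !(vdotC _ u) vdotNr. Qed.

Lemma vdot0l n (u : vec n) : vdot vzero u = 0.
Proof. by rewrite vdotC vdot0r. Qed.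

Definition vdotE := (vdotDl, vdotDr, vdotBl, vdotBr, vdotZl, vdotZr, vdotNl, vdotNr,
  vdot0l, vdot0r).

Lemma vdot_delta n (u : vec n) i : vdot u (vdelta i) = u i.
Proof. exact: vsum_delta. Qed.

Lemma vdot_adj a b (A : mat b a) (w : vec b) (v : vec a) :
  vdot (mulTmv A w) v = vdot w (mulmv A v).
Proof.
rewrite /vdot /mulTmv /mulmv.
have -> : vsum (fun i => vsum (fun i0 => A i0 i * w i0) * v i) =
          vsum (fun i => vsum (fun i0 => w i0 * (A i0 i * v i))).
  by apply: vsum_ext => i; rewrite Rmult_comm -vsumZ; apply: vsum_ext => j; ring.
by rewrite vsum_exch; apply: vsum_ext => j; rewrite vsumZ.
Qed.

Lemma mulmvD a b (A : mat b a) u v : mulmv A (vadd u v) = vadd (mulmv A u) (mulmv A v).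
Proof. by apply: vec_ext => i; rewrite /mulmv /vadd -vsumD; apply: vsum_ext => j; ring. Qed.

Lemma mulmvZ a b (A : mat b a) c u : mulmv A (vscale c u) = vscale c (mulmv A u).
Proof. by apply: vec_ext => i; rewrite /mulmv /vscale -vsumZ; apply: vsum_ext => j; ring. Qed.

Lemma mulmvB a b (A : mat b a) u v : mulmv A (vsub u v) = vsub (mulmv A u) (mulmv A v).
Proof. by apply: vec_ext => i; rewrite /mulmv /vsub -vsumB; apply: vsum_ext => j; ring. Qed.

Lemma mulmv0 a b (A : mat b a) : mulmv A vzero = vzero.
Proof. by apply: vec_ext => i; apply: vsum0 => j; rewrite /vzero; ring. Qed.

Definition mtrans {a b} (A : mat b a) : mat a b := fun i j => A j i.

Lemma mulTmvE a b (A : mat b a) w : mulTmv A w = mulmv (mtrans A) w.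
Proof. by []. Qed.

Lemma mulTmvB a b (A : mat b a) u v : mulTmv A (vsub u v) = vsub (mulTmv A u) (mulTmv A v).
Proof. exact: mulmvB. Qed.

Lemma mulTmvD a b (A : mat b a) u v : mulTmv A (vadd u v) = vadd (mulTmv A u) (mulTmv A v).
Proof. exact: mulmvD. Qed.

Lemma mulTmvZ a b (A : mat b a) c v : mulTmv A (vscale c v) = vscale c (mulTmv A v).
Proof. exact: mulmvZ. Qed.

Lemma mulmv_matmul a b c (A : mat c b) (B : mat b a) v :
  mulmv (matmul A B) v = mulmv A (mulmv B v).
Proof.
apply: vec_ext => i; rewrite /mulmv /matmul.
have -> : vsum (fun j => vsum (fun j0 => A i j0 * B j0 j) * v j) =
          vsum (fun j => vsum (fun j0 => A i j0 * (B j0 j * v j))).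
  by apply: vsum_ext => j; rewrite Rmult_comm -vsumZ; apply: vsum_ext => k; ring.
by rewrite vsum_exch; apply: vsum_ext => j; rewrite vsumZ.
Qed.

Lemma mulTmv_matmul a b c (A : mat c b) (B : mat b a) v :
  mulTmv (matmul A B) v = mulTmv B (mulTmv A v).
Proof.
rewrite !mulTmvE -mulmv_matmul; congr mulmv.
by apply: functional_extensionality => i; apply: functional_extensionality => j;
  apply: vsum_ext => k; rewrite /mtrans; ring.
Qed.

Lemma vdot_ge0 n (u : vec n) : 0 <= vdot u u.
Proof. by apply: vsum_ge0 => i; nra. Qed.

Lemma vnorm_ge0 n (u : vec n) : 0 <= vnorm u.
Proof. exact: sqrt_pos. Qed.

Lemma vnorm_sq n (u : vec n) : vnorm u * vnorm u = vdot u u.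
Proof. exact/sqrt_sqrt/vdot_ge0. Qed.

Lemma vnormZ n c (u : vec n) : vnorm (vscale c u) = Rabs c * vnorm u.
Proof.
rewrite /vnorm vdotZl vdotZr -Rmult_assoc sqrt_mult; [|nra|exact: vdot_ge0].
by rewrite sqrt_Rsqr_abs.
Qed.

Lemma vnorm0 n : vnorm (@vzero n) = 0.
Proof. by rewrite /vnorm vdot0r sqrt_0. Qed.

Lemma vnorm_coord n (u : vec n) i : Rabs (u i) <= vnorm u.
Proof.
apply: Rsqr_incr_0_var; last exact: vnorm_ge0.
rewrite -Rsqr_abs /Rsqr vnorm_sq.
by apply: (@vsum_ge_term _ (fun i => u i * u i)) => j; nra.
Qed.

Lemma vnorm_eq0 n (u : vec n) : vnorm u = 0 -> u = vzero.
Proof.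
move=> u0; apply: vec_ext => i; rewrite /vzero.
by have := vnorm_coord u i; rewrite u0; have := Rabs_pos (u i); move: (Rabs_no_R0 (u i)); lra.
Qed.

Lemma vnorm_gt0 n (u : vec n) : u <> vzero -> 0 < vnorm u.
Proof. by move=> u0; case: (vnorm_ge0 u) => // /esym /vnorm_eq0. Qed.

Lemma cauchy_schwarz n (u v : vec n) : vdot u v <= vnorm u * vnorm v.
Proof.
have u0 := vnorm_ge0 u; have v0 := vnorm_ge0 v.
have := vdot_ge0 (vsub (vscale (vnorm v) u) (vscale (vnorm u) v)).
rewrite !vdotE (vdotC v u) -!vnorm_sq => H.
case: (Rle_lt_dec (vnorm u * vnorm v) 0) => uv0.
  have {}uv0 : vnorm u * vnorm v = 0 by nra.
  case: (Rmult_integral _ _ uv0) => /vnorm_eq0 ->; rewrite ?vnorm0 vdotE; lra.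
nra.
Qed.

Lemma cauchy_schwarz_abs n (u v : vec n) : Rabs (vdot u v) <= vnorm u * vnorm v.
Proof.
apply: Rabs_le; split; last exact: cauchy_schwarz.
have := cauchy_schwarz (vopp u) v; rewrite vdotNl.
have -> : vopp u = vscale (-1) u by vring.
by rewrite vnormZ Rabs_Ropp Rabs_R1; lra.
Qed.

Lemma vnorm_triang n (u v : vec n) : vnorm (vadd u v) <= vnorm u + vnorm v.
Proof.
have u0 := vnorm_ge0 u; have v0 := vnorm_ge0 v.
apply: Rsqr_incr_0_var; last lra.
rewrite /Rsqr vnorm_sq !vdotE (vdotC v u) -!vnorm_sq.
by have := cauchy_schwarz u v; nra.
Qed.

Lemma vnormN n (u : vec n) : vnorm (vopp u) = vnorm u.
Proof.
have -> : vopp u = vscale (-1) u by vring.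
by rewrite vnormZ Rabs_Ropp Rabs_R1; lra.
Qed.

Lemma vnorm_subC n (u v : vec n) : vnorm (vsub u v) = vnorm (vsub v u).
Proof. by rewrite -vnormN; congr vnorm; vring. Qed.

Lemma vnorm_subv n (u v w : vec n) :
  vnorm (vsub u w) <= vnorm (vsub u v) + vnorm (vsub v w).
Proof.
have -> : vsub u w = vadd (vsub u v) (vsub v w) by vring.
exact: vnorm_triang.
Qed.

Lemma vnorm_le_sum n (u : vec n) : vnorm u <= vsum (fun i => Rabs (u i)).
Proof.
have s0 : 0 <= vsum (fun i => Rabs (u i)) by apply: vsum_ge0 => i; exact: Rabs_pos.
apply: Rsqr_incr_0_var => //; rewrite /Rsqr vnorm_sq -vsumZ.
apply: vsum_le => i.
have := @vsum_ge_term _ (fun i => Rabs (u i)) i (fun i => Rabs_pos (u i)).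
have -> : u i * u i = Rabs (u i) * Rabs (u i) by rewrite -Rabs_mult Rabs_pos_eq //; nra.
by have := Rabs_pos (u i); nra.
Qed.

Lemma mulmv_bound a b (A : mat b a) :
  exists c, 0 < c /\ forall v, vnorm (mulmv A v) <= c * vnorm v.
Proof.
have c0 : 0 <= vsum (fun i => vnorm (A i)) by apply: vsum_ge0 => i; exact: vnorm_ge0.
exists (1 + vsum (fun i => vnorm (A i))); split=> [|v]; first lra.
apply: (Rle_trans _ _ _ (vnorm_le_sum _)).
have : vsum (fun i => Rabs (mulmv A v i)) <= vsum (fun i => vnorm v * vnorm (A i)).
  by apply: vsum_le => i; rewrite Rmult_comm; exact: cauchy_schwarz_abs.
by rewrite vsumZ; have := vnorm_ge0 v; nra.
Qed.

Lemma vdot_right_eq n (u v : vec n) : (forall w, vdot u w = vdot v w) -> u = v.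
Proof. by move=> uv; apply: vec_ext => i; rewrite -!vdot_delta. Qed.

(** Expanding the squares leaves 2<a,b> <= s |b|^2 with s arbitrarily small. This first-order
    optimality condition serves every projection and minimal-norm choice below. *)
Lemma norm_min_dot n (a b : vec n) s0 : 0 < s0 ->
  (forall s, 0 < s <= s0 -> vnorm a <= vnorm (vsub a (vscale s b))) -> vdot a b <= 0.
Proof.
move=> s0p H; apply: Rnot_lt_le => ab.
have b0 := vdot_ge0 b.
set s := Rmin s0 (vdot a b / (1 + vdot b b)).
have q0 : 0 < vdot a b / (1 + vdot b b) by apply: Rdiv_lt_0_compat; lra.
have sp : 0 < s by rewrite /s; apply: Rmin_glb_lt.
have /H : 0 < s <= s0 by split=> //; exact: Rmin_l.
have : s * (1 + vdot b b) <= vdot a b.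
  have -> : vdot a b = vdot a b / (1 + vdot b b) * (1 + vdot b b) by field; lra.
  by apply: Rmult_le_compat_r; [lra | exact: Rmin_r].
move=> sb; have a0 := vnorm_ge0 a => /(fun H => Rmult_le_compat _ _ _ _ a0 a0 H H).
rewrite !vnorm_sq !vdotE (vdotC b a); nra.
Qed.

(** * Limits along an ultrafilter *)

Lemma choice_fun (T A : Type) (P : T -> A -> Prop) :
  (forall k, exists x, P k x) -> exists f : T -> A, forall k, P k (f k).
Proof.
move=> H; exists (fun k => proj1_sig (constructive_indefinite_description _ (H k))) => k.
exact: proj2_sig.
Qed.

(** The filter of eventually true predicates is extended to an ultrafilter; containing all tails
    makes limits along it agree with ordinary ones. *)
Lemma ultrafilter_nat : exists U : (nat -> Prop) -> Prop,
  [/\ forall N : nat, U (fun k => (N <= k)%N),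
      forall P Q : nat -> Prop, (forall k, P k -> Q k) -> U P -> U Q,
      forall P Q, U P -> U Q -> U (fun k => P k /\ Q k),
      ~ U (fun _ => False) &
      forall P, U P \/ U (fun k => ~ P k)].
Proof.
have [U [UU leU]] := filter.ultraFilterLemma filter.eventually_filter.
exists U; split.
- by move=> N; apply: leU; exists N.
- by move=> P Q PQ; apply: filter.filterS.
- by move=> P Q; apply: filter.filterI.
- exact: filter.filter_not_empty.
- by move=> P; exact: filter.in_ultra_setVsetC.
Qed.

(* A fixed nonprincipal ultrafilter on nat: limits along it exist for every
   bounded sequence, which replaces all extractions of subsequences. *)
Definition ult : (nat -> Prop) -> Prop :=
  proj1_sig (constructive_indefinite_description _ ultrafilter_nat).

Lemma ult_spec :
  [/\ forall N : nat, ult (fun k => (N <= k)%N),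
      forall P Q : nat -> Prop, (forall k, P k -> Q k) -> ult P -> ult Q,
      forall P Q, ult P -> ult Q -> ult (fun k => P k /\ Q k),
      ~ ult (fun _ => False) &
      forall P, ult P \/ ult (fun k => ~ P k)].
Proof. exact: proj2_sig (constructive_indefinite_description _ ultrafilter_nat). Qed.

Lemma ult_ge N : ult (fun k => (N <= k)%N).
Proof. by case: ult_spec. Qed.

Lemma ult_mono (P Q : nat -> Prop) : (forall k, P k -> Q k) -> ult P -> ult Q.
Proof. by case: ult_spec => _ H _ _ _; apply: H. Qed.

Lemma ult_mono2 (P Q S : nat -> Prop) :
  (forall k, P k -> Q k -> S k) -> ult P -> ult Q -> ult S.
Proof.
move=> PQS UP UQ; case: ult_spec => _ _ /(_ P Q UP UQ) H _ _.
by apply: ult_mono H => k [p q]; exact: PQS.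
Qed.

Lemma ult_mono3 (P Q S T : nat -> Prop) : (forall k, P k -> Q k -> S k -> T k) ->
  ult P -> ult Q -> ult S -> ult T.
Proof.
move=> PQST UP UQ; apply: (@ult_mono2 (fun k => P k /\ Q k)).
  by move=> k [p q] s; exact: PQST.
by apply: ult_mono2 UP UQ => k p q; split.
Qed.

Lemma ult_all (P : nat -> Prop) : (forall k, P k) -> ult P.
Proof. by move=> H; apply: ult_mono (ult_ge 0) => k _. Qed.

Lemma ult_ex (P : nat -> Prop) : ult P -> exists k, P k.
Proof.
move=> UP; case: (excluded_middle_informative (exists k, P k)) => // nP.
case: ult_spec => _ _ _ + _; case; apply: ult_mono UP => k Pk.
by apply: nP; exists k.
Qed.

Lemma ult_em (P : nat -> Prop) : ult P \/ ult (fun k => ~ P k).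
Proof. by case: ult_spec => _ _ _ _. Qed.

Lemma ult_const (P : Prop) : ult (fun _ => P) -> P.
Proof. by move=> /ult_ex[]. Qed.

Lemma ult_forall_ord n (P : 'I_n -> nat -> Prop) :
  (forall i, ult (P i)) -> ult (fun k => forall i, P i k).
Proof.
move=> H; suff: forall s : seq 'I_n, ult (fun k => forall i, i \in s -> P i k).
  move=> /(_ (enum 'I_n)); apply: ult_mono => k Hk i; apply: Hk.
  by rewrite mem_enum.
elim=> [|i s]; first by apply: ult_all.
apply: ult_mono2 (H i) => k Pi Ps j.
by rewrite in_cons => /orP[/eqP->|/Ps].
Qed.

Definition ulim (f : nat -> R) (a : R) :=
  forall eps, 0 < eps -> ult (fun k => Rabs (f k - a) < eps).

Lemma ulim_cst a : ulim (fun _ => a) a.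
Proof. by move=> e e0; apply: ult_all => k; rewrite Rminus_diag Rabs_R0. Qed.

Lemma ulim_ext f g a : ult (fun k => f k = g k) -> ulim f a -> ulim g a.
Proof. by move=> fg fa e /fa; apply: ult_mono2 fg => k ->. Qed.

Lemma ulim_eq f g a b : (forall k, f k = g k) -> a = b -> ulim f a -> ulim g b.
Proof. by move=> fg <-; apply: ulim_ext; exact: ult_all. Qed.

Lemma ulimD f g a b : ulim f a -> ulim g b -> ulim (fun k => f k + g k) (a + b).
Proof.
move=> fa gb e e0; have e2 : 0 < e / 2 by lra.
apply: ult_mono2 (fa _ e2) (gb _ e2) => k.
have -> : f k + g k - (a + b) = (f k - a) + (g k - b) by ring.
by have := Rabs_triang (f k - a) (g k - b); lra.
Qed.

Lemma ulim_bound f a : ulim f a -> ult (fun k => Rabs (f k) <= Rabs a + 1).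
Proof.
move=> /(_ 1 Rlt_0_1); apply: ult_mono => k.
have -> : Rabs (f k) = Rabs (f k - a + a) by congr Rabs; ring.
by have := Rabs_triang (f k - a) a; lra.
Qed.

Lemma ulim0_mul_bounded f g M : ulim f 0 -> ult (fun k => Rabs (g k) <= M) ->
  ulim (fun k => f k * g k) 0.
Proof.
move=> f0 gM e e0; have M0 : 0 <= M.
  by apply: (@ult_const (0 <= M)); apply: ult_mono gM => k; have := Rabs_pos (g k); lra.
have e1 : 0 < e / (M + 1) by apply: Rdiv_lt_0_compat; lra.
apply: ult_mono2 gM (f0 _ e1) => k gk; rewrite !Rminus_0_r Rabs_mult => fk.
have -> : e = e / (M + 1) * (M + 1) by field; lra.
by have := Rabs_pos (g k); have := Rabs_pos (f k); nra.
Qed.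

Lemma ulim_sub0 f a : ulim f a <-> ulim (fun k => f k - a) 0.
Proof. by split=> fa e /fa; apply: ult_mono => k; rewrite Rminus_0_r. Qed.

Lemma ulimZ c f a : ulim f a -> ulim (fun k => c * f k) (c * a).
Proof.
move=> /ulim_sub0 fa; apply/ulim_sub0.
have cM : ult (fun k => Rabs c <= Rabs c) by apply: ult_all => k; exact: Rle_refl.
by apply: ulim_eq (ulim0_mul_bounded fa cM) => [k|//]; ring.
Qed.

Lemma ulimN f a : ulim f a -> ulim (fun k => - f k) (- a).
Proof. by move=> /(ulimZ (-1)); apply: ulim_eq => [k|]; ring. Qed.

Lemma ulimB f g a b : ulim f a -> ulim g b -> ulim (fun k => f k - g k) (a - b).
Proof. by move=> fa /ulimN gb; exact: ulimD. Qed.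

Lemma ulimM f g a b : ulim f a -> ulim g b -> ulim (fun k => f k * g k) (a * b).
Proof.
move=> fa gb; have gM := ulim_bound gb.
have := ulim0_mul_bounded (proj1 (ulim_sub0 _ _) fa) gM.
move=> /ulimD /(_ (ulimZ a gb)).
by apply: ulim_eq => [k|]; ring.
Qed.

Lemma ulim_le f g a b : ulim f a -> ulim g b -> ult (fun k => f k <= g k) -> a <= b.
Proof.
move=> fa gb fg; apply: Rnot_lt_le => ba.
have e0 : 0 < (a - b) / 2 by lra.
have [k] := ult_ex (ult_mono3 (fun k x y z => conj x (conj y z)) fg (fa _ e0) (gb _ e0)).
by move=> [H [/Rabs_def2 ? /Rabs_def2 ?]]; lra.
Qed.

Lemma ulim_uniq f a b : ulim f a -> ulim f b -> a = b.
Proof.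
move=> fa fb; have ff : ult (fun k => f k <= f k) by apply: ult_all => k; exact: Rle_refl.
by apply: Rle_antisym; [exact: ulim_le fa fb ff | exact: ulim_le fb fa ff].
Qed.

Lemma ulim_squeeze0 f g : ult (fun k => Rabs (f k) <= g k) -> ulim g 0 -> ulim f 0.
Proof.
move=> fg g0 e /g0; apply: ult_mono2 fg => k; rewrite !Rminus_0_r => fg gk.
by have := Rle_abs (g k); lra.
Qed.

(** The limit is the supremum of the x that stay below [f] on a set of [ult]; the ultrafilter
    dichotomy turns both ways of missing it into a contradiction with the supremum. *)
Lemma ulim_exists f M : ult (fun k => Rabs (f k) <= M) -> exists a, ulim f a.
Proof.
move=> fM; pose E x := ult (fun k => x <= f k).
have [||a [ub lub]] := @completeness E.
- exists (M + 1) => x Ex; apply: Rnot_lt_le => Mx.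
  have [k [x1 x2]] := ult_ex (ult_mono2 (fun k x y => conj x y) Ex fM).
  by have := Rle_abs (f k); lra.
- by exists (- M); apply: ult_mono fM => k fk; have := Rle_abs (- f k); rewrite Rabs_Ropp; lra.
exists a => e e0.
have H1 : ult (fun k => a - e / 2 <= f k).
  case: (ult_em (fun k => a - e / 2 <= f k)) => // H.
  suff /lub : is_upper_bound E (a - e / 2) by lra.
  move=> x Ex; apply: Rnot_lt_le => ax.
  by have [k []] := ult_ex (ult_mono2 (fun k x y => conj x y) Ex H); lra.
have H2 : ult (fun k => ~ a + e / 2 <= f k).
  by case: (ult_em (fun k => a + e / 2 <= f k)) => // /ub; lra.
by apply: ult_mono2 H1 H2 => k ? ?; apply: Rabs_def1; lra.
Qed.

Lemma ulim_of_cv f a : Un_cv f a -> ulim f a.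
Proof.
move=> fa e /fa[N HN]; apply: ult_mono (ult_ge N) => k /leP Nk.
exact: HN.
Qed.

Lemma ulim_inv_succ : ulim (fun k => / (INR k + 1)) 0.
Proof.
move=> e e0; have [N [Ne N0]] := archimed_cor1 e e0.
apply: ult_mono (ult_ge N) => k Nk; rewrite Rminus_0_r.
have {}N0 : 0 < INR N by exact: lt_0_INR.
have {}Nk : INR N <= INR k by apply/le_INR/leP.
rewrite Rabs_pos_eq; last by apply/Rlt_le/Rinv_0_lt_compat; lra.
by apply: Rle_lt_trans Ne; apply: Rinv_le_contravar; lra.
Qed.

Lemma ulim_lt f a b : ulim f a -> a < b -> ult (fun k => f k < b).
Proof.
move=> fa ab; have e0 : 0 < b - a by lra.
by apply: ult_mono (fa _ e0) => k /Rabs_def2; lra.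
Qed.

Lemma ulim_gt f a b : ulim f a -> b < a -> ult (fun k => b < f k).
Proof.
move=> fa ab; have e0 : 0 < a - b by lra.
by apply: ult_mono (fa _ e0) => k /Rabs_def2; lra.
Qed.

Lemma ulim_vsum n (F : nat -> 'I_n -> R) (a : 'I_n -> R) :
  (forall i, ulim (fun k => F k i) (a i)) -> ulim (fun k => vsum (F k)) (vsum a).
Proof.
move=> Fa; rewrite /vsum; elim: (index_enum _) => [|i s IH].
  by apply: ulim_eq (ulim_cst 0) => [k|]; rewrite big_nil.
by apply: ulim_eq (ulimD (Fa i) IH) => [k|]; rewrite big_cons.
Qed.

Lemma ulim_abs0 f : ulim f 0 -> ulim (fun k => Rabs (f k)) 0.
Proof. by move=> f0 e /f0; apply: ult_mono => k; rewrite !Rminus_0_r Rabs_Rabsolu. Qed.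

(** * Vector limits and attained minima *)

Definition vlim {n} (w : nat -> vec n) (w0 : vec n) := forall i, ulim (fun k => w k i) (w0 i).

Lemma vlim_cst n (w : vec n) : vlim (fun _ => w) w.
Proof. by move=> i; exact: ulim_cst. Qed.

Lemma vlim_ext n (w v : nat -> vec n) a : ult (fun k => w k = v k) -> vlim w a -> vlim v a.
Proof. by move=> wv wa i; apply: ulim_ext (wa i); apply: ult_mono wv => k ->. Qed.

Lemma vlim_eq n (w v : nat -> vec n) a b : (forall k, w k = v k) -> a = b ->
  vlim w a -> vlim v b.
Proof. by move=> wv <-; apply: vlim_ext; exact: ult_all. Qed.

Lemma vlimD n (w v : nat -> vec n) a b : vlim w a -> vlim v b ->
  vlim (fun k => vadd (w k) (v k)) (vadd a b).
Proof. by move=> wa vb i; exact: ulimD. Qed.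

Lemma vlimB n (w v : nat -> vec n) a b : vlim w a -> vlim v b ->
  vlim (fun k => vsub (w k) (v k)) (vsub a b).
Proof. by move=> wa vb i; exact: ulimB. Qed.

Lemma vlimZ n (t : nat -> R) (w : nat -> vec n) s a : ulim t s -> vlim w a ->
  vlim (fun k => vscale (t k) (w k)) (vscale s a).
Proof. by move=> ts wa i; exact: ulimM. Qed.

Lemma ulim_vdot n (w v : nat -> vec n) a b : vlim w a -> vlim v b ->
  ulim (fun k => vdot (w k) (v k)) (vdot a b).
Proof. by move=> wa vb; apply: ulim_vsum => i; exact: ulimM. Qed.

Lemma vlim_mulmv a b (A : nat -> mat b a) A0 (w : nat -> vec a) w0 :
  (forall i j, ulim (fun k => A k i j) (A0 i j)) -> vlim w w0 ->
  vlim (fun k => mulmv (A k) (w k)) (mulmv A0 w0).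
Proof. by move=> AA ww i; apply: ulim_vsum => j; exact: ulimM. Qed.

Lemma vlim_mulmv_cst a b (A : mat b a) (w : nat -> vec a) w0 : vlim w w0 ->
  vlim (fun k => mulmv A (w k)) (mulmv A w0).
Proof. by move=> ww; apply: vlim_mulmv => // i j; exact: ulim_cst. Qed.

Lemma vlim_dist n (w : nat -> vec n) a :
  vlim w a <-> ulim (fun k => vnorm (vsub (w k) a)) 0.
Proof.
split=> [wa|H i]; last first.
  apply/ulim_sub0; apply: ulim_squeeze0 H; apply: ult_all => k.
  exact: (vnorm_coord (vsub (w k) a)).
have : ulim (fun k => vsum (fun i => Rabs (w k i - a i))) (vsum (fun i : 'I_n => 0)).
  by apply: ulim_vsum => i; apply: ulim_abs0; exact: (proj1 (ulim_sub0 _ _) (wa i)).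
rewrite (_ : vsum _ = 0); last exact: vsum0.
apply: ulim_squeeze0; apply: ult_all => k.
by rewrite Rabs_pos_eq; [exact: (vnorm_le_sum (vsub (w k) a)) | exact: vnorm_ge0].
Qed.

Lemma vnorm_dist n (u v : vec n) : Rabs (vnorm u - vnorm v) <= vnorm (vsub u v).
Proof.
apply: Rabs_le; split.
  have := vnorm_triang u (vsub v u); rewrite (vnorm_subC v u).
  have -> : vadd u (vsub v u) = v by vring.
  by lra.
have := vnorm_triang v (vsub u v).
have -> : vadd v (vsub u v) = u by vring.
by lra.
Qed.

Lemma ulim_vnorm n (w : nat -> vec n) a : vlim w a -> ulim (fun k => vnorm (w k)) (vnorm a).
Proof.
move=> /vlim_dist H; apply/ulim_sub0; apply: ulim_squeeze0 H.
by apply: ult_all => k; exact: vnorm_dist.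
Qed.

Lemma vlim_exists n (w : nat -> vec n) M :
  ult (fun k => vnorm (w k) <= M) -> exists a, vlim w a.
Proof.
move=> wM; have H i : exists a, ulim (fun k => w k i) a.
  apply: (@ulim_exists _ M); apply: ult_mono wM => k.
  by have := vnorm_coord (w k) i; lra.
exists (fun i => proj1_sig (constructive_indefinite_description _ (H i))) => i.
by case: (constructive_indefinite_description _ (H i)).
Qed.

Lemma vlim_uniq n (w : nat -> vec n) a b : vlim w a -> vlim w b -> a = b.
Proof. by move=> wa wb; apply: vec_ext => i; exact: ulim_uniq (wa i) (wb i). Qed.

Lemma vlim_closed n (A : vec n -> Prop) w a :
  is_closed A -> vlim w a -> ult (fun k => A (w k)) -> A a.
Proof.
move=> clA /vlim_dist wa wA; apply: clA => e /wa {}wa.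
have [k [Ak]] := ult_ex (ult_mono2 (fun k x y => conj x y) wA wa).
rewrite Rminus_0_r Rabs_pos_eq; last exact: vnorm_ge0.
by move=> ?; exists (w k).
Qed.

Lemma vlim_norm_lt n (w : nat -> vec n) a r : vlim w a -> 0 < r ->
  ult (fun k => vnorm (vsub (w k) a) < r).
Proof. by move=> /vlim_dist wa; exact: ulim_lt. Qed.

(** Boundedness is asked only on the sublevel set of [w0] and continuity only along sequences inside
    [A], because [phi] may be a residual that is differentiable merely near the reference point. *)
Lemma closed_attains_min n (A : vec n -> Prop) (phi : vec n -> R) w0 M :
  is_closed A -> A w0 ->
  (forall w, A w -> 0 <= phi w) ->
  (forall w, A w -> phi w <= phi w0 -> vnorm w <= M) ->
  (forall w a, A a -> (forall k : nat, A (w k)) -> vlim w a ->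
    ulim (fun k => phi (w k)) (phi a)) ->
  exists a, A a /\ forall w, A w -> phi a <= phi w.
Proof.
move=> clA A0 phi0 coe cont.
pose E x := exists w, A w /\ x = - phi w.
have [||s [ub lub]] := @completeness E.
- by exists 0 => _ [w [/phi0 ? ->]]; lra.
- by exists (- phi w0), w0.
have near k : exists w, A w /\ phi w <= phi w0 /\ phi w <= - s + / (INR k + 1).
  have k0 : 0 < / (INR k + 1) by apply: Rinv_0_lt_compat; have := pos_INR k; lra.
  case: (excluded_middle_informative (exists w, A w /\ phi w < - s + / (INR k + 1))).
    (* A point above the level of [w0] is replaced by [w0], so the minimising sequence stays in the
       bounded sublevel set. *)
    move=> [w [Aw ws]]; case: (Rle_lt_dec (phi w) (phi w0)) => ww0.
      by exists w; split=> //; lra.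
    by exists w0; split=> //; lra.
  move=> nE; suff /lub : is_upper_bound E (s - / (INR k + 1)) by lra.
  move=> _ [w [Aw ->]]; apply: Rnot_lt_le => H; apply: nE; exists w; split=> //; lra.
have [w Hw] := choice_fun near.
have [a wa] : exists a, vlim w a.
  by apply: (@vlim_exists _ _ M); apply: ult_all => k; have [Aw [? _]] := Hw k; apply: coe.
have Aa : A a by apply: vlim_closed clA wa _; apply: ult_all => k; have [] := Hw k.
exists a; split=> // v Av.
have ca : ulim (fun k => phi (w k)) (phi a) by apply: cont => // k; have [] := Hw k.
have : phi a <= - s + 0.
  apply: (ulim_le ca (ulimD (ulim_cst (- s)) ulim_inv_succ)).
  by apply: ult_all => k; have [_ []] := Hw k.
suff : - phi v <= s by lra.
by apply: ub; exists v.
Qed.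

Lemma closed_of_vlim n (A : vec n -> Prop) :
  (forall w a, (forall k : nat, A (w k)) -> vlim w a -> A a) -> is_closed A.
Proof.
move=> H y near.
have pos k : 0 < / (INR k + 1) by apply: Rinv_0_lt_compat; have := pos_INR k; lra.
have [w Hw] := choice_fun (fun k => near _ (pos k)).
apply: (H w) => [k|]; first by have [] := Hw k.
apply/vlim_dist; apply: ulim_squeeze0 ulim_inv_succ; apply: ult_all => k.
by rewrite Rabs_pos_eq; [have [] := Hw k; lra | exact: vnorm_ge0].
Qed.

(** * Derivatives *)

Definition quot {a b} (F : vec a -> vec b) (x : vec a) (t : R) (v : vec a) : vec b :=
  vscale (/ t) (vsub (F (vadd x (vscale t v))) (F x)).

Lemma quotE a b (F : vec a -> vec b) x t v : 0 < t ->
  F (vadd x (vscale t v)) = vadd (F x) (vscale t (quot F x t v)).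
Proof. by move=> t0; apply: vec_ext => i; rewrite /quot /vadd /vscale /vsub; field; lra. Qed.

(** The directions [v k] vary with k; in this form the derivative composes and applies directly to
    points x_k = xbar + t_k us_k. *)
Lemma has_jac_lim a b (F : vec a -> vec b) J x t v v0 : has_jac F J x ->
  (forall k : nat, 0 < t k) -> ulim t 0 -> vlim v v0 ->
  vlim (fun k => quot F x (t k) (v k)) (mulmv J v0).
Proof.
move=> FJ t0 tl vl; have vb := ulim_bound (ulim_vnorm vl).
set M := Rabs _ + 1 in vb.
have M0 : 0 < M by rewrite /M; have := Rabs_pos (vnorm v0); lra.
have tv : ulim (fun k => vnorm (vscale (t k) (v k))) 0.
  apply: ulim_eq (ulimM tl (ulim_vnorm vl)) => [k|]; last by ring.
  by rewrite vnormZ Rabs_pos_eq //; exact: Rlt_le.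
suff H : vlim (fun k => vsub (quot F x (t k) (v k)) (mulmv J (v k))) vzero.
  by apply: vlim_eq (vlimD H (vlim_mulmv_cst J vl)) => [k|]; vring.
apply/vlim_dist => e e0; have e1 : 0 < e / (2 * M) by apply: Rdiv_lt_0_compat; lra.
have [d [d0 Hd]] := FJ _ e1.
apply: ult_mono2 (ulim_lt tv d0) vb => k /Hd H vM.
have tk := t0 k; rewrite Rabs_pos_eq in vM; last exact: vnorm_ge0.
rewrite Rminus_0_r Rabs_pos_eq; last exact: vnorm_ge0.
rewrite (_ : vsub _ vzero = vscale (/ t k) (vsub (vsub (F (vadd x (vscale (t k) (v k)))) (F x))
   (mulmv J (vscale (t k) (v k))))); last first.
  by rewrite mulmvZ; apply: vec_ext => i; rewrite /quot /vsub /vscale /vzero; field; lra.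
have ti : 0 < / t k by exact: Rinv_0_lt_compat.
rewrite vnormZ Rabs_pos_eq; last lra.
rewrite vnormZ Rabs_pos_eq in H; last lra.
have {}H := Rmult_le_compat_l _ _ _ (Rlt_le _ _ ti) H.
apply: (Rle_lt_trans _ _ _ H).
rewrite (_ : / t k * _ = e / (2 * M) * vnorm (v k)); last by field; lra.
apply: (@Rle_lt_trans _ (e / (2 * M) * M)); first by apply: Rmult_le_compat_l; lra.
by rewrite (_ : e / (2 * M) * M = e / 2); [lra | field; lra].
Qed.

(** In finite dimension quotient limits give back Frechet differentiability: bad increments, once
    normalised, have a limiting direction along which the quotients converge. *)
Lemma lim_has_jac a b (F : vec a -> vec b) J x :
  (forall t v v0, (forall k : nat, 0 < t k) -> ulim t 0 -> vlim v v0 ->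
     vlim (fun k => quot F x (t k) (v k)) (mulmv J v0)) -> has_jac F J x.
Proof.
move=> H e e0.
case: (excluded_middle_informative (exists delta, 0 < delta /\
    forall h : vec a, vnorm h < delta ->
      vnorm (vsub (vsub (F (vadd x h)) (F x)) (mulmv J h)) <= e * vnorm h)) => // nE.
have bad k : exists h : vec a, vnorm h < / (INR k + 1) /\
    e * vnorm h < vnorm (vsub (vsub (F (vadd x h)) (F x)) (mulmv J h)).
  case: (excluded_middle_informative (exists h : vec a, vnorm h < / (INR k + 1) /\
    e * vnorm h < vnorm (vsub (vsub (F (vadd x h)) (F x)) (mulmv J h)))) => // nh.
  case: nE; exists (/ (INR k + 1)); split.
    by apply: Rinv_0_lt_compat; have := pos_INR k; lra.
  by move=> h hk; apply: Rnot_lt_le => H1; apply: nh; exists h.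
have [h Hh] := choice_fun bad.
have h0 k : 0 < vnorm (h k).
  apply: vnorm_gt0 => hk; have [_] := Hh k; rewrite hk vnorm0 mulmv0.
  rewrite (_ : vsub _ _ = vzero) ?vnorm0; first by lra.
  by rewrite (_ : vadd x vzero = x); vring.
pose v k := vscale (/ vnorm (h k)) (h k).
have v1 k : vnorm (v k) = 1.
  rewrite /v vnormZ Rabs_pos_eq; first by field; have := h0 k; lra.
  exact/Rlt_le/Rinv_0_lt_compat.
have hE k : h k = vscale (vnorm (h k)) (v k).
  by apply: vec_ext => i; rewrite /v /vscale; field; have := h0 k; lra.
have [v0 vl] : exists v0, vlim v v0.
  by apply: (@vlim_exists _ _ 1); apply: ult_all => k; rewrite v1; lra.
have hl : ulim (fun k => vnorm (h k)) 0.
  apply: ulim_squeeze0 ulim_inv_succ; apply: ult_all => k.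
  by rewrite Rabs_pos_eq; [have [] := Hh k; lra | exact: vnorm_ge0].
have /vlimB /(_ (vlim_mulmv_cst J vl)) /ulim_vnorm := H _ _ _ h0 hl vl.
rewrite (_ : vsub _ _ = vzero) ?vnorm0; last by vring.
move=> /ulim_lt /(_ e0) /ult_ex[k]; have [_ +] := Hh k.
rewrite {2}(hE k) {3}(hE k) mulmvZ.
rewrite (_ : vsub _ _ = vscale (vnorm (h k))
   (vsub (quot F x (vnorm (h k)) (v k)) (mulmv J (v k)))); last first.
  apply: vec_ext => i; rewrite /quot /vsub /vscale; field; have := h0 k; lra.
rewrite vnormZ Rabs_pos_eq; last exact: vnorm_ge0.
by have := h0 k; nra.
Qed.

(** The increment of [E] is again t times a convergent direction, so the chain rule is a
    substitution of one quotient limit into the other. *)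
Lemma has_jac_comp a b c (F : vec b -> vec c) (E : vec a -> vec b) A B x :
  has_jac F A (E x) -> has_jac E B x -> has_jac (fun z => F (E z)) (matmul A B) x.
Proof.
move=> FA EB; apply: lim_has_jac => t v v0 t0 tl vl.
have := has_jac_lim FA t0 tl (has_jac_lim EB t0 tl vl).
by apply: vlim_eq => [k|]; rewrite ?mulmv_matmul // {1}/quot -quotE.
Qed.

Lemma has_jac2_lim a b (DF : vec a -> mat b a) T x t v v0 : has_jac2 DF T x ->
  (forall k : nat, 0 < t k) -> ulim t 0 -> vlim v v0 -> forall i j,
  ulim (fun k => / t k * (DF (vadd x (vscale (t k) (v k))) i j - DF x i j))
       (vsum (fun l => T i j l * v0 l)).
Proof.
move=> FJ t0 tl vl i j; have vb := ulim_bound (ulim_vnorm vl).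
set M := Rabs _ + 1 in vb.
have M0 : 0 < M by rewrite /M; have := Rabs_pos (vnorm v0); lra.
have tv : ulim (fun k => vnorm (vscale (t k) (v k))) 0.
  apply: ulim_eq (ulimM tl (ulim_vnorm vl)) => [k|]; last by ring.
  by rewrite vnormZ Rabs_pos_eq //; exact: Rlt_le.
have Tl : ulim (fun k => vsum (fun l => T i j l * v k l)) (vsum (fun l => T i j l * v0 l)).
  by apply: ulim_vsum => l; apply: ulimM => //; exact: ulim_cst.
suff H : ulim (fun k => / t k * (DF (vadd x (vscale (t k) (v k))) i j - DF x i j)
    - vsum (fun l => T i j l * v k l)) 0.
  by apply: ulim_eq (ulimD H Tl) => [k|]; ring.
move=> e e0; have e1 : 0 < e / (2 * M) by apply: Rdiv_lt_0_compat; lra.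
have [d [d0 Hd]] := FJ _ e1.
apply: ult_mono2 (ulim_lt tv d0) vb => k /Hd /(_ i j) H vM.
have tk := t0 k; rewrite Rabs_pos_eq in vM; last exact: vnorm_ge0.
have ti : 0 < / t k by exact: Rinv_0_lt_compat.
rewrite (_ : _ - 0 = / t k * (DF (vadd x (vscale (t k) (v k))) i j - DF x i j
   - vsum (fun l => T i j l * vscale (t k) (v k) l))); last first.
  rewrite (_ : vsum (fun l => T i j l * vscale (t k) (v k) l) =
    t k * vsum (fun l => T i j l * v k l)); first by field; lra.
  by rewrite -vsumZ; apply: vsum_ext => l; rewrite /vscale; ring.
rewrite Rabs_mult (Rabs_pos_eq (/ _)); last lra.
rewrite vnormZ (Rabs_pos_eq (t k)) in H; last lra.
have {}H := Rmult_le_compat_l _ _ _ (Rlt_le _ _ ti) H.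
apply: (Rle_lt_trans _ _ _ H).
rewrite (_ : / t k * _ = e / (2 * M) * vnorm (v k)); last by field; lra.
apply: (@Rle_lt_trans _ (e / (2 * M) * M)); first by apply: Rmult_le_compat_l; lra.
by rewrite (_ : e / (2 * M) * M = e / 2); [lra | field; lra].
Qed.

Lemma has_jac2_cont a b (DF : vec a -> mat b a) T x (y : nat -> vec a) : has_jac2 DF T x ->
  vlim y x -> forall i j, ulim (fun k => DF (y k) i j) (DF x i j).
Proof.
move=> FJ yl i j.
have [d [d0 Hd]] := FJ _ Rlt_0_1.
have yd : vlim (fun k => vsub (y k) x) vzero.
  by apply: vlim_eq (vlimB yl (vlim_cst x)) => [k|]; vring.
have yx k : vadd x (vsub (y k) x) = y k by vring.
have H1 : ulim (fun k => vsum (fun l => T i j l * vsub (y k) x l)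
   + vnorm (vsub (y k) x)) 0.
  have L : ulim (fun k => vsum (fun l => T i j l * vsub (y k) x l))
      (vsum (fun l => T i j l * @vzero a l)).
    by apply: ulim_vsum => l; apply: ulimM => //; exact: ulim_cst.
  apply: ulim_eq (ulimD L (ulim_vnorm yd)) => //.
  by rewrite vnorm0 vsum0 ?Rplus_0_r // => l; rewrite /vzero; ring.
have H2 : ulim (fun k => DF (y k) i j - DF x i j - vsum (fun l => T i j l * vsub (y k) x l)) 0.
  apply: (@ulim_squeeze0 _ (fun k => vnorm (vsub (y k) x))).
    apply: ult_mono (vlim_norm_lt yl d0) => k /Hd /(_ i j).
    by rewrite yx Rmult_1_l.
  by rewrite -(vnorm0 a); exact: ulim_vnorm.
have := ulimD (ulimB (ulimD H2 H1) (ulim_vnorm yd)) (ulim_cst (DF x i j)).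
by apply: ulim_eq => [k|]; rewrite ?vnorm0; ring.
Qed.

Lemma has_jac_cont a b (F : vec a -> vec b) J x (y : nat -> vec a) : has_jac F J x ->
  vlim y x -> vlim (fun k => F (y k)) (F x).
Proof.
move=> FJ yl; have [d [d0 Hd]] := FJ _ Rlt_0_1.
have yd : vlim (fun k => vsub (y k) x) vzero.
  by apply: vlim_eq (vlimB yl (vlim_cst x)) => [k|]; vring.
have yx k : vadd x (vsub (y k) x) = y k by vring.
have H2 : vlim (fun k => vsub (vsub (F (y k)) (F x)) (mulmv J (vsub (y k) x))) vzero.
  apply/vlim_dist; apply: (@ulim_squeeze0 _ (fun k => vnorm (vsub (y k) x))).
    apply: ult_mono (vlim_norm_lt yl d0) => k /Hd.
    rewrite yx Rmult_1_l Rabs_pos_eq; last exact: vnorm_ge0.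
    by rewrite (_ : vsub (vsub (vsub (F (y k)) (F x)) (mulmv J (vsub (y k) x))) vzero =
      vsub (vsub (F (y k)) (F x)) (mulmv J (vsub (y k) x))) //; vring.
  by rewrite -(vnorm0 a); exact: ulim_vnorm.
have := vlimD (vlimD H2 (vlim_mulmv_cst J yd)) (vlim_cst (F x)).
by apply: vlim_eq => [k|]; rewrite ?mulmv0; vring.
Qed.

(* The derivative in direction v of the chain rule expression D(F o E) = DF(E) DE, where
   A, B are the Jacobians of F, E and T2, T1 their second derivatives. *)
Definition comp_hess {a b c} (T2 : tensor c b) (T1 : tensor b a) (A : mat c b) (B : mat b a)
    (v : vec a) : mat c a := fun i j =>
  vsum (fun p => vsum (fun q => T2 i p q * mulmv B v q) * B p j) +
  vsum (fun p => A i p * vsum (fun q => T1 p j q * v q)).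

Lemma comp_hess_lim a b c (DF : vec b -> mat c b) (E : vec a -> vec b) (DE : vec a -> mat b a)
    T2 T1 x t v v0 :
  has_jac2 DF T2 (E x) -> has_jac E (DE x) x -> has_jac2 DE T1 x ->
  (forall k : nat, 0 < t k) -> ulim t 0 -> vlim v v0 -> forall i j,
  ulim (fun k => / t k * (matmul (DF (E (vadd x (vscale (t k) (v k)))))
                                 (DE (vadd x (vscale (t k) (v k)))) i j
                          - matmul (DF (E x)) (DE x) i j))
    (comp_hess T2 T1 (DF (E x)) (DE x) v0 i j).
Proof.
move=> FT EB ET t0 tl vl i j.
have El := has_jac_lim EB t0 tl vl.
have yl : vlim (fun k => vadd x (vscale (t k) (v k))) x.
  by apply: vlim_eq (vlimD (vlim_cst x) (vlimZ tl vl)) => [k|]; vring.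
(* Discrete Leibniz rule: the increment of [DF] meets the new value of [DE], the increment of [DE]
   the old value of [DF]. *)
have L p : ulim (fun k => / t k * (DF (E (vadd x (vscale (t k) (v k)))) i p - DF (E x) i p)
     * DE (vadd x (vscale (t k) (v k))) p j
     + DF (E x) i p * (/ t k * (DE (vadd x (vscale (t k) (v k))) p j - DE x p j)))
   (vsum (fun q => T2 i p q * mulmv (DE x) v0 q) * DE x p j
    + DF (E x) i p * vsum (fun q => T1 p j q * v0 q)).
  apply: ulimD; last by apply: ulimZ; exact: has_jac2_lim ET t0 tl vl p j.
  apply: ulimM; last exact: has_jac2_cont ET yl p j.
  have := has_jac2_lim FT t0 tl El i p.
  by apply: ulim_eq => // k; rewrite -quotE.
have := ulim_vsum L; rewrite vsumD; apply: ulim_eq => // k.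
rewrite /matmul -vsumB -vsumZ; apply: vsum_ext => p; ring.
Qed.

Lemma has_jac_line a b (F : vec a -> vec b) J x w s i :
  has_jac F J (vadd x (vscale s w)) ->
  derivable_pt_lim (fun s => F (vadd x (vscale s w)) i) s (mulmv J w i).
Proof.
move=> FJ e e0; have w0 := vnorm_ge0 w.
have e1 : 0 < e / (vnorm w + 1) by apply: Rdiv_lt_0_compat; lra.
have [d [d0 Hd]] := FJ _ e1.
have d1 : 0 < d / (vnorm w + 1) by apply: Rdiv_lt_0_compat; lra.
exists (mkposreal _ d1) => k k0 /= kd.
have kp := Rabs_pos_lt _ k0.
have kw : Rabs k * vnorm w < d.
  have : Rabs k * (vnorm w + 1) < d / (vnorm w + 1) * (vnorm w + 1).
    by apply: Rmult_lt_compat_r; lra.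
  by rewrite (_ : d / (vnorm w + 1) * (vnorm w + 1) = d); [nra | field; lra].
have := Hd (vscale k w); rewrite vnormZ => /(_ kw).
rewrite (_ : vadd (vadd x (vscale s w)) (vscale k w) = vadd x (vscale (s + k) w)); last by vring.
set D := vsub _ _ => HD.
have DE : D i = F (vadd x (vscale (s + k) w)) i - F (vadd x (vscale s w)) i - k * mulmv J w i.
  by rewrite /D mulmvZ.
have Di := vnorm_coord D i.
rewrite (_ : _ - mulmv J w i = D i / k); last by rewrite DE; field.
rewrite /Rdiv Rabs_mult Rabs_inv; apply: (Rmult_lt_reg_r (Rabs k)) => //.
rewrite Rmult_assoc Rinv_l ?Rmult_1_r; last lra.
apply: (Rle_lt_trans _ _ _ Di); apply: (Rle_lt_trans _ _ _ HD).
rewrite (_ : e * Rabs k = e / (vnorm w + 1) * (Rabs k * (vnorm w + 1))); last by field; lra.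
by apply: Rmult_lt_compat_l => //; nra.
Qed.

Lemma quadratic_deriv A c s :
  derivable_pt_lim (fun s => s * A + s * s * c) s (A + 2 * s * c).
Proof.
move=> e e0; have c0 := Rabs_pos c.
have d0 : 0 < e / (Rabs c + 1) by apply: Rdiv_lt_0_compat; lra.
exists (mkposreal _ d0) => k k0 /= kd.
rewrite (_ : _ - _ = k * c); last by field.
rewrite Rabs_mult.
have : Rabs k * (Rabs c + 1) < e / (Rabs c + 1) * (Rabs c + 1).
  by apply: Rmult_lt_compat_r; lra.
rewrite (_ : e / (Rabs c + 1) * (Rabs c + 1) = e); last by field; lra.
by have := Rabs_pos k; nra.
Qed.

(** The mean value theorem reduces the second-order remainder to quotients of [DF] based at [x]
    itself, so their directional limits suffice; [B v0] is the second derivative contracted with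
    [v0]. *)
Lemma taylor2_lim a b (F : vec a -> vec b) (DF : vec a -> mat b a) (B : vec a -> mat b a)
    x r t v v0 i :
  0 < r -> (forall y, vnorm (vsub y x) < r -> has_jac F (DF y) y) ->
  (forall t v v0, (forall k : nat, 0 < t k) -> ulim t 0 -> vlim v v0 -> forall i j,
    ulim (fun k => / t k * (DF (vadd x (vscale (t k) (v k))) i j - DF x i j)) (B v0 i j)) ->
  (forall k : nat, 0 < t k) -> ulim t 0 -> vlim v v0 ->
  ulim (fun k => / t k * (/ t k * (F (vadd x (vscale (t k) (v k))) i - F x i)
                          - mulmv (DF x) (v k) i))
       (/ 2 * mulmv (B v0) v0 i).
Proof.
move=> r0 FJ HB t0 tl vl.
set c := mulmv (B v0) v0 i.
(* The mean value theorem is applied to F on the segment minus its expected quadratic model in s. If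
   the segment leaves the ball the claim is void and s is arbitrary. *)
have mvt k : exists s, 0 < s < 1 /\ (vnorm (vscale (t k) (v k)) < r ->
  F (vadd x (vscale (t k) (v k))) i - F x i - t k * mulmv (DF x) (v k) i - / 2 * (t k * t k * c) =
  t k * mulmv (DF (vadd x (vscale (s * t k) (v k)))) (v k) i
   - t k * mulmv (DF x) (v k) i - s * (t k * t k * c)).
  case: (Rlt_le_dec (vnorm (vscale (t k) (v k))) r) => H; last by exists (/ 2); split; lra.
  set w := vscale (t k) (v k) in H *.
  have [||s [Hs s01]] := @MVT_cor2 (fun s => F (vadd x (vscale s w)) i -
      (s * (t k * mulmv (DF x) (v k) i) + s * s * (/ 2 * (t k * t k * c))))
    (fun s => mulmv (DF (vadd x (vscale s w))) w i -
      (t k * mulmv (DF x) (v k) i + 2 * s * (/ 2 * (t k * t k * c)))) 0 1.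
  - lra.
  - move=> s s01; apply: derivable_pt_lim_minus; last exact: quadratic_deriv.
    apply: has_jac_line; apply: FJ.
    rewrite (_ : vsub _ _ = vscale s w); last by vring.
    rewrite vnormZ Rabs_pos_eq; last lra.
    by have := vnorm_ge0 w; nra.
  exists s; split=> // _; move: Hs.
  rewrite (_ : vscale 1 w = w); last by vring.
  rewrite (_ : vadd x (vscale 0 w) = x); last by vring.
  rewrite (_ : vscale s w = vscale (s * t k) (v k)); last by rewrite /w; vring.
  have -> D : mulmv D w i = t k * mulmv D (v k) i by rewrite /w mulmvZ.
  by rewrite -/w; lra.
have [s Hs] := choice_fun mvt.
have st0 k : 0 < s k * t k by have [? _] := Hs k; apply: Rmult_lt_0_compat; [lra|].
have stl : ulim (fun k => s k * t k) 0.
  apply: ulim_squeeze0 tl; apply: ult_all => k; have [? _] := Hs k.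
  by rewrite Rabs_pos_eq; have := t0 k; nra.
have L := ulim_vsum (fun j => ulimM (HB _ _ _ st0 stl vl i j) (vl j)).
(* Of s_k only 0 < s_k < 1 is known; it multiplies a null sequence, so boundedness is enough. *)
have L0 : ulim (fun k => (vsum (fun j => / (s k * t k) *
    (DF (vadd x (vscale (s k * t k) (v k))) i j - DF x i j) * v k j) - c) * s k) 0.
  apply: (@ulim0_mul_bounded _ _ 1).
    by apply: ulim_eq (ulimB L (ulim_cst c)) => //; rewrite /c /mulmv; ring.
  by apply: ult_all => k; have [? _] := Hs k; rewrite Rabs_pos_eq; lra.
have tv : ulim (fun k => vnorm (vscale (t k) (v k))) 0.
  apply: ulim_eq (ulimM tl (ulim_vnorm vl)) => [k|]; last by ring.
  by rewrite vnormZ Rabs_pos_eq //; exact: Rlt_le.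
have L1 := ulimD L0 (ulim_cst (/ 2 * c)); rewrite Rplus_0_l in L1.
apply: ulim_ext L1; apply: ult_mono (ulim_lt tv r0) => k tvk.
have [s01 /(_ tvk) Hk] := Hs k; have tk := t0 k; have stk := st0 k.
set S := vsum _.
have ES : s k * t k * S = mulmv (DF (vadd x (vscale (s k * t k) (v k)))) (v k) i
    - mulmv (DF x) (v k) i.
  rewrite /mulmv /S -vsumZ -vsumB; apply: vsum_ext => j; field; lra.
apply: (Rmult_eq_reg_l (t k * t k)); last nra.
rewrite (_ : t k * t k * (/ t k * (_ - _)) = F (vadd x (vscale (t k) (v k))) i - F x i
   - t k * mulmv (DF x) (v k) i); last by field; lra.
by nra.
Qed.

(** * Polar cones and metric regularity *)

Definition polar {n} (K : vec n -> Prop) : vec n -> Prop :=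
  fun mu => forall y, K y -> vdot mu y <= 0.

Lemma polar_add n (K : vec n -> Prop) mu nu : polar K mu -> polar K nu -> polar K (vadd mu nu).
Proof. by move=> Kmu Knu y Ky; rewrite vdotDl; have := Kmu y Ky; have := Knu y Ky; lra. Qed.

Lemma polar_scale n (K : vec n -> Prop) t mu : 0 <= t -> polar K mu -> polar K (vscale t mu).
Proof. by move=> t0 Kmu y Ky; rewrite vdotZl; have := Kmu y Ky; nra. Qed.

Lemma polar_lim n (K : vec n -> Prop) (w : nat -> vec n) a :
  vlim w a -> ult (fun k => polar K (w k)) -> polar K a.
Proof.
move=> wa wK y Ky; apply: (ulim_le (ulim_vdot wa (vlim_cst y)) (ulim_cst 0)).
by apply: ult_mono wK => k /(_ y Ky).
Qed.

Lemma polar_closed n (K : vec n -> Prop) : is_closed (polar K).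
Proof. by apply: closed_of_vlim => w a Kw wa; apply: polar_lim wa _; exact: ult_all. Qed.

(** Moreau decomposition. The residual is orthogonal to [e] because 0 and 2 e are both competitors
    in the cone. *)
Lemma cone_projection n (K : vec n -> Prop) a : closed_convex_cone K ->
  exists e, [/\ K e, vdot (vsub a e) e = 0 & polar K (vsub a e)].
Proof.
move=> KK; have [clK [cv [K0 cone]]] := KK.
have [||e [Ke emin]] := @closed_attains_min _ K (fun w => vnorm (vsub a w)) vzero
  (2 * vnorm a) clK K0 (fun w _ => vnorm_ge0 _).
- move=> w Kw; rewrite (_ : vsub a vzero = a); last by vring.
  have := vnorm_triang (vsub w a) a; rewrite (_ : vadd _ _ = w); last by vring.
  by rewrite (vnorm_subC w a); lra.
- by move=> w b _ _ wb; apply: ulim_vnorm; apply: vlimB => //; exact: vlim_cst.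
have VI k : K k -> vdot (vsub a e) (vsub k e) <= 0.
  move=> Kk; apply: (@norm_min_dot _ _ _ 1); first lra.
  move=> s s01; have /emin : K (vadd (vscale s k) (vscale (1 - s) e)) by apply: cv => //; lra.
  by congr (_ <= vnorm _); vring.
have e0 : vdot (vsub a e) e = 0.
  have := VI _ K0; have := VI _ (cone 2 _ ltac:(lra) Ke).
  by rewrite !vdotBr vdot0r vdotZr; lra.
by exists e; split=> // k /VI; rewrite vdotBr; lra.
Qed.

Lemma right_inverse a b (A : mat b a) : (forall e, exists y, mulmv A y = e) ->
  exists B : mat a b, forall e, mulmv A (mulmv B e) = e.
Proof.
move=> surj; have [Y HY] := choice_fun (fun j => surj (vdelta j)).
exists (fun i j => Y j i) => e; rewrite -mulmv_matmul; apply: vec_ext => p.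
rewrite /mulmv -[RHS](vsum_delta p); apply: vsum_ext => j; rewrite Rmult_comm.
by have := f_equal (fun v => v p) (HY j); rewrite /mulmv /matmul => ->; rewrite /vdelta eq_sym.
Qed.

Lemma has_jac_lip a b (F : vec a -> vec b) J x : has_jac F J x ->
  exists c delta, [/\ 0 < c, 0 < delta &
    forall y, vnorm (vsub y x) < delta -> vnorm (vsub (F y) (F x)) <= c * vnorm (vsub y x)].
Proof.
move=> /(_ 1 Rlt_0_1)[d [d0 Hd]]; have [c [c0 Hc]] := mulmv_bound J.
exists (c + 1), d; split=> // [|y /Hd]; first lra.
rewrite (_ : vadd x (vsub y x) = y); last by vring.
have := vnorm_triang (vsub (vsub (F y) (F x)) (mulmv J (vsub y x))) (mulmv J (vsub y x)).
rewrite (_ : vadd _ _ = vsub (F y) (F x)); last by vring.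
by have := Hc (vsub y x); lra.
Qed.

Lemma has_jac2_op_cont a b (DF : vec a -> mat b a) T x eps : has_jac2 DF T x -> 0 < eps ->
  exists delta, 0 < delta /\ forall y, vnorm (vsub y x) < delta -> forall w,
    vnorm (vsub (mulmv (DF y) w) (mulmv (DF x) w)) <= eps * vnorm w.
Proof.
move=> /(_ 1 Rlt_0_1)[d [d0 Hd]] e0.
(* Lipschitz constant of [DF] at [x] summed over the entries: |T i j| from the derivative plus 1
   from the remainder with tolerance 1. *)
set c := vsum (fun i => vsum (fun j => vnorm (T i j) + 1)).
have c0 : 0 <= c.
  by apply: vsum_ge0 => i; apply: vsum_ge0 => j; have := vnorm_ge0 (T i j); lra.
have e1 : 0 < eps / (c + 1) by apply: Rdiv_lt_0_compat; lra.
exists (Rmin d (eps / (c + 1))); split=> [|y yx w]; first exact: Rmin_glb_lt.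
have {}Hd := Hd _ (Rlt_le_trans _ _ _ yx (Rmin_l _ _)).
have {yx}yx := Rlt_le_trans _ _ _ yx (Rmin_r _ _).
rewrite (_ : vadd x (vsub y x) = y) in Hd; last by vring.
set r := vnorm (vsub y x) in yx Hd; have r0 : 0 <= r by exact: vnorm_ge0.
apply: (Rle_trans _ _ _ (vnorm_le_sum _)); apply: (@Rle_trans _ (c * r * vnorm w)); last first.
  apply: Rmult_le_compat_r; first exact: vnorm_ge0.
  have : (c + 1) * r <= eps / (c + 1) * (c + 1) by nra.
  by rewrite (_ : eps / (c + 1) * (c + 1) = eps); [nra | field; lra].
rewrite (_ : c * r * vnorm w = vsum (fun i => vsum (fun j =>
  (r * vnorm w) * (vnorm (T i j) + 1)))); last first.
  rewrite (_ : c * r * vnorm w = r * vnorm w * c); last by ring.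
  by rewrite /c -vsumZ; apply: vsum_ext => i; rewrite vsumZ.
apply: vsum_le => i; rewrite /vsub /mulmv -vsumB.
apply: (Rle_trans _ _ _ (vsum_abs _)); apply: vsum_le => j.
rewrite (_ : _ - _ = (DF y i j - DF x i j) * w j); last by ring.
rewrite Rabs_mult (_ : r * _ * _ = (r * (vnorm (T i j) + 1)) * vnorm w); last by ring.
apply: Rmult_le_compat; [exact: Rabs_pos | exact: Rabs_pos | | exact: vnorm_coord].
have := Hd i j; have := cauchy_schwarz_abs (T i j) (vsub y x); rewrite /vdot -/r.
set S := vsum _; have := Rabs_triang (DF y i j - DF x i j - S) S.
by rewrite (_ : _ - S + S = DF y i j - DF x i j); [lra | ring].
Qed.

(* Metric regularity at a point with surjective derivative: a minimiser of
   |h(.) - e| + sigma |. - y| on a small ball must solve h = e, since moving along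
   the right inverse of the derivative would otherwise decrease this function. *)
Lemma surjective_metric_regular a b (h : vec a -> vec b) Dh T y0 r :
  0 < r -> (forall y, vnorm (vsub y y0) < r -> has_jac h (Dh y) y) -> has_jac2 Dh T y0 ->
  (forall e, exists y, mulmv (Dh y0) y = e) ->
  exists kappa rho, [/\ 0 < kappa, 0 < rho & forall y e,
    vnorm (vsub y y0) < rho -> vnorm (vsub (h y) e) < rho ->
    exists y', [/\ h y' = e, vnorm (vsub y' y) <= kappa * vnorm (vsub (h y) e) &
                   vnorm (vsub y' y0) < r]].
Proof.
move=> r0 hJ hJ2 /right_inverse[B HB].
have [c [c0 Hc]] := mulmv_bound B.
(* [c] bounds the right inverse [B]. With tolerance and penalty both 1/(4c), the error of the
   derivative and the rise of the penalty each cost at most a quarter of the residual along a step B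
   q. *)
have c4 : 0 < / (4 * c) by apply: Rinv_0_lt_compat; lra.
have [d [d0 Hd]] := has_jac2_op_cont hJ2 c4.
set r1 := Rmin r d; have r10 : 0 < r1 by exact: Rmin_glb_lt.
set Rd := r1 / 2; set sg := / (4 * c) in c4 Hd *.
have Rd0 : 0 < Rd by rewrite /Rd; lra.
(* The bound sg Rd on the residual forces the minimiser strictly inside the ball of radius Rd, so
   that small steps from it remain admissible. *)
exists (/ sg), (Rmin Rd (sg * Rd)); split.
- exact: Rinv_0_lt_compat.
- by apply: Rmin_glb_lt => //; nra.
move=> y e /Rlt_le_trans /(_ (Rmin_l _ _)) yy0 /Rlt_le_trans /(_ (Rmin_r _ _)) hye.
have near w : vnorm (vsub w y) <= Rd -> vnorm (vsub w y0) < r1.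
  by move=> wy; have := vnorm_subv w y y0; rewrite /Rd in wy yy0; lra.
have nr w : vnorm (vsub w y) <= Rd -> vnorm (vsub w y0) < r.
  by move=> /near H; apply: (Rlt_le_trans _ _ _ H); exact: Rmin_l.
have yy : vnorm (vsub y y) = 0 by rewrite (_ : vsub y y = vzero) ?vnorm0 //; vring.
have [|||||z [Az zmin]] := @closed_attains_min _ (fun w => vnorm (vsub w y) <= Rd)
   (fun w => vnorm (vsub (h w) e) + sg * vnorm (vsub w y)) y (Rd + vnorm y).
- apply: closed_of_vlim => w x wR wx.
  apply: (ulim_le (ulim_vnorm (vlimB wx (vlim_cst y))) (ulim_cst Rd)); exact: ult_all.
- by rewrite yy; lra.
- by move=> w _; have := vnorm_ge0 (vsub (h w) e); have := vnorm_ge0 (vsub w y); nra.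
- move=> w wR _; have := vnorm_triang (vsub w y) y.
  by rewrite (_ : vadd _ _ = w); [lra | vring].
- move=> w x xR _ wx; apply: ulimD.
    by apply: ulim_vnorm; apply: vlimB (vlim_cst e); apply: has_jac_cont wx; exact: hJ _ (nr _ xR).
  by apply: ulimZ; apply: ulim_vnorm; apply: vlimB wx (vlim_cst y).
have zy : vnorm (vsub (h z) e) + sg * vnorm (vsub z y) <= vnorm (vsub (h y) e).
  by have := zmin y; rewrite yy Rmult_0_r Rplus_0_r; apply; lra.
have zR : vnorm (vsub z y) < Rd.
  by have := vnorm_ge0 (vsub (h z) e); nra.
exists z; split; last exact: nr.
- apply: Classical_Prop.NNPP => hz.
  (* A step s B q lowers the residual by at least s|q|(1 - 1/4 - 1/8), the 1/8 being the
     differentiability remainder at z, and raises the penalty by at most s|q|/4. *)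
  set q := vsub e (h z).
  have q0 : 0 < vnorm q.
    apply: vnorm_gt0 => q0; apply: hz; apply: vec_ext => i.
    by have := f_equal (fun v => v i) q0; rewrite /q /vsub /vzero; lra.
  set w := mulmv B q; have wq : vnorm w <= c * vnorm q by exact: Hc.
  have w0 := vnorm_ge0 w.
  have e1 : 0 < / (8 * c) by apply: Rinv_0_lt_compat; lra.
  have [d1 [d10 Hd1]] := hJ _ (nr _ Az) _ e1.
  set m := Rmin d1 (Rd - vnorm (vsub z y)).
  have m0 : 0 < m by apply: Rmin_glb_lt; lra.
  have s1 : 0 < m / (vnorm w + 1) by apply: Rdiv_lt_0_compat; lra.
  set s := Rmin 1 (m / (vnorm w + 1)).
  have s0 : 0 < s by apply: Rmin_glb_lt; lra.
  have sle : s <= 1 by exact: Rmin_l.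
  have sw : s * vnorm w < m.
    have : s * (vnorm w + 1) <= m / (vnorm w + 1) * (vnorm w + 1).
      by apply: Rmult_le_compat_r; [lra | exact: Rmin_r].
    by rewrite (_ : m / (vnorm w + 1) * (vnorm w + 1) = m); [nra | field; lra].
  have nsw : vnorm (vscale s w) = s * vnorm w by rewrite vnormZ Rabs_pos_eq //; lra.
  have := Hd1 (vscale s w); rewrite nsw mulmvZ => /(_ (Rlt_le_trans _ _ _ sw (Rmin_l _ _))).
  set hs := h (vadd z (vscale s w)) => H1.
  have tri : vnorm (vsub (vadd z (vscale s w)) y) <= vnorm (vsub z y) + s * vnorm w.
    by rewrite -nsw (_ : vsub _ y = vadd (vsub z y) (vscale s w)); [exact: vnorm_triang | vring].
  have := zmin (vadd z (vscale s w)); rewrite -/hs.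
  have sm := Rlt_le_trans _ _ _ sw (Rmin_r _ _).
  have zsR : vnorm (vsub (vadd z (vscale s w)) y) <= Rd by lra.
  move=> /(_ zsR).
  have := Hd z (Rlt_le_trans _ _ _ (near _ Az) (Rmin_r _ _)) w.
  rewrite /w HB -/w => H2.
  have := vnorm_triang (vsub (vsub hs (h z)) (vscale s (mulmv (Dh z) w)))
            (vadd (vscale s (vsub (mulmv (Dh z) w) q)) (vscale (1 - s) (vopp q))).
  rewrite (_ : vadd _ (vadd _ _) = vsub hs e); last by rewrite /q; vring.
  have := vnorm_triang (vscale s (vsub (mulmv (Dh z) w) q)) (vscale (1 - s) (vopp q)).
  rewrite !vnormZ vnormN (Rabs_pos_eq s) ?(Rabs_pos_eq (1 - s)); [|lra|lra].
  rewrite (vnorm_subC (h z) e) -/q => T1 T2 T3.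
  have k1 : / (8 * c) * (s * vnorm w) <= s * vnorm q / 8.
    have : / (8 * c) * (s * vnorm w) <= / (8 * c) * (s * (c * vnorm q)).
      by apply: Rmult_le_compat_l; nra.
    by rewrite (_ : / (8 * c) * (s * (c * vnorm q)) = s * vnorm q / 8) //; field; lra.
  have k2 : sg * vnorm w <= vnorm q / 4.
    have : sg * vnorm w <= sg * (c * vnorm q) by apply: Rmult_le_compat_l; nra.
    by rewrite (_ : sg * (c * vnorm q) = vnorm q / 4) //; rewrite /sg; field; lra.
  have k3 : s * vnorm (vsub (mulmv (Dh z) w) q) <= s * (vnorm q / 4).
    by apply: Rmult_le_compat_l; lra.
  have k4 : sg * vnorm (vsub (vadd z (vscale s w)) y) <= sg * vnorm (vsub z y) + s * (vnorm q / 4).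
    have : sg * vnorm (vsub (vadd z (vscale s w)) y) <= sg * (vnorm (vsub z y) + s * vnorm w).
      by apply: Rmult_le_compat_l; lra.
    have : s * (sg * vnorm w) <= s * (vnorm q / 4) by apply: Rmult_le_compat_l; lra.
    by lra.
  have : 0 < s * vnorm q by exact: Rmult_lt_0_compat.
  by lra.
- apply: (Rmult_le_reg_l sg) => //; rewrite -Rmult_assoc Rinv_r ?Rmult_1_l; last lra.
  by have := vnorm_ge0 (vsub (h z) e); lra.
Qed.

(** * Multipliers of regular normals and tangent cones *)

(** [Rinf] defaults to 0 when there is no infimum, so nonemptiness is what gives the distance its
    meaning. *)
Lemma dist_glb n (A : vec n -> Prop) y : (exists a, A a) ->
  is_glb (fun r => exists a, A a /\ r = vnorm (vsub y a)) (dist A y).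
Proof.
move=> [a0 Aa0]; rewrite /dist /Rinf.
case: excluded_middle_informative => [H|[]].
  exact: proj2_sig (constructive_indefinite_description _ H).
have [||s [ub lub]] := @completeness (fun r => exists a, A a /\ r = - vnorm (vsub y a)).
- by exists 0 => _ [a [_ ->]]; have := vnorm_ge0 (vsub y a); lra.
- by exists (- vnorm (vsub y a0)), a0.
exists (- s); split=> [_ [a [Aa ->]]|b Hb].
  suff : - vnorm (vsub y a) <= s by lra.
  by apply: ub; exists a.
suff /lub : is_upper_bound (fun r => exists a, A a /\ r = - vnorm (vsub y a)) (- b) by lra.
move=> _ [a [Aa ->]]; suff : b <= vnorm (vsub y a) by lra.
by apply: Hb; exists a.
Qed.

Lemma dist_le n (A : vec n -> Prop) y a : A a -> dist A y <= vnorm (vsub y a).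
Proof. by move=> Aa; apply: (proj1 (dist_glb y (ex_intro _ a Aa))); exists a. Qed.

Lemma dist_approx n (A : vec n -> Prop) y eta : (exists a, A a) -> 0 < eta ->
  exists a, A a /\ vnorm (vsub y a) < dist A y + eta.
Proof.
move=> A0 e0; apply: NNPP => nE.
suff : dist A y + eta <= dist A y by lra.
apply: (proj2 (dist_glb y A0)) => _ [a [Aa ->]].
by apply: Rnot_lt_le => H; apply: nE; exists a.
Qed.

Lemma split_lshift m n (i : 'I_m) : split (lshift n i) = inl i.
Proof. exact: (unsplitK (inl i)). Qed.

Lemma split_rshift m n (j : 'I_n) : split (rshift m j) = inr j.
Proof. exact: (unsplitK (inr j)). Qed.

Lemma vjoin_l m n (p : vec m) (x : vec n) i : vjoin p x (lshift n i) = p i.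
Proof. by rewrite /vjoin split_lshift. Qed.

Lemma vjoin_r m n (p : vec m) (x : vec n) j : vjoin p x (rshift m j) = x j.
Proof. by rewrite /vjoin split_rshift. Qed.

Lemma uncurry2_join m n k (F : vec m -> vec n -> vec k) p x : uncurry2 F (vjoin p x) = F p x.
Proof.
by rewrite /uncurry2; congr F; apply: vec_ext => i; rewrite /vfst /vsnd ?vjoin_l ?vjoin_r.
Qed.

Lemma vdot_join m n (p q : vec m) (x y : vec n) :
  vdot (vjoin p x) (vjoin q y) = vdot p q + vdot x y.
Proof.
rewrite /vdot vsum_split; congr (_ + _); apply: vsum_ext => i.
  by rewrite !vjoin_l.
by rewrite !vjoin_r.
Qed.

Lemma vjoin_op m n (F : R -> R -> R) (p q : vec m) (x y : vec n) :
  (fun i => F (vjoin p x i) (vjoin q y i)) =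
  vjoin (fun i => F (p i) (q i)) (fun i => F (x i) (y i)).
Proof. by apply: vec_ext => i; rewrite /vjoin; case: (split i). Qed.

Lemma vjoinD m n (p q : vec m) (x y : vec n) :
  vadd (vjoin p x) (vjoin q y) = vjoin (vadd p q) (vadd x y).
Proof. exact: vjoin_op. Qed.

Lemma vjoinB m n (p q : vec m) (x y : vec n) :
  vsub (vjoin p x) (vjoin q y) = vjoin (vsub p q) (vsub x y).
Proof. exact: vjoin_op. Qed.

Lemma vjoinZ m n t (p : vec m) (x : vec n) :
  vscale t (vjoin p x) = vjoin (vscale t p) (vscale t x).
Proof. exact: (@vjoin_op m n (fun a _ => t * a) p p x x). Qed.

Lemma vnorm_join m n (p : vec m) (x : vec n) : vnorm (vjoin p x) <= vnorm p + vnorm x.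
Proof.
have p0 := vnorm_ge0 p; have x0 := vnorm_ge0 x.
apply: Rsqr_incr_0_var; last lra.
by rewrite /Rsqr vnorm_sq vdot_join -!vnorm_sq; nra.
Qed.

Lemma vnorm_join0 m n (x : vec n) : vnorm (vjoin (@vzero m) x) = vnorm x.
Proof. by rewrite /vnorm vdot_join vdot0r Rplus_0_l. Qed.

Lemma mulmv_join b m n (J : mat b (m + n)) q u :
  mulmv J (vjoin q u) = vadd (mulmv (jac_p J) q) (mulmv (jac_x J) u).
Proof.
apply: vec_ext => i; rewrite /mulmv /vadd vsum_split; congr (_ + _); apply: vsum_ext => j.
  by rewrite vjoin_l.
by rewrite vjoin_r.
Qed.

Lemma mulmv_join0 b m n (J : mat b (m + n)) u : mulmv J (vjoin vzero u) = mulmv (jac_x J) u.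
Proof. by rewrite mulmv_join mulmv0; vring. Qed.

Lemma vlim_join m n (p : nat -> vec m) (x : nat -> vec n) p0 x0 :
  vlim p p0 -> vlim x x0 -> vlim (fun k => vjoin (p k) (x k)) (vjoin p0 x0).
Proof. by move=> pl xl i; rewrite /vjoin; case: (split i) => j; [exact: pl | exact: xl]. Qed.

Lemma has_jac_section b m n (F : vec (m + n) -> vec b) J p x :
  has_jac F J (vjoin p x) -> has_jac (fun y => F (vjoin p y)) (jac_x J) x.
Proof.
move=> FJ e /FJ[d [d0 Hd]]; exists d; split=> // w wd.
have := Hd (vjoin vzero w); rewrite vnorm_join0 vjoinD mulmv_join0 => /(_ wd).
by rewrite (_ : vadd p vzero = p) //; vring.
Qed.

(** Metric regularity of [h] lifts e in K near G(p,x) to y' in C near g(p,x) with h y' = e, which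
    bounds dist(g(p,x); C) by a multiple of |G(p,x) - e|. Robinson stability becomes an estimate for
    G against individual points of K. *)
Lemma robinson_reduced m n l d (g : vec m -> vec n -> vec l) (C : vec l -> Prop)
    (K : vec d -> Prop) (h : vec l -> vec d) Dh T J rV pbar xbar :
  0 < rV -> (forall y, ball (g pbar xbar) rV y -> has_jac h (Dh y) y) ->
  has_jac2 Dh T (g pbar xbar) ->
  (forall e : vec d, exists y : vec l, mulmv (Dh (g pbar xbar)) y = e) ->
  (forall y, ball (g pbar xbar) rV y -> (C y <-> K (h y))) ->
  has_jac (uncurry2 g) J (vjoin pbar xbar) ->
  robinson_stable g C pbar xbar ->
  exists kappa rho, [/\ 0 <= kappa, 0 < rho & forall p x e,
    ball pbar rho p -> ball xbar rho x -> K e -> vnorm (vsub (h (g p x)) e) < rho ->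
    exists x', Gamma g C p x' /\ vnorm (vsub x' x) <= kappa * vnorm (vsub (h (g p x)) e)].
Proof.
move=> rV0 hJ hJ2 surj CK gJ [kR [r1 [r2 [kR0 [r10 [r20 HR]]]]]].
have [kh [rh [kh0 rh0 Hh]]] := surjective_metric_regular rV0 hJ hJ2 surj.
have [c [d1 [c0 d10 Hc]]] := has_jac_lip gJ.
set r3 := Rmin rV rh; have r30 : 0 < r3 by exact: Rmin_glb_lt.
set r4 := Rmin (d1 / 2) (r3 / (2 * c)).
have r40 : 0 < r4 by apply: Rmin_glb_lt; [lra | apply: Rdiv_lt_0_compat; lra].
set r5 := Rmin (Rmin r1 r2) (Rmin r4 rh).
(* The extra 1 pays for a distance to Gamma(p) that is only approached: x' is chosen with slack
   equal to the residual. *)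
exists (kR * kh + 1), r5; split.
- have : 0 <= kR * kh by apply: Rmult_le_pos; lra.
  lra.
- by do 2!apply: Rmin_glb_lt => //; apply: Rmin_glb_lt.
have [L1 [L2 [L3 L4]]] : r5 <= r1 /\ r5 <= r2 /\ r5 <= r4 /\ r5 <= rh.
  rewrite /r5; have := Rmin_l (Rmin r1 r2) (Rmin r4 rh); have := Rmin_r (Rmin r1 r2) (Rmin r4 rh).
  by have := Rmin_l r1 r2; have := Rmin_r r1 r2; have := Rmin_l r4 rh; have := Rmin_r r4 rh; lra.
move=> p x e pB xB Ke; rewrite /ball in pB xB => hB.
have gB : vnorm (vsub (g p x) (g pbar xbar)) < r3.
  have := Hc (vjoin p x); rewrite !uncurry2_join vjoinB.
  have := vnorm_join (vsub p pbar) (vsub x xbar) => J1 H.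
  have J2 : vnorm (vjoin (vsub p pbar) (vsub x xbar)) < 2 * r4 by lra.
  have M1 := Rmin_l (d1 / 2) (r3 / (2 * c)); have M2 := Rmin_r (d1 / 2) (r3 / (2 * c)).
  rewrite -/r4 in M1 M2; have {}H := H ltac:(lra).
  apply: (Rle_lt_trans _ _ _ H); rewrite (_ : r3 = c * (2 * (r3 / (2 * c)))); last by field; lra.
  by apply: Rmult_lt_compat_l; lra.
have N0 := vnorm_ge0 (vsub (h (g p x)) e).
(* The slack has to be positive, so a zero residual is treated apart; x is then itself feasible. *)
case: (classic (h (g p x) = e)) => he.
  exists x; split.
    have gV : ball (g pbar xbar) rV (g p x) by exact: Rlt_le_trans gB (Rmin_l _ _).
    by rewrite /Gamma; apply/(CK _ gV); rewrite he.
  rewrite (_ : vsub x x = vzero) ?vnorm0; last by vring.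
  have k1 : 0 <= kR * kh by apply: Rmult_le_pos; lra.
  by apply: Rmult_le_pos => //; lra.
have [||y' [hy' yk yB]] := Hh (g p x) e; first exact: Rlt_le_trans gB (Rmin_r _ _).
  lra.
have Cy' : C y' by apply/(CK _ yB); rewrite hy'.
have [||G0 Gd] := HR p x; rewrite /ball; try lra.
have Np : 0 < vnorm (vsub (h (g p x)) e).
  apply: vnorm_gt0 => q; apply: he; apply: vec_ext => i.
  by have := f_equal (fun v => v i) q; rewrite /vsub /vzero; lra.
have [x' [Gx' xx']] := dist_approx x G0 Np.
exists x'; split=> //; rewrite vnorm_subC.
have D1 := dist_le (g p x) Cy'; rewrite vnorm_subC in D1.
have : kR * dist C (g p x) <= kR * (kh * vnorm (vsub (h (g p x)) e)).
  by apply: Rmult_le_compat_l; lra.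
by lra.
Qed.

(** A minimax argument. For each direction w the residuals of projecting Gp(x + t w) onto K, divided
    by t, converge to a polar vector [ri]. The regularity estimate moves x + t w into [Om] at
    relative cost kappa |ri|, so normality gives <xs, w> <= kappa |xs| |ri|. Rescaling [ri] to norm
    kappa |xs| yields an admissible mu with <xs, w> <= <A^* mu, w>. Hence xs cannot be separated
    from the compact convex set of all A^* mu with admissible mu. *)
Lemma multiplier_of_normal n d (K : vec d -> Prop) (Gp : vec n -> vec d) A
    (Om : vec n -> Prop) x xs kappa rho :
  closed_convex_cone K -> has_jac Gp A x -> K (Gp x) -> 0 <= kappa -> 0 < rho ->
  (forall x1 e, vnorm (vsub x1 x) < rho -> K e -> vnorm (vsub (Gp x1) e) < rho ->
     exists x2, Om x2 /\ vnorm (vsub x2 x1) <= kappa * vnorm (vsub (Gp x1) e)) ->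
  normal_cone Om x xs ->
  exists mu, [/\ polar K mu, vdot mu (Gp x) = 0, vnorm mu <= kappa * vnorm xs &
                 mulTmv A mu = xs].
Proof.
move=> KK GA KG k0 r0 reg [_ nrm].
set S := fun mu => [/\ polar K mu, vdot mu (Gp x) = 0 & vnorm mu <= kappa * vnorm xs].
have c0 : 0 <= kappa * vnorm xs by apply: Rmult_le_pos => //; exact: vnorm_ge0.
have S0 : S vzero.
  by split; [move=> y _; rewrite vdot0l; lra | exact: vdot0l | rewrite vnorm0].
have step w : exists mu, S mu /\ vdot xs w <= vdot mu (mulmv A w).
  set t := fun k => / (INR k + 1).
  have t0 k : 0 < t k by apply: Rinv_0_lt_compat; have := pos_INR k; lra.
  have tl : ulim t 0 by exact: ulim_inv_succ.
  set a := fun k => Gp (vadd x (vscale (t k) w)).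
  have [e He] := choice_fun (fun k => cone_projection (a k) KK).
  set r := fun k => vsub (a k) (e k).
  have ql : vlim (fun k => quot Gp x (t k) w) (mulmv A w).
    exact: has_jac_lim GA t0 tl (vlim_cst w).
  have aE k : a k = vadd (Gp x) (vscale (t k) (quot Gp x (t k) w)) by rewrite /a quotE.
  have rr k : vdot (r k) (r k) = vdot (r k) (a k).
    by have [_ H _] := He k; rewrite {2}/r vdotBr H; ring.
  have rG k : vdot (r k) (Gp x) <= 0 by have [_ _ H] := He k; exact: H.
  have rle k : vnorm (r k) <= t k * vnorm (quot Gp x (t k) w).
    have H : vnorm (r k) * vnorm (r k) <= vnorm (r k) * (t k * vnorm (quot Gp x (t k) w)).
      rewrite vnorm_sq rr aE vdotDr vdotZr.
      have := rG k; have := cauchy_schwarz (r k) (quot Gp x (t k) w); have := t0 k.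
      by set cs := vdot _ (quot _ _ _ _); nra.
    have [//|H1] := Rle_lt_dec (vnorm (r k)) (t k * vnorm (quot Gp x (t k) w)).
    have : 0 <= t k * vnorm (quot Gp x (t k) w).
      by apply: Rmult_le_pos; [have := t0 k; lra | exact: vnorm_ge0].
    by nra.
  have qb := ulim_bound (ulim_vnorm ql).
  set M := Rabs _ + 1 in qb.
  have {}qb : ult (fun k => vnorm (quot Gp x (t k) w) <= M).
    by apply: ult_mono qb => k; rewrite Rabs_pos_eq //; exact: vnorm_ge0.
  pose rt k := vscale (/ t k) (r k).
  have rtE k : r k = vscale (t k) (rt k).
    by rewrite /rt; apply: vec_ext => i; rewrite /vscale; field; have := t0 k; lra.
  have nrt k : vnorm (rt k) <= vnorm (quot Gp x (t k) w).
    apply: (Rmult_le_reg_l (t k)) => //.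
    by have := rle k; rewrite {1}rtE vnormZ Rabs_pos_eq //; have := t0 k; lra.
  have [ri rl] : exists ri, vlim rt ri.
    by apply: (@vlim_exists _ _ M); apply: ult_mono qb => k; have := nrt k; lra.
  (* The value [x] outside the good range only makes the choice total; [ult]-almost every k lies in
     that range. *)
  have x2P k : exists x2, vnorm (vsub (vadd x (vscale (t k) w)) x) < rho ->
      vnorm (r k) < rho -> Om x2 /\
      vnorm (vsub x2 (vadd x (vscale (t k) w))) <= kappa * vnorm (r k).
    case: (classic (vnorm (vsub (vadd x (vscale (t k) w)) x) < rho /\ vnorm (r k) < rho)).
      move=> [H1 H2]; have [Ke _ _] := He k.
      by have [x2 ?] := reg _ _ H1 Ke H2; exists x2.
    by move=> H; exists x => H1 H2; case: H.
  have [x2 Hx2] := choice_fun x2P.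
  have near1 : ult (fun k => vnorm (vsub (vadd x (vscale (t k) w)) x) < rho).
    apply: vlim_norm_lt => //.
    by apply: vlim_eq (vlimD (vlim_cst x) (vlimZ tl (vlim_cst w))) => [k|]; vring.
  have rlim : ulim (fun k => vnorm (r k)) 0.
    apply: ulim_eq (ulimM tl (ulim_vnorm rl)) => [k|]; last by ring.
    by rewrite rtE vnormZ Rabs_pos_eq //; have := t0 k; lra.
  have good : ult (fun k => Om (x2 k) /\
      vnorm (vsub (x2 k) (vadd x (vscale (t k) w))) <= kappa * vnorm (r k)).
    by apply: ult_mono2 near1 (ulim_lt rlim r0) => k H1 H2; exact: Hx2.
  pose y k := vscale (/ t k) (vsub (x2 k) x).
  have yE k : vsub (x2 k) x = vscale (t k) (y k).
    by rewrite /y; apply: vec_ext => i; rewrite /vscale; field; have := t0 k; lra.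
  have yw : ult (fun k => vnorm (vsub (y k) w) <= kappa * vnorm (rt k)).
    apply: ult_mono good => k [_ H]; have tk := t0 k.
    apply: (Rmult_le_reg_l (t k)) => //.
    rewrite (_ : t k * (kappa * _) = kappa * (t k * vnorm (rt k))); last by ring.
    have nz z : t k * vnorm z = vnorm (vscale (t k) z) by rewrite vnormZ Rabs_pos_eq //; lra.
    rewrite !nz -rtE; apply: Rle_trans H; right; congr vnorm.
    rewrite (_ : vscale (t k) (vsub (y k) w) = vsub (vscale (t k) (y k)) (vscale (t k) w));
      last by vring.
    by rewrite -yE; vring.
  have yM : ult (fun k => vnorm (y k) <= kappa * M + vnorm w).
    apply: ult_mono2 yw qb => k H1 H2.
    have := vnorm_triang (vsub (y k) w) w; rewrite (_ : vadd _ _ = y k); last by vring.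
    have : kappa * vnorm (rt k) <= kappa * M.
      by apply: Rmult_le_compat_l => //; have := nrt k; lra.
    by lra.
  have [yi yl] := vlim_exists yM.
  have xy : vdot xs yi <= 0.
    apply: le_epsilon => eps e0; rewrite Rplus_0_l.
    have e1 : 0 < eps / (vnorm yi + 1) by apply: Rdiv_lt_0_compat; have := vnorm_ge0 yi; lra.
    have [dl [dl0 Hdl]] := nrm _ e1.
    have x2x : ult (fun k => vnorm (vsub (x2 k) x) < dl).
      apply: ulim_lt dl0; apply: ulim_eq (ulimM tl (ulim_vnorm yl)) => [k|]; last by ring.
      by rewrite yE vnormZ Rabs_pos_eq //; have := t0 k; lra.
    apply: (@Rle_trans _ (eps / (vnorm yi + 1) * vnorm yi)).
      apply: (ulim_le (ulim_vdot (vlim_cst xs) yl) (ulimZ _ (ulim_vnorm yl))).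
      apply: ult_mono2 good x2x => k [Ok _] /(Hdl _ Ok).
      rewrite yE vdotZr vnormZ Rabs_pos_eq; last by have := t0 k; lra.
      move=> H; apply: (Rmult_le_reg_l (t k)) => //; lra.
    have E : eps / (vnorm yi + 1) * (vnorm yi + 1) = eps.
      by field; have := vnorm_ge0 yi; lra.
    by lra.
  have ywi : vnorm (vsub yi w) <= kappa * vnorm ri.
    exact: ulim_le (ulim_vnorm (vlimB yl (vlim_cst w))) (ulimZ _ (ulim_vnorm rl)) yw.
  have riK : polar K ri.
    apply: polar_lim rl _; apply: ult_all => k; apply: polar_scale; last by have [] := He k.
    by apply/Rlt_le/Rinv_0_lt_compat.
  have al : vlim a (Gp x).
    apply: vlim_eq (vlimD (vlim_cst (Gp x)) (vlimZ tl ql)) => [k|]; first by rewrite aE.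
    by vring.
  have rta k : vdot (rt k) (a k) = t k * vdot (rt k) (rt k).
    by have := rr k; rewrite {1 2 3}rtE !vdotZl vdotZr => H;
      apply: (Rmult_eq_reg_l (t k)); have := t0 k; lra.
  have riG : vdot ri (Gp x) = 0.
    apply: ulim_uniq (ulim_vdot rl al) _.
    by apply: ulim_eq (ulimM tl (ulim_vdot rl rl)) => [k|]; [rewrite rta | ring].
  have ri2 : vnorm ri * vnorm ri <= vdot ri (mulmv A w).
    rewrite vnorm_sq; apply: (ulim_le (ulim_vdot rl rl) (ulim_vdot rl ql)).
    apply: ult_all => k; apply: (Rmult_le_reg_l (t k)) => //.
    rewrite -rta aE vdotDr vdotZr.
    have := rG k; rewrite rtE vdotZl => H.
    have : vdot (rt k) (Gp x) <= 0 by apply: (Rmult_le_reg_l (t k)) => //; lra.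
    lra.
  have bnd : vdot xs w <= kappa * vnorm xs * vnorm ri.
    have := cauchy_schwarz xs (vsub w yi); rewrite vdotBr vnorm_subC.
    have : vnorm xs * vnorm (vsub yi w) <= vnorm xs * (kappa * vnorm ri).
      by apply: Rmult_le_compat_l => //; exact: vnorm_ge0.
    by lra.
  case: (classic (ri = vzero)) => ri0.
    by exists vzero; split=> //; rewrite vdot0l; move: bnd; rewrite ri0 vnorm0; lra.
  have rp := vnorm_gt0 ri0; have ip := Rinv_0_lt_compat _ rp.
  exists (vscale (kappa * vnorm xs * / vnorm ri) ri); split.
    have cc : 0 <= kappa * vnorm xs * / vnorm ri by apply: Rmult_le_pos; lra.
    split; [exact: polar_scale | by rewrite vdotZl riG; ring |].
    rewrite vnormZ Rabs_pos_eq // Rmult_assoc Rinv_l ?Rmult_1_r; lra.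
  apply: (Rle_trans _ _ _ bnd); rewrite vdotZl.
  rewrite {1}(_ : vnorm ri = / vnorm ri * (vnorm ri * vnorm ri)); last by field; lra.
  rewrite (Rmult_assoc (kappa * _)); apply: Rmult_le_compat_l => //.
  by apply: Rmult_le_compat_l; lra.
have [|||mu [Smu mmin]] := @closed_attains_min _ S (fun mu => vnorm (vsub xs (mulTmv A mu)))
    vzero (kappa * vnorm xs) _ S0 (fun w _ => vnorm_ge0 _).
- apply: closed_of_vlim => w b Sw wb; split.
  + by apply: polar_lim wb _; apply: ult_all => k; have [] := Sw k.
  + apply: ulim_uniq (ulim_vdot wb (vlim_cst (Gp x))) _.
    by apply: ulim_eq (ulim_cst 0) => // k; have [] := Sw k.
  + apply: (ulim_le (ulim_vnorm wb) (ulim_cst _)); apply: ult_all => k.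
    by have [] := Sw k.
- by move=> w [].
- move=> w b _ _ wb; apply: ulim_vnorm; apply: vlimB (vlim_cst xs) _.
  exact: vlim_mulmv_cst.
set q := vsub xs (mulTmv A mu) in mmin *.
have VI nu : S nu -> vdot q (vsub (mulTmv A nu) (mulTmv A mu)) <= 0.
  move=> [n1 n2 n3]; have [m1 m2 m3] := Smu.
  apply: (@norm_min_dot _ _ _ 1); first lra.
  move=> s s01; have /mmin : S (vadd (vscale s nu) (vscale (1 - s) mu)).
    split.
    - by apply: polar_add; apply: polar_scale => //; lra.
    - by rewrite vdotDl !vdotZl n2 m2; ring.
    - have := vnorm_triang (vscale s nu) (vscale (1 - s) mu).
      rewrite !vnormZ !Rabs_pos_eq; [|lra|lra].
      have : s * vnorm nu <= s * (kappa * vnorm xs) by apply: Rmult_le_compat_l; lra.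
      have : (1 - s) * vnorm mu <= (1 - s) * (kappa * vnorm xs).
        by apply: Rmult_le_compat_l; lra.
      by lra.
  by rewrite mulTmvD !mulTmvZ; congr (_ <= vnorm _); rewrite /q; vring.
(* The tested direction is the residual q itself; with the variational inequality this gives |q|^2
   <= 0. *)
have [nu [Snu xnu]] := step q.
have := VI _ Snu; rewrite vdotBr -vdot_adj vdotC in xnu *.
have q0 := vdot_ge0 q; have qE : vdot q q = vdot q xs - vdot q (mulTmv A mu).
  by rewrite {2}/q vdotBr.
rewrite (vdotC (mulTmv A nu)) in xnu => H.
have {}q0 : vnorm q = 0 by have := vnorm_sq q; nra.
have [m1 m2 m3] := Smu; exists mu; split=> //.
apply: vec_ext => i; have := f_equal (fun v => v i) (vnorm_eq0 q0).
by rewrite /q /vsub /vzero; lra.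
Qed.

Lemma cone_of_tangent n d (K : vec d -> Prop) (Gp : vec n -> vec d) A (Om : vec n -> Prop) x r u :
  closed_convex_cone K -> has_jac Gp A x -> Gp x = vzero -> 0 < r ->
  (forall x', vnorm (vsub x' x) < r -> Om x' -> K (Gp x')) ->
  tangent_cone Om x u -> K (mulmv A u).
Proof.
move=> [clK [_ [_ cone]]] GA G0 r0 OK [t [w [t0 [/ulim_of_cv tl [wl Ow]]]]].
have wu : vlim w u.
  apply/vlim_dist => e /wl[N HN]; apply: ult_mono (ult_ge N) => k /HN.
  by rewrite Rminus_0_r Rabs_pos_eq //; exact: vnorm_ge0.
apply: vlim_closed clK (has_jac_lim GA t0 tl wu) _.
have near : ult (fun k => vnorm (vsub (vadd x (vscale (t k) (w k))) x) < r).
  apply: vlim_norm_lt => //.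
  by apply: vlim_eq (vlimD (vlim_cst x) (vlimZ tl wu)) => [k|]; vring.
apply: ult_mono near => k /OK /(_ (Ow k)) H; rewrite /quot G0.
rewrite (_ : vsub _ _ = Gp (vadd x (vscale (t k) (w k)))); last by vring.
by apply: cone => //; apply/Rlt_le/Rinv_0_lt_compat.
Qed.

(** As t A u lies in K, the constraint at x + t u is violated only by o(t); the regularity estimate
    repairs this at cost o(t), which does not change the direction. *)
Lemma tangent_of_cone n d (K : vec d -> Prop) (Gp : vec n -> vec d) A (Om : vec n -> Prop)
    x kappa rho u :
  closed_convex_cone K -> has_jac Gp A x -> Gp x = vzero -> 0 <= kappa -> 0 < rho ->
  (forall x1 e, vnorm (vsub x1 x) < rho -> K e -> vnorm (vsub (Gp x1) e) < rho ->
     exists x2, Om x2 /\ vnorm (vsub x2 x1) <= kappa * vnorm (vsub (Gp x1) e)) ->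
  K (mulmv A u) -> tangent_cone Om x u.
Proof.
move=> [_ [_ [_ cone]]] GA G0 k0 r0 reg KA.
have u0 := vnorm_ge0 u.
have lin eps : 0 < eps -> exists tau, 0 < tau /\ forall t, 0 < t < tau ->
    vnorm (vsub (Gp (vadd x (vscale t u))) (vscale t (mulmv A u))) <= eps * t.
  move=> e0; have e1 : 0 < eps / (vnorm u + 1) by apply: Rdiv_lt_0_compat; lra.
  have [d1 [d10 Hd]] := GA _ e1.
  exists (d1 / (vnorm u + 1)); split=> [|t [t0 tt]]; first by apply: Rdiv_lt_0_compat; lra.
  have tu : t * (vnorm u + 1) < d1.
    have : t * (vnorm u + 1) < d1 / (vnorm u + 1) * (vnorm u + 1).
      by apply: Rmult_lt_compat_r; lra.
    by rewrite (_ : d1 / (vnorm u + 1) * (vnorm u + 1) = d1) //; field; lra.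
  have := Hd (vscale t u); rewrite vnormZ Rabs_pos_eq; last lra.
  move=> /(_ ltac:(lra)); rewrite G0 mulmvZ.
  rewrite (_ : vsub _ vzero = Gp (vadd x (vscale t u))); last by vring.
  move=> H; apply: (Rle_trans _ _ _ H).
  have : eps / (vnorm u + 1) * (t * vnorm u) <= eps / (vnorm u + 1) * (t * (vnorm u + 1)).
    by apply: Rmult_le_compat_l; nra.
  by rewrite (_ : eps / (vnorm u + 1) * (t * (vnorm u + 1)) = eps * t) //; field; lra.
have [tau [tau0 Htau]] := lin _ r0.
(* For t <= s the linearisation error is at most rho t <= rho/2 and the displacement t |u| at most
   rho/2, so the regularity estimate applies. *)
set s := Rmin (tau / 2) (Rmin (/ 2) (rho / (2 * (vnorm u + 1)))).
have s0 : 0 < s.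
  by apply: Rmin_glb_lt; [lra | apply: Rmin_glb_lt; [lra | apply: Rdiv_lt_0_compat; lra]].
have [S1 [S2 S3]] : s <= tau / 2 /\ s <= / 2 /\ s <= rho / (2 * (vnorm u + 1)).
  have := Rmin_l (tau / 2) (Rmin (/ 2) (rho / (2 * (vnorm u + 1)))).
  have := Rmin_r (tau / 2) (Rmin (/ 2) (rho / (2 * (vnorm u + 1)))).
  have := Rmin_l (/ 2) (rho / (2 * (vnorm u + 1))); have := Rmin_r (/ 2) (rho / (2 * (vnorm u + 1))).
  by rewrite -/s; lra.
set t := fun k => s * / (INR k + 1).
have i1 k : 0 < / (INR k + 1) <= 1.
  split; first by apply: Rinv_0_lt_compat; have := pos_INR k; lra.
  by rewrite -{2}Rinv_1; apply: Rinv_le_contravar; have := pos_INR k; lra.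
have t0 k : 0 < t k <= s by have := i1 k; rewrite /t; nra.
have near k : exists w, Om (vadd x (vscale (t k) w)) /\ vnorm (vsub w u) <=
    kappa * (/ t k * vnorm (vsub (Gp (vadd x (vscale (t k) u))) (vscale (t k) (mulmv A u)))).
  have tk := t0 k.
  have H2 := Htau (t k) ltac:(lra).
  have [|||x2 [Ox2 Hx2]] := reg (vadd x (vscale (t k) u)) (vscale (t k) (mulmv A u)).
  - rewrite (_ : vsub _ x = vscale (t k) u); last by vring.
    rewrite vnormZ Rabs_pos_eq; last lra.
    have : t k * (vnorm u + 1) <= rho / (2 * (vnorm u + 1)) * (vnorm u + 1).
      by apply: Rmult_le_compat_r; lra.
    by rewrite (_ : rho / (2 * (vnorm u + 1)) * (vnorm u + 1) = rho / 2); [nra | field; lra].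
  - by apply: cone => //; lra.
  - apply: Rle_lt_trans H2 _.
    have : rho * t k <= rho * / 2 by apply: Rmult_le_compat_l; lra.
    by lra.
  exists (vscale (/ t k) (vsub x2 x)); split.
    rewrite (_ : vadd x _ = x2) //; apply: vec_ext => i.
    by rewrite /vadd /vscale /vsub; field; lra.
  rewrite (_ : vsub _ u = vscale (/ t k) (vsub x2 (vadd x (vscale (t k) u)))); last first.
    by apply: vec_ext => i; rewrite /vadd /vscale /vsub; field; lra.
  have ti : 0 < / t k by apply: Rinv_0_lt_compat; lra.
  rewrite vnormZ Rabs_pos_eq; last lra.
  by rewrite -Rmult_assoc (Rmult_comm kappa) Rmult_assoc; apply: Rmult_le_compat_l; lra.
have [w Hw] := choice_fun near.
have tcv : Un_cv t 0.
  move=> e e0; have e1 : 0 < e / s by apply: Rdiv_lt_0_compat.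
  have [N [Ne N0]] := archimed_cor1 _ e1.
  exists N => k Nk; rewrite /R_dist Rminus_0_r Rabs_pos_eq; last by have := t0 k; lra.
  have {}N0 : 0 < INR N by exact: lt_0_INR.
  have {}Nk : INR N <= INR k by apply/le_INR.
  have H : / (INR k + 1) < e / s.
    by apply: Rle_lt_trans Ne; apply: Rinv_le_contravar; lra.
  rewrite /t (_ : e = s * (e / s)); last by field; lra.
  exact: Rmult_lt_compat_l.
exists t, w; split; first by move=> k; have := t0 k; lra.
split=> //; split; last by move=> k; have [] := Hw k.
move=> e e0; have e1 : 0 < e / (2 * (kappa + 1)) by apply: Rdiv_lt_0_compat; lra.
have [tau1 [tau10 H1]] := lin _ e1; have [N HN] := tcv _ tau10.
exists N => k /leP Nk; have [_ Hk] := Hw k; apply: (Rle_lt_trans _ _ _ Hk).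
have tk := t0 k; have := HN k Nk; rewrite /R_dist Rminus_0_r Rabs_pos_eq; last lra.
move=> tk1; have {}H1 := H1 (t k) ltac:(lra).
have ti : 0 < / t k by apply: Rinv_0_lt_compat; lra.
have {}H1 := Rmult_le_compat_l _ _ _ (Rlt_le _ _ ti) H1.
rewrite (_ : / t k * (e / (2 * (kappa + 1)) * t k) = e / (2 * (kappa + 1))) in H1; last first.
  by field; lra.
have {}H1 := Rmult_le_compat_l _ _ _ k0 H1.
apply: (Rle_lt_trans _ _ _ H1).
have : (kappa + 1) * (e / (2 * (kappa + 1))) = e / 2 by field; lra.
by lra.
Qed.

(** * Error bounds for multiplier sets *)

Lemma small_uniform k (P : 'I_k -> R -> Prop) :
  (forall i, exists s0, 0 < s0 /\ forall s, 0 < s <= s0 -> P i s) ->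
  exists s0, 0 < s0 /\ forall s, 0 < s <= s0 -> forall i, P i s.
Proof.
move=> /choice_fun[s0 Hs].
have S0 : 0 <= vsum (fun i => / s0 i).
  by apply: vsum_ge0 => i; apply/Rlt_le/Rinv_0_lt_compat; have [] := Hs i.
(* Stands in for the minimum of the thresholds: the reciprocal of a sum of reciprocals lies below
   each of them, and the 1 covers the empty family. *)
exists (/ (vsum (fun i => / s0 i) + 1)); split=> [|s [sp sle] i].
  by apply: Rinv_0_lt_compat; lra.
have [si Hi] := Hs i; apply: Hi; split=> //; apply: (Rle_trans _ _ _ sle).
rewrite -(Rinv_inv (s0 i)); apply: Rinv_le_contravar; first exact: Rinv_0_lt_compat.
have : / s0 i <= vsum (fun i => / s0 i).
  apply: (@vsum_ge_term _ (fun i => / s0 i)) => j.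
  by apply/Rlt_le/Rinv_0_lt_compat; have [] := Hs j.
by lra.
Qed.

(** Common core of the two bounds proved by contradiction: vectors with ever smaller relative image
    have a limiting unit direction in the kernel, and almost all of them make an acute angle with
    it. *)
Lemma unbounded_direction e k (A : mat e k) (w : nat -> vec k) :
  (forall j, (INR j + 1) * vnorm (mulmv A (w j)) < vnorm (w j)) ->
  exists dl, [/\ vlim (fun j => vscale (/ vnorm (w j)) (w j)) dl, mulmv A dl = vzero &
                 ult (fun j => 0 < vdot (w j) dl)].
Proof.
move=> H; have w0 j : 0 < vnorm (w j).
  apply: Rle_lt_trans (H j); apply: Rmult_le_pos; last exact: vnorm_ge0.
  by have := pos_INR j; lra.
pose v j := vscale (/ vnorm (w j)) (w j).
have i0 j : 0 < / vnorm (w j) by exact: Rinv_0_lt_compat.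
have v1 j : vnorm (v j) = 1.
  by rewrite /v vnormZ Rabs_pos_eq; [field; have := w0 j; lra | have := i0 j; lra].
have [dl vl] : exists dl, vlim v dl.
  by apply: (@vlim_exists _ _ 1); apply: ult_all => j; rewrite v1; lra.
exists dl; split=> //.
  apply: vnorm_eq0; apply: ulim_uniq (ulim_vnorm (vlim_mulmv_cst A vl)) _.
  apply: ulim_squeeze0 ulim_inv_succ; apply: ult_all => j.
  rewrite Rabs_pos_eq; last exact: vnorm_ge0.
  rewrite /v mulmvZ vnormZ Rabs_pos_eq; last by have := i0 j; lra.
  have j0 : 0 < INR j + 1 by have := pos_INR j; lra.
  apply: (Rmult_le_reg_l ((INR j + 1) * vnorm (w j))); first exact: Rmult_lt_0_compat.
  rewrite (_ : _ * (/ _ * _) = (INR j + 1) * vnorm (mulmv A (w j))).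
    rewrite (_ : _ * / (INR j + 1) = vnorm (w j)); last by field; lra.
    by have := H j; lra.
  by field; have := w0 j; lra.
have dd : vdot dl dl = 1.
  apply: ulim_uniq (ulim_vdot vl vl) _.
  by apply: ulim_eq (ulim_cst 1) => // j; rewrite -vnorm_sq v1; ring.
have := ulim_gt (ulim_vdot vl (vlim_cst dl)) (_ : 0 < _); rewrite dd => /(_ Rlt_0_1).
apply: ult_mono => j; rewrite /v vdotZl => Hj.
by apply: (Rmult_lt_reg_l (/ vnorm (w j))) => //; lra.
Qed.

Definition nonneg {k} (c : vec k) := forall i, 0 <= c i.

(* Hoffman's bound for the system c >= 0, V c = b.  If it failed along a sequence of
   projections, the normalised corrections would converge to a kernel direction of V
   along which the projected points could still be moved closer. *)
Lemma hoffman e k (V : mat e k) : exists L, 0 < L /\ forall a c, nonneg a -> nonneg c ->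
  exists c', [/\ nonneg c', mulmv V c' = mulmv V c &
                 vnorm (vsub c' a) <= L * vnorm (vsub (mulmv V c) (mulmv V a))].
Proof.
apply: NNPP => nE.
have bad j : exists ac : vec k * vec k, [/\ nonneg ac.1, nonneg ac.2 & forall c',
    nonneg c' -> mulmv V c' = mulmv V ac.2 ->
    (INR j + 1) * vnorm (vsub (mulmv V ac.2) (mulmv V ac.1)) < vnorm (vsub c' ac.1)].
  apply: NNPP => H; apply: nE; exists (INR j + 1); split.
    by have := pos_INR j; lra.
  move=> a c a0 c0; apply: NNPP => H1; apply: H; exists (a, c); split=> //= c' c'0 Vc.
  by apply: Rnot_le_lt => H2; apply: H1; exists c'.
have [ac Hac] := choice_fun bad.
have proj j : exists z, (nonneg z /\ mulmv V z = mulmv V (ac j).2) /\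
    forall w, nonneg w /\ mulmv V w = mulmv V (ac j).2 ->
      vnorm (vsub z (ac j).1) <= vnorm (vsub w (ac j).1).
  have [a0 c0 _] := Hac j.
  apply: (@closed_attains_min _ (fun z => nonneg z /\ mulmv V z = mulmv V (ac j).2)
    (fun w => vnorm (vsub w (ac j).1)) (ac j).2
    (vnorm (vsub (ac j).2 (ac j).1) + vnorm (ac j).1)) => //.
  - apply: closed_of_vlim => w b Hw wb; split.
      move=> i; apply: (ulim_le (ulim_cst 0) (wb i)); apply: ult_all => q.
      by have [] := Hw q.
    apply: vlim_uniq (vlim_mulmv_cst V wb) _.
    by apply: vlim_eq (vlim_cst (mulmv V (ac j).2)) => // q; have [] := Hw q.
  - by move=> *; exact: vnorm_ge0.
  - move=> w _ H; have := vnorm_triang (vsub w (ac j).1) (ac j).1.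
    by rewrite (_ : vadd _ _ = w); [lra | vring].
  - by move=> w b _ _ wb; apply: ulim_vnorm; apply: vlimB => //; exact: vlim_cst.
have [z Hz] := choice_fun proj.
pose d j := vsub (z j) (ac j).1.
have [|dl [dll Vdl dpos]] := @unbounded_direction _ _ V d.
  move=> j; have [[z0 Vz] _] := Hz j; have [_ _ H] := Hac j.
  by rewrite /d mulmvB Vz; exact: H.
(* Where dl is positive the projected point strictly exceeds a nonnegative number and has room to
   decrease; elsewhere subtracting dl cannot spoil the sign. *)
have signs : ult (fun j => forall i, 0 < dl i -> 0 < d j i).
  apply: ult_forall_ord => i; case: (Rlt_le_dec 0 (dl i)) => H.
    apply: ult_mono (ulim_gt (dll i) H) => j; rewrite /vscale => Hj _.
    have w0 : 0 < vnorm (d j).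
      case: (vnorm_ge0 (d j)) => // w0; move: Hj; rewrite -w0 Rinv_0; lra.
    by apply: (Rmult_lt_reg_l (/ vnorm (d j))); [exact: Rinv_0_lt_compat | lra].
  by apply: ult_all => j; lra.
have [j [dj sj]] := ult_ex (ult_mono2 (fun j x y => conj x y) dpos signs).
have [[z0 Vz] zmin] := Hz j; have [a0 c0 _] := Hac j.
have [s0 [s0p Hs]] : exists s0, 0 < s0 /\ forall s, 0 < s <= s0 ->
    forall i, 0 <= z j i - s * dl i.
  apply: small_uniform => i; case: (Rlt_le_dec 0 (dl i)) => H.
    have zi : 0 < z j i by have := sj i H; have := a0 i; rewrite /d /vsub; lra.
    exists (z j i / dl i); split=> [|s [sp sle]]; first exact: Rdiv_lt_0_compat.
    have : s * dl i <= z j i / dl i * dl i by apply: Rmult_le_compat_r; lra.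
    by rewrite (_ : z j i / dl i * dl i = z j i); [lra | field; lra].
  by exists 1; split=> [|s [sp _]]; [lra | have := z0 i; nra].
suff : vdot (d j) dl <= 0 by lra.
apply: (norm_min_dot s0p) => s ss.
have := zmin (vsub (z j) (vscale s dl)).
rewrite (_ : vsub (vsub (z j) (vscale s dl)) (ac j).1 = vsub (d j) (vscale s dl)); last first.
  by rewrite /d; vring.
apply; split; first exact: Hs.
by rewrite mulmvB mulmvZ Vdl Vz; vring.
Qed.

(** The generated cone is closed, so mu can be projected onto it. The residual lies in its polar,
    that is, satisfies all the inequalities; hence <mu, residual> <= 0 and the residual vanishes. *)
Lemma farkas k d (A : 'I_k -> vec d) mu :
  polar (fun y => forall i, vdot (A i) y <= 0) mu ->
  exists c, nonneg c /\ mulmv (fun j i => A i j) c = mu.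
Proof.
set V : mat d k := fun j i => A i j => Kmu.
have VA nu c : vdot nu (mulmv V c) = vsum (fun i => c i * vdot (A i) nu).
  by rewrite -vdot_adj vdotC; apply: vsum_ext => i; congr (_ * _); apply: vsum_ext.
pose Q y := exists c, nonneg c /\ mulmv V c = y.
have [|e [[c [c0 ce]] re rQ]] := @cone_projection _ Q mu.
  split; last split; last split.
  (* Closedness: Hoffman's bound around the origin provides coefficients of norm at most L |y j|,
     which therefore have a limit. *)
  - have [L [L0 HL]] := hoffman V.
    apply: closed_of_vlim => y b Qy yb.
    have bounded j : exists c, [/\ nonneg c, mulmv V c = y j & vnorm c <= L * vnorm (y j)].
      have [c [c0 cy]] := Qy j.
      have [|c' [H1 H2 H3]] := HL vzero c _ c0; first by move=> i; rewrite /vzero; lra.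
      exists c'; split=> //; first by rewrite H2.
      move: H3; rewrite mulmv0 cy.
      rewrite (_ : vsub c' vzero = c'); last by vring.
      by rewrite (_ : vsub (y j) vzero = y j); last by vring.
    have [c Hc] := choice_fun bounded.
    have [c' cl] : exists c', vlim c c'.
      have yM := ulim_bound (ulim_vnorm yb).
      apply: (@vlim_exists _ _ (L * (Rabs (vnorm b) + 1))); apply: ult_mono yM => j.
      rewrite Rabs_pos_eq; last exact: vnorm_ge0.
      move=> H; have [_ _ H1] := Hc j; apply: (Rle_trans _ _ _ H1).
      by apply: Rmult_le_compat_l; lra.
    exists c'; split.
      move=> i; apply: (ulim_le (ulim_cst 0) (cl i)); apply: ult_all => j.
      by have [H _ _] := Hc j.
    apply: vlim_uniq (vlim_mulmv_cst V cl) _.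
    by apply: vlim_eq yb => // j; have [_ H _] := Hc j.
  - move=> a b t [ca [ca0 <-]] [cb [cb0 <-]] t01.
    exists (vadd (vscale t ca) (vscale (1 - t) cb)); split.
      move=> i; rewrite /vadd /vscale; have := ca0 i; have := cb0 i => H1 H2.
      by apply: Rplus_le_le_0_compat; apply: Rmult_le_pos; lra.
    by rewrite mulmvD !mulmvZ.
  - by exists vzero; split; [move=> i; rewrite /vzero; lra | rewrite mulmv0].
  - move=> t a t0 [ca [ca0 <-]]; exists (vscale t ca); split; last by rewrite mulmvZ.
    by move=> i; apply: Rmult_le_pos.
exists c; split=> //.
have rK i : vdot (A i) (vsub mu e) <= 0.
  have := rQ (A i); rewrite vdotC; apply; exists (vdelta i); split.
    by move=> j; rewrite /vdelta; case: (_ == _); lra.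
  by apply: vec_ext => j; exact: vsum_delta.
have := Kmu _ rK; have rr := vdot_ge0 (vsub mu e).
have E : vdot (vsub mu e) (vsub mu e) = vdot mu (vsub mu e) - vdot (vsub mu e) e.
  by rewrite vdotBl (vdotC e).
move=> H; have /vnorm_eq0 z : vnorm (vsub mu e) = 0.
  by have := vnorm_sq (vsub mu e); have := vnorm_ge0 (vsub mu e); nra.
rewrite ce; apply: vec_ext => i; have := f_equal (fun v => v i) z.
by rewrite /vsub /vzero; lra.
Qed.

(** [polyhedral] allows affine inequalities. In a cone they may be made homogeneous: a y with <A i,
    y> > 0, rescaled to the value c i + 1, would violate the i-th one. *)
Lemma polyhedral_cone d (K : vec d -> Prop) : closed_convex_cone K -> polyhedral K ->
  exists (k : nat) (A : 'I_k -> vec d), forall y, K y <-> (forall i, vdot (A i) y <= 0).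
Proof.
move=> [_ [_ [K0 cone]]] [k [A [c HK]]]; exists k, A => y; split=> [Ky i|H].
  apply: Rnot_lt_le => H.
  have c0 : 0 <= c i by have /HK/(_ i) := K0; rewrite vdot0r.
  have := cone ((c i + 1) / vdot (A i) y) y _ Ky.
  move=> /(_ ltac:(apply: Rlt_le; apply: Rdiv_lt_0_compat; lra)) /HK /(_ i).
  rewrite vdotZr (_ : (c i + 1) / vdot (A i) y * vdot (A i) y = c i + 1); first lra.
  by field; lra.
apply/HK => i; have /HK/(_ i) := K0; rewrite vdot0r; have := H i; lra.
Qed.

(** The factor 1 + |mus - mu| makes the bound linear on bounded sets only. The relative interior
    argument produces this growth, and it is harmless along convergent multipliers. *)
Definition multiplier_error_bound {d e} (K : vec d -> Prop) (A : mat e d) (mus : vec d) :=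
  exists L, 0 < L /\ forall mu, polar K mu -> exists mu',
    [/\ polar K mu', mulmv A mu' = mulmv A mus & vnorm (vsub mu' mu) <=
        L * (1 + vnorm (vsub mus mu)) * vnorm (vsub (mulmv A mus) (mulmv A mu))].

(** Generators present [polar K] as the image of a nonnegative orthant, where Hoffman's bound
    applies to [A] composed with the generators. *)
Lemma polyhedral_error_bound d e (K : vec d -> Prop) (A : mat e d) mus :
  closed_convex_cone K -> polyhedral K -> polar K mus ->
  multiplier_error_bound K A mus.
Proof.
move=> KK pK Kmus; have [k [a HK]] := polyhedral_cone KK pK.
have rep nu : polar K nu -> exists c, nonneg c /\ mulmv (fun j i => a i j) c = nu.
  by move=> Kn; apply: farkas => y /HK; exact: Kn.
set V : mat d k := fun j i => a i j in rep.
have [L [L0 HL]] := hoffman (matmul A V); have [c [c0 Hc]] := mulmv_bound V.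
exists (c * L); split=> [|mu Kmu]; first exact: Rmult_lt_0_compat.
have [cs [cs0 Vs]] := rep _ Kmus; have [cm [cm0 Vm]] := rep _ Kmu.
have [c' [c'0]] := HL _ _ cm0 cs0; rewrite !mulmv_matmul Vs Vm => H1 H2.
exists (mulmv V c'); split=> //.
- move=> y /HK Hy; rewrite vdotC -vdot_adj vdotC.
  apply: Rnot_lt_le => H; have : 0 <= - vdot c' (mulTmv V y) by (rewrite -vdotNr; apply: vsum_ge0 => i; apply: Rmult_le_pos => //; have := Hy i; rewrite /vopp /mulTmv /V /vdot; lra).
  lra.
- rewrite -{1}Vm -mulmvB; apply: (Rle_trans _ _ _ (Hc _)).
  have N0 := vnorm_ge0 (vsub mus mu).
  have : c * vnorm (vsub c' cm) <= c * (L * vnorm (vsub (mulmv A mus) (mulmv A mu))).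
    by apply: Rmult_le_compat_l; lra.
  set z := vnorm (vsub (mulmv A mus) _); have z0 : 0 <= z by exact: vnorm_ge0.
  have : 0 <= c * L * z * vnorm (vsub mus mu).
    by do 2!apply: Rmult_le_pos => //; apply: Rmult_le_pos; lra.
  by lra.
Qed.

(** For a convex cone [N] this is its linear span; the closure is built in so that limits stay
    inside without a dimension argument. *)
Definition diff_closure {d} (N : vec d -> Prop) : vec d -> Prop := fun w =>
  forall eps, 0 < eps -> exists nu nu', [/\ N nu, N nu' & vnorm (vsub (vsub nu nu') w) < eps].

Lemma diff_closure_closed d (N : vec d -> Prop) : is_closed (diff_closure N).
Proof.
move=> y H eps e0; have e2 : 0 < eps / 2 by lra.
have [w [cw wy]] := H _ e2; have [nu [nu' [H1 H2 H3]]] := cw _ e2.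
exists nu, nu'; split=> //.
by have := vnorm_subv (vsub nu nu') w y; lra.
Qed.

Lemma diff_closure_comb d (K : vec d -> Prop) a b s : 0 < s ->
  diff_closure (polar K) a -> diff_closure (polar K) b ->
  diff_closure (polar K) (vsub (vscale s a) b).
Proof.
move=> s0 ca cb eps e0.
have e1 : 0 < eps / (2 * s) by apply: Rdiv_lt_0_compat; lra.
have e2 : 0 < eps / 2 by lra.
have [x [x' [X1 X2 X3]]] := ca _ e1; have [y [y' [Y1 Y2 Y3]]] := cb _ e2.
exists (vadd (vscale s x) y'), (vadd (vscale s x') y); split.
- by apply: polar_add => //; apply: polar_scale => //; lra.
- by apply: polar_add => //; apply: polar_scale => //; lra.
have := vnorm_triang (vscale s (vsub (vsub x x') a)) (vopp (vsub (vsub y y') b)).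
rewrite (_ : vadd _ _ = vsub (vsub (vadd (vscale s x) y') (vadd (vscale s x') y))
  (vsub (vscale s a) b)); last by vring.
rewrite vnormZ vnormN Rabs_pos_eq; last lra.
have : s * vnorm (vsub (vsub x x') a) < s * (eps / (2 * s)) by apply: Rmult_lt_compat_l.
by rewrite (_ : s * (eps / (2 * s)) = eps / 2); [lra | field; lra].
Qed.

Lemma diff_closure0 d (K : vec d -> Prop) : diff_closure (polar K) vzero.
Proof.
have K0 : polar K vzero by move=> y _; rewrite vdot0l; lra.
move=> eps e0; exists vzero, vzero; split=> //.
by rewrite (_ : vsub _ _ = vzero) ?vnorm0 //; vring.
Qed.

(** A linear map on the span of the cone has preimages of controlled size. Minimal-norm preimages
    violating every bound would have a limiting kernel direction inside the span, along which they
    could be shortened. *)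
Lemma diff_closure_bounded_preimage d e (K : vec d -> Prop) (A : mat e d) :
  exists L, 0 < L /\ forall w, diff_closure (polar K) w -> exists w',
    [/\ diff_closure (polar K) w', mulmv A w' = mulmv A w &
        vnorm w' <= L * vnorm (mulmv A w)].
Proof.
set D := diff_closure _.
apply: NNPP => nE.
have bad j : exists w, D w /\ forall w', D w' -> mulmv A w' = mulmv A w ->
    (INR j + 1) * vnorm (mulmv A w) < vnorm w'.
  apply: NNPP => H; apply: nE; exists (INR j + 1); split.
    by have := pos_INR j; lra.
  move=> w Dw; apply: NNPP => H1; apply: H; exists w; split=> // w' Dw' E.
  by apply: Rnot_le_lt => H2; apply: H1; exists w'.
have [b Hb] := choice_fun bad.
have proj j : exists z, (D z /\ mulmv A z = mulmv A (b j)) /\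
    forall w, D w /\ mulmv A w = mulmv A (b j) -> vnorm z <= vnorm w.
  have [Db _] := Hb j.
  apply: (@closed_attains_min _ (fun z => D z /\ mulmv A z = mulmv A (b j))
    (fun w => vnorm w) (b j) (vnorm (b j))) => //.
  - apply: closed_of_vlim => w c Hw wc; split.
      apply: vlim_closed (@diff_closure_closed _ _) wc _; apply: ult_all => q.
      by have [] := Hw q.
    apply: vlim_uniq (vlim_mulmv_cst A wc) _.
    by apply: vlim_eq (vlim_cst (mulmv A (b j))) => // q; have [] := Hw q.
  - by move=> *; exact: vnorm_ge0.
  - by move=> w c _ _; exact: ulim_vnorm.
have [z Hz] := choice_fun proj.
have zbig j : (INR j + 1) * vnorm (mulmv A (z j)) < vnorm (z j).
  by have [[Dz Az] _] := Hz j; have [_ H] := Hb j; rewrite Az; exact: H.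
have [dl [dll Adl dpos]] := unbounded_direction zbig.
have Dneg a : D a -> D (vsub (vscale 1 vzero) a).
  by move=> Da; apply: diff_closure_comb => //; [lra | exact: diff_closure0].
have Dsub a c s : 0 < s -> D a -> D c -> D (vsub a (vscale s c)).
  move=> s0 Da Dc.
  have := diff_closure_comb s0 Dc Da; rewrite -/D => /Dneg.
  by congr D; vring.
have Dscale a s : 0 <= s -> D a -> D (vscale s a).
  case=> [s0|<-] Da; last first.
    by rewrite (_ : vscale 0 a = vzero); [exact: diff_closure0 | vring].
  have := diff_closure_comb s0 Da (@diff_closure0 _ K); congr D; vring.
have Ddl : D dl.
  apply: vlim_closed (@diff_closure_closed _ _) dll _; apply: ult_all => j.
  have [[Dz _] _] := Hz j; apply: Dscale => //.
  case: (vnorm_ge0 (z j)) => [|<-]; last by rewrite Rinv_0; lra.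
  by move=> ?; apply/Rlt_le/Rinv_0_lt_compat.
have [j dj] := ult_ex dpos; have [[Dz Az] zmin] := Hz j.
suff : vdot (z j) dl <= 0 by lra.
apply: (@norm_min_dot _ _ _ 1) => [|s [s0 _]]; first lra.
apply: zmin; split; first exact: Dsub.
by rewrite mulmvB mulmvZ Adl Az; vring.
Qed.

(** Adding to mu a short w from the span corrects its image but may leave the cone. Moving a
    fraction s towards [mus], which tolerates perturbations in the span up to [eps0], restores
    membership and costs a further s |mus - mu|. *)
Lemma relint_error_bound d e (K : vec d -> Prop) (A : mat e d) mus eps0 :
  0 < eps0 -> polar K mus ->
  (forall nu nu', polar K nu -> polar K nu' -> vnorm (vsub nu nu') < eps0 ->
     polar K (vadd mus (vsub nu nu'))) ->
  multiplier_error_bound K A mus.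
Proof.
move=> e0 Kmus ri.
have [L [L0 HL]] := diff_closure_bounded_preimage K A.
exists (L * (1 + 2 / eps0)); split=> [|mu Kmu].
  have : 0 < 2 / eps0 by apply: Rdiv_lt_0_compat; lra.
  by move=> ?; apply: Rmult_lt_0_compat => //; lra.
have ric w : diff_closure (polar K) w -> vnorm w < eps0 -> polar K (vadd mus w).
  move=> cw w0; apply: polar_closed => eps ep.
  have m0 : 0 < Rmin eps (eps0 - vnorm w) by apply: Rmin_glb_lt; lra.
  have [nu [nu' [H1 H2 H3]]] := cw _ m0.
  have H4 := Rmin_l eps (eps0 - vnorm w); have H5 := Rmin_r eps (eps0 - vnorm w).
  exists (vadd mus (vsub nu nu')); split.
    apply: ri => //; have := vnorm_triang (vsub (vsub nu nu') w) w.
    by rewrite (_ : vadd _ w = vsub nu nu'); [lra | vring].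
  rewrite (_ : vsub _ _ = vsub (vsub nu nu') w); [lra | vring].
have [|w [cw Aw wL]] := HL (vsub mus mu).
  move=> eps ep; exists mus, mu; split=> //.
  by rewrite (_ : vsub _ _ = vzero) ?vnorm0 //; vring.
rewrite mulmvB in Aw wL; set z := vnorm (vsub (mulmv A mus) _) in wL *.
have z0 : 0 <= z by exact: vnorm_ge0.
set r := vnorm (vsub mus mu); have r0 : 0 <= r by exact: vnorm_ge0.
have w0 := vnorm_ge0 w.
have i0 : 0 < 2 / eps0 by apply: Rdiv_lt_0_compat; lra.
(* With this weight the perturbation carried by [mus] has norm (1 - s) eps0 / 2, below [eps0]. *)
pose s := 2 / eps0 * vnorm w.
have s0 : 0 <= s by apply: Rmult_le_pos; lra.
have sL : s <= 2 / eps0 * (L * z) by apply: Rmult_le_compat_l; lra.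
have bound : vnorm w + s * r <= L * (1 + 2 / eps0) * (1 + r) * z.
  have H : s * r <= 2 / eps0 * (L * z) * r by apply: Rmult_le_compat_r.
  have Lz : 0 <= L * z by apply: Rmult_le_pos; lra.
  have H1 : 0 <= L * z * r by apply: Rmult_le_pos; lra.
  have H2 : 0 <= 2 / eps0 * (L * z) by apply: Rmult_le_pos; lra.
  by lra.
(* If s > 1, the correction is so large compared with [eps0] that [mus] itself is close enough. *)
case: (Rle_lt_dec s 1) => s1; last first.
  exists mus; split=> //; rewrite -/r.
  have : 1 * r <= s * r by apply: Rmult_le_compat_r; lra.
  by lra.
case: w0 => w0; last first.
  exists mu; split=> //.
    apply: vec_ext => i; have := f_equal (fun v => v i) Aw.
    by rewrite (vnorm_eq0 (esym w0)) mulmv0 /vsub /vzero; lra.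
  rewrite (_ : vsub mu mu = vzero) ?vnorm0; last by vring.
  have : 0 <= s * r by exact: Rmult_le_pos.
  by lra.
have sp : 0 < s by exact: Rmult_lt_0_compat.
exists (vadd (vscale (1 - s) mu) (vscale s (vadd mus (vscale ((1 - s) / s) w)))); split.
- apply: polar_add; apply: polar_scale => //; try lra.
  apply: ric.
    case: (Rle_lt_or_eq_dec _ _ s1) => s2.
      have q0 : 0 < (1 - s) / s by apply: Rdiv_lt_0_compat; lra.
      have := diff_closure_comb q0 cw (@diff_closure0 _ K).
      by rewrite (_ : vsub _ vzero = vscale ((1 - s) / s) w) //; vring.
    rewrite s2 (_ : vscale _ w = vzero); first exact: diff_closure0.
    by apply: vec_ext => i; rewrite /vscale /vzero; field.
  have q0 : 0 <= (1 - s) / s by apply: Rmult_le_pos; [lra | apply/Rlt_le/Rinv_0_lt_compat].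
  rewrite vnormZ Rabs_pos_eq //.
  have -> : (1 - s) / s * vnorm w = (1 - s) * (eps0 / 2) by rewrite /s; field; lra.
  by nra.
- rewrite mulmvD !mulmvZ mulmvD !mulmvZ Aw; apply: vec_ext => i.
  by rewrite /vadd /vscale /vsub; field; lra.
- rewrite (_ : vsub _ mu = vadd (vscale (1 - s) w) (vscale s (vsub mus mu))); last first.
    by apply: vec_ext => i; rewrite /vadd /vscale /vsub; field; lra.
  apply: Rle_trans bound; apply: (Rle_trans _ _ _ (vnorm_triang _ _)).
  by rewrite !vnormZ !Rabs_pos_eq -/r; [nra | lra | lra].
Qed.

(** * Second-order analysis along stationary points *)

(* Stationary points x_k = xbar + t_k us_k for parameters p_k = pbar + t_k q_k, with
   multipliers mus_k.  A and P are the partial Jacobians of G = h o g in x and p, As_k is the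
   x-Jacobian at (p_k, x_k), B is the second x-derivative of G contracted with u, and Fu is
   the x-derivative of f at u. *)
Record kkt_sequence {m n d} (K : vec d -> Prop) (A B : mat d n) (P : mat d m)
    (fbar Fu u : vec n) (mu : vec d) (t : nat -> R) (q : nat -> vec m) (us : nat -> vec n)
    (mus G : nat -> vec d) (As : nat -> mat d n) (fs : nat -> vec n) : Prop := {
  kkt_t : forall k, 0 < t k;
  kkt_t_lim : ulim t 0;
  kkt_q_lim : vlim q vzero;
  kkt_u_lim : vlim us u;
  kkt_mu_lim : vlim mus mu;
  kkt_A_lim : forall i j, ulim (fun k => / t k * (As k i j - A i j)) (B i j);
  kkt_G_lim : vlim (fun k => vscale (/ t k) (vsub (vscale (/ t k) (G k))
                (vadd (mulmv P (q k)) (mulmv A (us k))))) (vscale (/ 2) (mulmv B u));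
  kkt_f_lim : vlim (fun k => vscale (/ t k) (vsub (fs k) fbar)) Fu;
  kkt_G : forall k, K (G k);
  kkt_mu : forall k, polar K (mus k);
  kkt_compl : forall k, vdot (mus k) (G k) = 0;
  kkt_stat : forall k, mulTmv (As k) (mus k) = vopp (fs k) }.

(** The reduced form of <F_lambda u, a> for lambda = Dh^* mu; [Fu] and [B] already contain the
    direction u. *)
Definition lagrangian_form {n d} (B : mat d n) (Fu : vec n) (mu : vec d) (a : vec n) : R :=
  vdot Fu a + vdot mu (mulmv B a).

Section KktSequence.
Context {m n d : nat} {K : vec d -> Prop} {A B : mat d n} {P : mat d m}.
Context {fbar Fu u : vec n} {mu : vec d} {t : nat -> R} {q : nat -> vec m}.
Context {us : nat -> vec n} {mus G : nat -> vec d} {As : nat -> mat d n} {fs : nat -> vec n}.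
Context (KK : closed_convex_cone K).
Context (S : kkt_sequence K A B P fbar Fu u mu t q us mus G As fs).

Local Notation form := (lagrangian_form B Fu mu).
Let t0 := kkt_t S.
Let ti k : 0 < / t k. Proof. exact: Rinv_0_lt_compat. Qed.

Lemma kkt_A_cv i j : ulim (fun k => As k i j) (A i j).
Proof.
apply: ulim_eq (ulimD (ulimM (kkt_t_lim S) (kkt_A_lim S i j)) (ulim_cst (A i j))) => [k|].
  by field; have := t0 k; lra.
by ring.
Qed.

Lemma kkt_f_cv : vlim fs fbar.
Proof.
apply: vlim_eq (vlimD (vlimZ (kkt_t_lim S) (kkt_f_lim S)) (vlim_cst fbar)) => [k|]; last by vring.
by apply: vec_ext => i; rewrite /vadd /vscale /vsub; field; have := t0 k; lra.
Qed.

Lemma kkt_mu_polar : polar K mu.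
Proof. by apply: polar_lim (kkt_mu_lim S) _; apply: ult_all; exact: (kkt_mu S). Qed.

Lemma kkt_mu_stat : mulTmv A mu = vopp fbar.
Proof.
have H : vlim (fun k => mulTmv (As k) (mus k)) (mulTmv A mu).
  by apply: vlim_mulmv (kkt_mu_lim S) => i j; exact: kkt_A_cv.
apply: vlim_uniq H _; apply: vlim_eq (vlimB (vlim_cst vzero) kkt_f_cv) => [k|].
  by rewrite (kkt_stat S); vring.
by vring.
Qed.

(** By stationarity at x_k, the defect fbar + A^* mu_k of the unperturbed equation is minus the
    increments of f and of the adjoint Jacobian applied to mu_k; divided by t_k these converge. *)
Lemma kkt_form_lim (a : nat -> vec n) a0 : vlim a a0 ->
  ulim (fun k => - (/ t k * (vdot fbar (a k) + vdot (mus k) (mulmv A (a k))))) (form a0).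
Proof.
move=> al; have H1 := ulim_vdot (kkt_f_lim S) al.
have H2 := ulim_vdot (kkt_mu_lim S) (vlim_mulmv (kkt_A_lim S) al).
apply: ulim_eq (ulimD H1 H2) => // k.
have E : vdot (mus k) (mulmv (As k) (a k)) = - vdot (fs k) (a k).
  by rewrite -vdot_adj (kkt_stat S) vdotNl.
rewrite (_ : mulmv (fun i j => / t k * (As k i j - A i j)) (a k) =
  vscale (/ t k) (vsub (mulmv (As k) (a k)) (mulmv A (a k)))); last first.
  apply: vec_ext => i; rewrite /mulmv /vscale /vsub -vsumB -vsumZ.
  by apply: vsum_ext => j; ring.
by rewrite vdotZl vdotZr vdotBr vdotBl E; ring.
Qed.

Lemma kkt_G_cv : vlim (fun k => vscale (/ t k) (G k)) (mulmv A u).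
Proof.
have H := vlimD (vlim_mulmv_cst P (kkt_q_lim S)) (vlim_mulmv_cst A (kkt_u_lim S)).
apply: vlim_eq (vlimD (vlimZ (kkt_t_lim S) (kkt_G_lim S)) H) => [k|].
  by apply: vec_ext => i; rewrite /vadd /vscale /vsub; field; have := t0 k; lra.
by rewrite mulmv0; vring.
Qed.

Lemma kkt_dir_cone : K (mulmv A u).
Proof.
have [clK [_ [_ cone]]] := KK.
apply: vlim_closed clK kkt_G_cv _; apply: ult_all => k.
by apply: cone (kkt_G S k); exact/Rlt_le.
Qed.

Lemma kkt_dir_orth : vdot fbar u = 0.
Proof.
have : vdot mu (mulmv A u) = 0.
  apply: ulim_uniq (ulim_vdot (kkt_mu_lim S) kkt_G_cv) _.
  by apply: ulim_eq (ulim_cst 0) => // k; rewrite vdotZr (kkt_compl S); ring.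
by rewrite -vdot_adj kkt_mu_stat vdotNl; lra.
Qed.

Lemma kkt_form_ge0 a : K (mulmv A a) -> vdot fbar a = 0 -> 0 <= form a.
Proof.
move=> Ka fa; apply: (ulim_le (ulim_cst 0) (kkt_form_lim (vlim_cst a))).
apply: ult_all => k; rewrite fa; have := kkt_mu S k Ka; have := ti k; nra.
Qed.

(** Of the three terms the first converges and the last is handled by stationarity; the middle one,
    with q_k divided by t_k, is what the lemmas below have to control. *)
Lemma kkt_expand nu k : / t k * vdot nu (vscale (/ t k) (G k)) =
  vdot nu (vscale (/ t k) (vsub (vscale (/ t k) (G k))
                (vadd (mulmv P (q k)) (mulmv A (us k))))) +
  / t k * vdot nu (mulmv P (q k)) + / t k * vdot nu (mulmv A (us k)).
Proof. by rewrite !vdotE; ring. Qed.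

Lemma kkt_form_le0 (mut : nat -> vec d) :
  (forall k, polar K (mut k)) -> (forall k, mulTmv A (mut k) = vopp fbar) -> vlim mut mu ->
  ulim (fun k => / t k * vdot (vsub (mut k) (mus k)) (mulmv P (q k))) 0 ->
  form u <= 0.
Proof.
move=> mK mA ml pl.
have ml0 := vlimB ml (kkt_mu_lim S).
have L1 := ulim_vdot ml0 (kkt_G_lim S).
have L2 := kkt_form_lim (kkt_u_lim S).
have L := ulimD (ulimD L1 pl) L2.
rewrite (_ : vdot _ _ + 0 + form u = form u) in L; last first.
  by rewrite (_ : vsub mu mu = vzero) ?vdot0l; [ring | vring].
apply: ulim_le L (ulim_cst 0) _; apply: ult_all => k.
have E : vdot fbar (us k) = - vdot (mut k) (mulmv A (us k)).
  by rewrite -vdot_adj mA vdotNl; ring.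
have := kkt_expand (vsub (mut k) (mus k)) k.
set X := vdot _ (vscale _ (vsub _ _)); set Y := / t k * vdot _ (mulmv P _) => H.
(* [mut k] solves the unperturbed equation, so all terms reassemble to <mut_k - mu_k, G_k>/t_k^2;
   complementarity removes mu_k and polarity of mut_k gives the sign. *)
rewrite E (_ : X + Y + _ = / t k * vdot (vsub (mut k) (mus k)) (vscale (/ t k) (G k))).
  rewrite vdotZr vdotBl (kkt_compl S); have := mK k _ (kkt_G S k); have := ti k => ? ?.
  have : 0 <= / t k * (/ t k * - vdot (mut k) (G k)).
    by do 2!(apply: Rmult_le_pos; [lra|]); lra.
  by lra.
by rewrite H (vdotBl (mulmv A _)); ring.
Qed.

(** Under this rate the fixed choice mu'_k = mu makes the form vanish at u. Repeating the expansion
    with [mub], which acts like mu on the range of (P, A), leaves half the difference of the two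
    curvature terms. *)
Lemma kkt_maximal mub : polar K mub ->
  (forall a b, vdot mub (vadd (mulmv P a) (mulmv A b)) = vdot mu (vadd (mulmv P a) (mulmv A b))) ->
  ulim (fun k => / t k * vdot (vsub mu (mus k)) (mulmv P (q k))) 0 ->
  vdot mub (mulmv B u) <= vdot mu (mulmv B u).
Proof.
move=> mK mE pl.
have f0 : form u = 0.
  apply: Rle_antisym; last exact: kkt_form_ge0 kkt_dir_cone kkt_dir_orth.
  apply: (@kkt_form_le0 (fun _ => mu)) => // [_|_|]; first exact: kkt_mu_polar.
    exact: kkt_mu_stat.
  exact: vlim_cst.
have L1 := ulim_vdot (vlimB (vlim_cst mub) (kkt_mu_lim S)) (kkt_G_lim S).
have L := ulimD (ulimD L1 pl) (kkt_form_lim (kkt_u_lim S)).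
suff : vdot (vsub mub mu) (vscale (/ 2) (mulmv B u)) + 0 + form u <= 0.
  by rewrite f0 vdotZr vdotBl; lra.
apply: ulim_le L (ulim_cst 0) _; apply: ult_all => k.
have E : vdot fbar (us k) = - vdot mu (mulmv A (us k)).
  by rewrite -vdot_adj kkt_mu_stat vdotNl; ring.
have H := kkt_expand (vsub mub (mus k)) k.
have H1 := mE (q k) (us k); rewrite !vdotDr in H1.
rewrite E (_ : _ + _ + _ = / t k * vdot (vsub mub (mus k)) (vscale (/ t k) (G k))).
  rewrite vdotZr vdotBl (kkt_compl S); have := mK _ (kkt_G S k); have := ti k => ? ?.
  have : 0 <= / t k * (/ t k * - vdot mub (G k)).
    by do 2!(apply: Rmult_le_pos; [lra|]); lra.
  by lra.
rewrite H; set X := vdot _ (vscale _ (vsub _ _)).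
rewrite !(vdotBl (mulmv A _)) !(vdotBl (mulmv P _)).
have -> : vdot mub (mulmv P (q k)) = vdot mu (mulmv P (q k)) + vdot mu (mulmv A (us k))
   - vdot mub (mulmv A (us k)) by lra.
by ring.
Qed.

(** No rate for <mu - mu_k, P q_k> is assumed here. As mu itself is complementary to G_k,
    subtracting it from [mub] cancels the first-order terms exactly. *)
Lemma kkt_maximal_face mub : polar K mub ->
  (forall a b, vdot mub (vadd (mulmv P a) (mulmv A b)) = vdot mu (vadd (mulmv P a) (mulmv A b))) ->
  ult (fun k => vdot mu (G k) = 0) ->
  vdot mub (mulmv B u) <= vdot mu (mulmv B u).
Proof.
move=> mK mE mG.
have L := ulim_vdot (vlim_cst (vsub mub mu)) (kkt_G_lim S).
suff : vdot (vsub mub mu) (vscale (/ 2) (mulmv B u)) <= 0 by rewrite vdotZr vdotBl; lra.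
apply: ulim_le L (ulim_cst 0) _; apply: ult_mono mG => k Gk.
have H1 := mE (q k) (us k).
rewrite vdotZr vdotBr vdotBl (vdotBl (vadd _ _)) H1 !vdotZr Gk.
have := mK _ (kkt_G S k); have := ti k => ? ?.
have : 0 <= / t k * (/ t k * - vdot mub (G k)).
  by do 2!(apply: Rmult_le_pos; [lra|]); lra.
by lra.
Qed.

(** Modulo lin K, on which polar vectors vanish, P q_k equals A M q_k, a displacement in x; the
    stationarity defect in the direction M q_k -> 0 then gives the limit. *)
Lemma kkt_param_range :
  (forall a, exists x' w, lin_space K w /\ mulmv P a = vadd (mulmv A x') w) ->
  ulim (fun k => / t k * vdot (vsub mu (mus k)) (mulmv P (q k))) 0.
Proof.
move=> full.
have [X HX] := choice_fun (fun j => full (vdelta j)).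
have lin0 w nu : lin_space K w -> polar K nu -> vdot nu w = 0.
  by move=> [w1 w2] nK; have := nK _ w1; have := nK _ w2; rewrite vdotNr; lra.
(* A linear selection of x', assembled from its values on the basis, so that M q_k inherits
   convergence from q_k. *)
pose M : mat n m := fun i j => X j i.
have PM nu a : polar K nu -> vdot nu (mulmv P a) = vdot nu (mulmv A (mulmv M a)).
  move=> nK; rewrite -mulmv_matmul -!vdot_adj; congr vdot; apply: vec_ext => j.
  have [w [lw HP]] := HX j.
  transitivity (vdot nu (mulmv P (vdelta j))); first by rewrite -vdot_adj vdot_delta.
  rewrite HP vdotDr (lin0 w) // Rplus_0_r; apply: vsum_ext => i; rewrite Rmult_comm.
  by congr (_ * _).
have Ml : vlim (fun k => mulmv M (q k)) vzero.
  by rewrite -(mulmv0 M); apply: vlim_mulmv_cst; exact: (kkt_q_lim S).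
have F0 : form vzero = 0 by rewrite /lagrangian_form mulmv0 !vdot0r; ring.
have := kkt_form_lim Ml; rewrite F0; apply: ulim_eq => // k.
rewrite vdotBl !PM; [|exact: (kkt_mu S)|exact: kkt_mu_polar].
by rewrite -(vdot_adj A mu) kkt_mu_stat vdotNl; ring.
Qed.

(** [nu] only anchors the multiplier set and may differ from the limit mu. The defect of mu_k is t_k
    D_k with D_k convergent, so the correction is O(t_k) and q_k -> 0 disposes of the parameter
    term. *)
Lemma kkt_error_bound nu : polar K nu -> mulTmv A nu = vopp fbar ->
  multiplier_error_bound K (mtrans A) nu -> form u <= 0.
Proof.
move=> nK nA [L [L0 HL]].
have [mut Hm] := choice_fun (fun k => HL _ (kkt_mu S k)).
set D := fun k => vadd (vscale (/ t k) (vsub (fs k) fbar))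
   (mulTmv (fun i j => / t k * (As k i j - A i j)) (mus k)).
have Dl : vlim D (vadd Fu (mulTmv B mu)).
  apply: vlimD (kkt_f_lim S) _; apply: vlim_mulmv (kkt_mu_lim S) => i j.
  exact: kkt_A_lim S j i.
have DE k : vsub (mulTmv A nu) (mulTmv A (mus k)) = vscale (t k) (D k).
  rewrite nA; apply: vec_ext => i; have := f_equal (fun v => v i) (kkt_stat S k).
  rewrite /D /vsub /vscale /vadd /vopp => H.
  rewrite (_ : mulTmv (fun i j => / t k * (As k i j - A i j)) (mus k) i =
     / t k * (mulTmv (As k) (mus k) i - mulTmv A (mus k) i)).
    by rewrite H; field; have := t0 k; lra.
  by rewrite /mulTmv -vsumB -vsumZ; apply: vsum_ext => j; ring.
set E := fun k => L * (1 + vnorm (vsub nu (mus k))) * vnorm (D k).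
have El : ulim E (L * (1 + vnorm (vsub nu mu)) * vnorm (vadd Fu (mulTmv B mu))).
  apply: ulimM (ulim_vnorm Dl); apply: ulimZ; apply: ulimD; first exact: ulim_cst.
  by apply: ulim_vnorm; apply: vlimB (kkt_mu_lim S); exact: vlim_cst.
have mE k : vnorm (vsub (mut k) (mus k)) <= t k * E k.
  have [_ _ H] := Hm k; apply: (Rle_trans _ _ _ H); rewrite /E -!mulTmvE DE vnormZ.
  by rewrite Rabs_pos_eq; [right; ring | have := t0 k; lra].
apply: (@kkt_form_le0 mut) => [k|k||].
- by have [] := Hm k.
- by have [_ H _] := Hm k; rewrite mulTmvE H.
- have z0 : vlim (fun k => vsub (mut k) (mus k)) vzero.
    apply/vlim_dist; have := ulimM (kkt_t_lim S) El; rewrite Rmult_0_l.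
    apply: ulim_squeeze0; apply: ult_all => k; rewrite Rabs_pos_eq; last exact: vnorm_ge0.
    by rewrite (_ : vsub _ vzero = vsub (mut k) (mus k)); [exact: mE | vring].
  by apply: vlim_eq (vlimD z0 (kkt_mu_lim S)) => [k|]; vring.
- have Pl : ulim (fun k => E k * vnorm (mulmv P (q k))) 0.
    have := ulimM El (ulim_vnorm (vlim_mulmv_cst P (kkt_q_lim S))).
    by rewrite mulmv0 vnorm0 Rmult_0_r.
  apply: ulim_squeeze0 Pl; apply: ult_all => k; rewrite Rabs_mult Rabs_pos_eq; last exact: Rlt_le.
  apply: (Rmult_le_reg_l (t k)) => //; rewrite -Rmult_assoc Rinv_r; last by have := t0 k; lra.
  rewrite Rmult_1_l; apply: (Rle_trans _ _ _ (cauchy_schwarz_abs _ _)).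
  rewrite -Rmult_assoc; apply: Rmult_le_compat_r; [exact: vnorm_ge0 | exact: mE].
Qed.

End KktSequence.

(* Along the ultrafilter the set of active generators is constant, so the limit
   multiplier lies in the span of the generators orthogonal to every G_k. *)
Lemma polyhedral_limit_face d (K : vec d -> Prop) (mus G : nat -> vec d) mu :
  closed_convex_cone K -> polyhedral K -> vlim mus mu ->
  (forall k, K (G k)) -> (forall k, polar K (mus k)) -> (forall k, vdot (mus k) (G k) = 0) ->
  ult (fun k => vdot mu (G k) = 0).
Proof.
move=> KK pK ml GK mK compl; have [N [a HK]] := polyhedral_cone KK pK.
have rep k : exists c, nonneg c /\ mulmv (fun j i => a i j) c = mus k.
  by apply: farkas => y /HK; exact: mK.
have [c Hc] := choice_fun rep.
pose Act i k := 0 < c k i.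
(* T collects the generators active for almost every k; being finitely many, they can be fixed
   simultaneously. *)
have [T HT] : exists T : 'I_N -> Prop, forall i, ult (fun k => Act i k <-> T i).
  exists (fun i => ult (Act i)) => i; case: (ult_em (Act i)) => H.
    by apply: ult_mono (H) => k Ak; split.
  apply: ult_mono (H) => k nAk; split=> // H1; exfalso.
  by have [k' []] := ult_ex (ult_mono2 (fun k x y => conj x y) H H1).
have con := ult_forall_ord HT.
have VA k y : vdot (mus k) y = vsum (fun i => c k i * vdot (a i) y).
  have [_ <-] := Hc k; rewrite vdotC -vdot_adj; apply: vsum_ext => i.
  by rewrite Rmult_comm; congr (_ * _); apply: vsum_ext.
have orth j : (forall i, Act i j <-> T i) -> forall i, T i -> vdot (a i) (G j) = 0.
  move=> Tj i /Tj; rewrite /Act => ci; have /HK Ha := GK j.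
  have [c0 _] := Hc j.
  have := compl j; rewrite VA => H.
  have := @vsum_ge_term _ (fun i => - (c j i * vdot (a i) (G j))) i.
  move=> /(_ ltac:(move=> i0; have := Ha i0; have := c0 i0; nra)).
  have -> : vsum (fun i => - (c j i * vdot (a i) (G j))) = 0.
    have -> : 0 = (-1) * vsum (fun i => c j i * vdot (a i) (G j)) by rewrite H; ring.
    by rewrite -vsumZ; apply: vsum_ext => i0; ring.
  by have := Ha i; nra.
(* Two indices: for fixed j the generators in T annihilate G_j, while the multipliers mu_k, built
   from the same generators, run to the limit mu. *)
apply: ult_mono con => j Tj.
apply: ulim_uniq (ulim_vdot ml (vlim_cst (G j))) _.
apply: ulim_ext (ulim_cst 0); apply: ult_mono (ult_forall_ord HT) => k Tk.
rewrite VA vsum0 // => i; have [c0 _] := Hc k.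
case: (c0 i) => [ci|<-]; last by ring.
by rewrite (orth j Tj) ?Rmult_0_r //; apply/Tk.
Qed.

(** * Cone reduction *)

Lemma vdot_hess a b (T : tensor b a) (mu : vec b) (x v : vec a) :
  vdot x (mulmv (hess T mu) v) =
  vsum (fun i => mu i * vsum (fun j => vsum (fun k => T i j k * v k) * x j)).
Proof.
rewrite /vdot /mulmv /hess.
have -> : vsum (fun i => mu i * vsum (fun j => vsum (fun k => T i j k * v k) * x j)) =
   vsum (fun i => vsum (fun j => mu i * vsum (fun k => T i j k * v k) * x j)).
  by apply: vsum_ext => i; rewrite -vsumZ; apply: vsum_ext => j; ring.
rewrite vsum_exch; apply: vsum_ext => j.
have -> : vsum (fun i => mu i * vsum (fun k => T i j k * v k) * x j) =
   vsum (fun i => vsum (fun k => mu i * T i j k * v k * x j)).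
  by apply: vsum_ext => i; rewrite -vsumZ Rmult_comm -vsumZ; apply: vsum_ext => k; ring.
rewrite vsum_exch -vsumZ; apply: vsum_ext => k.
rewrite Rmult_comm (Rmult_comm _ (v k)) -vsumZ Rmult_comm -vsumZ.
by apply: vsum_ext => i; ring.
Qed.

(** Second-order chain rule in the split form of the problem data: [T1], for the inner map, is
    paired with lambda = A^* mu and [T2], for the outer map, with mu. *)
Lemma vdot_comp_hess a b c (T2 : tensor c b) (T1 : tensor b a) A B (mu : vec c) v x :
  vdot mu (mulmv (comp_hess T2 T1 A B v) x) =
  vdot x (mulmv (hess T1 (mulTmv A mu)) v) +
  vdot (mulmv B x) (mulmv (hess T2 mu) (mulmv B v)).
Proof.
rewrite !vdot_hess.
pose Q p := vsum (fun j => vsum (fun q => T1 p j q * v q) * x j).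
have -> : vsum (fun p => mulTmv A mu p * Q p) = vdot mu (mulmv A Q) by exact: vdot_adj.
rewrite Rplus_comm /vdot -vsumD; apply: vsum_ext => i; rewrite -Rmult_plus_distr_l.
congr (_ * _); rewrite /mulmv /comp_hess.
have -> : vsum (fun j => vsum (fun q => T2 i j q * vsum (fun j0 => B q j0 * v j0)) *
    vsum (fun j0 => B j j0 * x j0)) =
  vsum (fun j => vsum (fun p => vsum (fun q => T2 i p q * mulmv B v q) * B p j) * x j).
  have -> : vsum (fun j => vsum (fun p => vsum (fun q => T2 i p q * mulmv B v q) * B p j) * x j) =
    vsum (fun j => vsum (fun p => vsum (fun q => T2 i p q * mulmv B v q) * B p j * x j)).
    by apply: vsum_ext => j; rewrite Rmult_comm -vsumZ; apply: vsum_ext => p; ring.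
  rewrite vsum_exch; apply: vsum_ext => p; rewrite -vsumZ; apply: vsum_ext => j.
  by rewrite /mulmv; ring.
have -> : vsum (fun j => A i j * Q j) =
  vsum (fun j => vsum (fun p => A i p * vsum (fun q => T1 p j q * v q)) * x j).
  have -> : vsum (fun j => vsum (fun p => A i p * vsum (fun q => T1 p j q * v q)) * x j) =
    vsum (fun j => vsum (fun p => A i p * (vsum (fun q => T1 p j q * v q) * x j))).
    by apply: vsum_ext => j; rewrite Rmult_comm -vsumZ; apply: vsum_ext => p; ring.
  by rewrite vsum_exch; apply: vsum_ext => p; rewrite -vsumZ.
by rewrite -vsumD; apply: vsum_ext => j; ring.
Qed.

(** Surjectivity of [A] makes its adjoint injective, so the choice inside [preimT] is forced. *)
Lemma preimT_mulTmv a b (A : mat b a) mu : (forall e, exists y, mulmv A y = e) ->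
  preimT A (mulTmv A mu) = mu.
Proof.
move=> surj; rewrite /preimT; case: excluded_middle_informative => [H|[]]; last by exists mu.
case: (constructive_indefinite_description _ H) => nu /= E.
by apply: vdot_right_eq => w; have [y <-] := surj w; rewrite -!vdot_adj E.
Qed.

Lemma lam_obj_comp l k d (Dgz : mat l k) (D2gz : tensor l k) (Dhy : mat d l)
    (D2hy : tensor d l) mu v : (forall e, exists y, mulmv Dhy y = e) ->
  lam_obj Dgz D2gz Dhy D2hy (mulTmv Dhy mu) v =
  vdot mu (mulmv (comp_hess D2hy D2gz Dhy Dgz v) v).
Proof. by move=> surj; rewrite /lam_obj preimT_mulTmv // vdot_comp_hess. Qed.

Lemma vdot_hess_x b m n (T : tensor b (m + n)) lam (x u : vec n) :
  vdot (vjoin vzero x) (mulmv (hess T lam) (vjoin vzero u)) = vdot x (mulmv (hess_x T lam) u).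
Proof.
rewrite /vdot vsum_split vsum0 => [|i]; last by rewrite vjoin_l /vzero; ring.
rewrite Rplus_0_l; apply: vsum_ext => j; rewrite vjoin_r; congr (_ * _).
rewrite /mulmv vsum_split vsum0 => [|i]; last by rewrite vjoin_l /vzero; ring.
by rewrite Rplus_0_l; apply: vsum_ext => k; rewrite vjoin_r.
Qed.

Lemma Fop_comp m n l d (Dfz : mat n (m + n)) (Dgz : mat l (m + n)) D2gz
    (Dhy : mat d l) (D2hy : tensor d l) mu u x : (forall e, exists y, mulmv Dhy y = e) ->
  vdot (Fop Dfz Dgz D2gz Dhy D2hy (mulTmv Dhy mu) u) x =
  vdot (mulmv (jac_x Dfz) u) x +
  vdot mu (mulmv (jac_x (comp_hess D2hy D2gz Dhy Dgz (vjoin vzero u))) x).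
Proof.
move=> surj; rewrite -(mulmv_join0 (comp_hess _ _ _ _ _)) vdot_comp_hess vdot_hess_x !mulmv_join0.
rewrite /Fop /Hx preimT_mulTmv // !vdotDl vdot_adj.
by rewrite (vdotC x) (vdotC (mulmv (jac_x Dgz) x)); ring.
Qed.

Lemma normal_of_polar l d (C : vec l -> Prop) (K : vec d -> Prop) (h : vec l -> vec d) Dhy
    rV y0 mu :
  0 < rV -> has_jac h Dhy y0 -> h y0 = vzero -> K vzero ->
  (forall y, ball y0 rV y -> (C y <-> K (h y))) -> polar K mu ->
  normal_cone C y0 (mulTmv Dhy mu).
Proof.
move=> rV0 hJ h0 K0 CK Kmu; split.
  by apply/CK; rewrite ?h0 // /ball (_ : vsub y0 y0 = vzero) ?vnorm0 //; vring.
move=> eps e0; have m0 := vnorm_ge0 mu.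
have e1 : 0 < eps / (vnorm mu + 1) by apply: Rdiv_lt_0_compat; lra.
have [d1 [d10 Hd]] := hJ _ e1.
exists (Rmin rV d1); split=> [|y Cy yy]; first exact: Rmin_glb_lt.
have /Hd := Rlt_le_trans _ _ _ yy (Rmin_r _ _).
rewrite (_ : vadd y0 (vsub y y0) = y); last by vring.
rewrite h0 (_ : vsub (h y) vzero = h y); last by vring.
have Kh : K (h y) by apply/CK => //; exact: Rlt_le_trans yy (Rmin_l _ _).
have := Kmu _ Kh; rewrite vdot_adj => H1 H2.
have := cauchy_schwarz mu (vsub (mulmv Dhy (vsub y y0)) (h y)).
rewrite vdotBr vnorm_subC => H3.
have z0 := vnorm_ge0 (vsub y y0).
have : vnorm mu * vnorm (vsub (h y) (mulmv Dhy (vsub y y0))) <=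
   vnorm mu * (eps / (vnorm mu + 1) * vnorm (vsub y y0)) by exact: Rmult_le_compat_l.
have : (vnorm mu + 1) * (eps / (vnorm mu + 1) * vnorm (vsub y y0)) = eps * vnorm (vsub y y0).
  by field; lra.
have : 0 <= eps / (vnorm mu + 1) * vnorm (vsub y y0) by apply: Rmult_le_pos; lra.
by lra.
Qed.

(** The multiplier rule with [h] as constraint map: metric regularity of [h] supplies the estimate
    that Robinson stability supplies for G. *)
Lemma polar_of_normal l d (C : vec l -> Prop) (K : vec d -> Prop) (h : vec l -> vec d) Dh T
    rV y0 lam :
  closed_convex_cone K -> 0 < rV -> (forall y, ball y0 rV y -> has_jac h (Dh y) y) ->
  has_jac2 Dh T y0 -> (forall e, exists y, mulmv (Dh y0) y = e) -> h y0 = vzero ->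
  (forall y, ball y0 rV y -> (C y <-> K (h y))) -> normal_cone C y0 lam ->
  exists mu, polar K mu /\ mulTmv (Dh y0) mu = lam.
Proof.
move=> KK rV0 hJ hJ2 surj h0 CK Nlam.
have [kh [rh [kh0 rh0 Hh]]] := surjective_metric_regular rV0 hJ hJ2 surj.
have y0B : ball y0 rV y0 by rewrite /ball (_ : vsub y0 y0 = vzero) ?vnorm0 //; vring.
have [mu [Kmu _ _ E]] : exists mu, [/\ polar K mu, vdot mu (h y0) = 0,
    vnorm mu <= kh * vnorm lam & mulTmv (Dh y0) mu = lam].
  apply: (multiplier_of_normal KK (hJ _ y0B) _ (Rlt_le _ _ kh0) rh0 _ Nlam).
    by rewrite h0; have [_ [_ []]] := KK.
  move=> y e yB Ke he; have [y' [hy yk yV]] := Hh _ _ yB he.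
  by exists y'; split=> //; apply/CK => //; rewrite hy.
by exists mu.
Qed.

(** Brings relative interiority from the normal cone to [polar K] in the form the error bound uses;
    injectivity of the adjoint identifies the multiplier that is found. *)
Lemma relint_pullback l d (K : vec d -> Prop) (N : vec l -> Prop) (A : mat d l) mus :
  (forall mu, polar K mu -> N (mulTmv A mu)) ->
  (forall lam, N lam -> exists mu, polar K mu /\ mulTmv A mu = lam) ->
  (forall mu nu, mulTmv A mu = mulTmv A nu -> mu = nu) ->
  polar K mus -> rel_int N (mulTmv A mus) ->
  exists eps0, 0 < eps0 /\ forall nu nu', polar K nu -> polar K nu' ->
    vnorm (vsub nu nu') < eps0 -> polar K (vadd mus (vsub nu nu')).
Proof.
move=> KN NK inj Kmus [_ [eps [e0 ri]]].
have [c [c0 Hc]] := mulmv_bound (mtrans A).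
exists (eps / c); split=> [|nu nu' Kn Kn' nn]; first exact: Rdiv_lt_0_compat.
have [|mu [Kmu E]] := NK (mulTmv A (vadd mus (vsub nu nu'))).
  apply: ri; last first.
    rewrite -mulTmvB (_ : vsub _ mus = vsub nu nu'); last by vring.
    apply: (Rle_lt_trans _ _ _ (Hc _)); rewrite (_ : eps = c * (eps / c)); last by field; lra.
    exact: Rmult_lt_compat_l.
  (* The perturbed normal is the affine combination of three normals with weights 1, 1, -1. *)
  pose pick (T : Type) (a b e : T) (i : 'I_3) := match val i with 0%N => a | 1%N => b | _ => e end.
  exists 3%N, (pick _ (mulTmv A mus) (mulTmv A nu) (mulTmv A nu')), (pick _ 1 1 (-1)).
  have sum3 F : @vsum 3 F = F (inord 0) + F (inord 1) + F (inord 2).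
    rewrite /vsum !big_ord_recl big_ord0 Rplus_0_r -Rplus_assoc.
    by congr (_ + _ + _); congr F; apply: val_inj; rewrite /= inordK.
  have p0 T a b e : @pick T a b e (inord 0) = a by rewrite /pick /= inordK.
  have p1 T a b e : @pick T a b e (inord 1) = b by rewrite /pick /= inordK.
  have p2 T a b e : @pick T a b e (inord 2) = e by rewrite /pick /= inordK.
  split; first by rewrite sum3 p0 p1 p2; ring.
  split; first by move=> i; rewrite /pick; case: (val i) => [|[|?]]; exact: KN.
  rewrite mulTmvD mulTmvB; apply: vec_ext => j; rewrite sum3 !p0 !p1 !p2.
  by rewrite /vadd /vsub; ring.
by rewrite (inj _ _ (esym E)).
Qed.

(** * Isolated calmness *)

Lemma reduced_jac m n l d (g : vec m -> vec n -> vec l) Dg D2g (h : vec l -> vec d) Dh D2h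
    rV pbar xbar :
  C2_around (uncurry2 g) Dg D2g (vjoin pbar xbar) -> 0 < rV ->
  C2_on h Dh D2h (ball (g pbar xbar) rV) ->
  exists r, 0 < r /\ forall z, vnorm (vsub z (vjoin pbar xbar)) < r ->
    has_jac (fun z => h (uncurry2 g z)) (matmul (Dh (uncurry2 g z)) (Dg z)) z /\
    ball (g pbar xbar) rV (uncurry2 g z).
Proof.
move=> [r [r0 gC2]] rV0 hC2.
have zB : ball (vjoin pbar xbar) r (vjoin pbar xbar).
  by rewrite /ball (_ : vsub _ _ = vzero) ?vnorm0 //; vring.
have [c [d1 [c0 d10 Hc]]] := has_jac_lip (proj1 (gC2 _ zB)).
have e0 : 0 < rV / c by apply: Rdiv_lt_0_compat.
exists (Rmin r (Rmin d1 (rV / c))); split; first by do 2!apply: Rmin_glb_lt => //.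
move=> z zz; have z1 := Rlt_le_trans _ _ _ zz (Rmin_l _ _).
have {zz}zz := Rlt_le_trans _ _ _ zz (Rmin_r _ _).
have z2 := Rlt_le_trans _ _ _ zz (Rmin_l _ _).
have z3 := Rlt_le_trans _ _ _ zz (Rmin_r _ _).
have gB : ball (g pbar xbar) rV (uncurry2 g z).
  have := Hc _ z2; rewrite uncurry2_join => H; apply: (Rle_lt_trans _ _ _ H).
  rewrite (_ : rV = c * (rV / c)); last by field; lra.
  exact: Rmult_lt_compat_l.
split=> //; apply: has_jac_comp; first by have [] := hC2 _ gB.
by have [] := gC2 _ z1.
Qed.

(** Because G vanishes at xbar, the cone K itself describes the linearised constraint; the
    regularity estimate yields the inclusion that linearisation alone does not. *)
Lemma critical_coneP m n l d (g : vec m -> vec n -> vec l) C (K : vec d -> Prop)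
    (h : vec l -> vec d) A kappa rho rG rV pbar xbar fz a :
  closed_convex_cone K -> h (g pbar xbar) = vzero -> 0 <= kappa -> 0 < rho -> 0 < rG ->
  has_jac (fun y => h (g pbar y)) A xbar ->
  (forall y, ball (g pbar xbar) rV y -> (C y <-> K (h y))) ->
  (forall x, vnorm (vsub x xbar) < rG -> ball (g pbar xbar) rV (g pbar x)) ->
  (forall x e, ball xbar rho x -> K e -> vnorm (vsub (h (g pbar x)) e) < rho ->
    exists x', Gamma g C pbar x' /\ vnorm (vsub x' x) <= kappa * vnorm (vsub (h (g pbar x)) e)) ->
  critical_cone (Gamma g C pbar) xbar (vopp fz) a <-> K (mulmv A a) /\ vdot fz a = 0.
Proof.
move=> KK h0 k0 r0 rG0 GA CK gB reg; rewrite /critical_cone vdotNl.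
split=> [[T fa]|[Ka fa]]; split; try lra.
  apply: (cone_of_tangent KK GA h0 rG0 _ T) => x xB.
  by move/(CK _ (gB _ xB)).
exact: (tangent_of_cone KK GA h0 k0 r0 reg Ka).
Qed.

Lemma kkt_sequence_of_not_calm m n l d (g : vec m -> vec n -> vec l) Dg D2g C (K : vec d -> Prop)
    rV (h : vec l -> vec d) Dh D2h (f : vec m -> vec n -> vec n) Df pbar xbar :
  C2_around (uncurry2 g) Dg D2g (vjoin pbar xbar) ->
  closed_convex_cone K -> 0 < rV ->
  C2_on h Dh D2h (ball (g pbar xbar) rV) ->
  h (g pbar xbar) = vzero ->
  (forall e : vec d, exists y : vec l, mulmv (Dh (g pbar xbar)) y = e) ->
  (forall y, ball (g pbar xbar) rV y -> (C y <-> K (h y))) ->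
  C1_around (uncurry2 f) Df (vjoin pbar xbar) ->
  robinson_stable g C pbar xbar ->
  ~ (exists ell rQ rU, 0 < ell /\ 0 < rQ /\ 0 < rU /\
    forall p x, ball pbar rQ p -> Ssol g C f p x -> ball xbar rU x ->
      vnorm (vsub x xbar) <= ell * vnorm (vsub p pbar)) ->
  let zbar := vjoin pbar xbar in
  let ybar := g pbar xbar in
  let DG := matmul (Dh ybar) (Dg zbar) in
  exists u mu t q us mus G As fs, u <> vzero /\
    kkt_sequence K (jac_x DG)
      (jac_x (comp_hess (D2h ybar) (D2g zbar) (Dh ybar) (Dg zbar) (vjoin vzero u))) (jac_p DG)
      (f pbar xbar) (mulmv (jac_x (Df zbar)) u) u mu t q us mus G As fs.
Proof.
move=> gC2 KK rV0 hC2 h0 surj CK [rf [rf0 fC1]] rob nE zbar ybar DG.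
have zz0 : vsub zbar zbar = vzero by vring.
have ybB : ball ybar rV ybar by rewrite /ball (_ : vsub _ _ = vzero) ?vnorm0 //; vring.
have [rg [rg0 gJ]] := gC2.
have [gJ1 [gJ2 _]] : has_jac (uncurry2 g) (Dg zbar) zbar /\ has_jac2 Dg (D2g zbar) zbar /\
    tensor_cont_at D2g zbar by apply: gJ; rewrite /ball zz0 vnorm0.
have [fJ _] : has_jac (uncurry2 f) (Df zbar) zbar /\ mat_cont_at Df zbar.
  by apply: fC1; rewrite /ball zz0 vnorm0.
have [_ [hJ2 _]] := hC2 _ ybB.
have hJ y : ball ybar rV y -> has_jac h (Dh y) y by move=> /hC2[].
have [rG [rG0 HG]] := reduced_jac gC2 rV0 hC2.
have [kap [rho [k0 rho0 HR]]] := robinson_reduced rV0 hJ hJ2 surj CK gJ1 rob.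
(* Halved so that the pair (p_k, x_k), whose norm is bounded by a sum, stays within rG, and points
   within rho/2 of x_k stay within rho of xbar. *)
set r0 := Rmin (rG / 2) (rho / 2).
have r00 : 0 < r0 by apply: Rmin_glb_lt; lra.
have r0G := Rmin_l (rG / 2) (rho / 2); have r0R := Rmin_r (rG / 2) (rho / 2).
rewrite -/r0 in r0G r0R.
have i1 k : 0 < / (INR k + 1) <= 1.
  split; first by apply: Rinv_0_lt_compat; have := pos_INR k; lra.
  by rewrite -{2}Rinv_1; apply: Rinv_le_contravar; have := pos_INR k; lra.
(* Failure with the constant k + 1 is what makes q_k = (p_k - pbar)/t_k smaller than 1/(k + 1). *)
have bad k : exists px : vec m * vec n, [/\ ball pbar (r0 * / (INR k + 1)) px.1,
    Ssol g C f px.1 px.2, ball xbar (r0 * / (INR k + 1)) px.2 &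
    (INR k + 1) * vnorm (vsub px.1 pbar) < vnorm (vsub px.2 xbar)].
  apply: NNPP => H; apply: nE; have rp : 0 < r0 * / (INR k + 1).
    by apply: Rmult_lt_0_compat => //; have [] := i1 k.
  exists (INR k + 1), (r0 * / (INR k + 1)), (r0 * / (INR k + 1)).
  split; first by have := pos_INR k; lra.
  split=> //; split=> // p x pB Sx xB; apply: Rnot_lt_le => H1.
  by apply: H; exists (p, x).
have [px Hpx] := choice_fun bad.
pose p k := (px k).1; pose x k := (px k).2.
pose t k := vnorm (vsub (x k) xbar).
have rk k : r0 * / (INR k + 1) <= r0 by have := i1 k; nra.
have t0 k : 0 < t k.
  have [_ _ _ H] := Hpx k; apply: Rle_lt_trans H.
  by apply: Rmult_le_pos; [have := pos_INR k; lra | exact: vnorm_ge0].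
have tr k : t k < r0 * / (INR k + 1) by have [_ _ H _] := Hpx k.
have pr k : vnorm (vsub (p k) pbar) < r0 * / (INR k + 1) by have [H _ _ _] := Hpx k.
pose q k := vscale (/ t k) (vsub (p k) pbar).
pose us k := vscale (/ t k) (vsub (x k) xbar).
pose z k := vjoin (p k) (x k).
have ti k : 0 < / t k by exact: Rinv_0_lt_compat.
have zE k : vadd zbar (vscale (t k) (vjoin (q k) (us k))) = z k.
  rewrite vjoinZ vjoinD /z; congr vjoin; apply: vec_ext => i;
    by rewrite /q /us /vadd /vscale /vsub; field; have := t0 k; lra.
have zG k : vnorm (vsub (z k) zbar) < rG.
  rewrite vjoinB; apply: (Rle_lt_trans _ _ _ (vnorm_join _ _)).
  by have := tr k; have := pr k; have := rk k; rewrite /t; lra.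
pose As k := jac_x (matmul (Dh (uncurry2 g (z k))) (Dg (z k))).
have mult k : exists mu, [/\ polar K mu, vdot mu (h (g (p k) (x k))) = 0,
    vnorm mu <= kap * vnorm (vopp (f (p k) (x k))) & mulTmv (As k) mu = vopp (f (p k) (x k))].
  have [GJ gB] := HG _ (zG k); have [_ Sx _ _] := Hpx k; rewrite uncurry2_join in gB.
  apply: (@multiplier_of_normal _ _ K (fun y => h (g (p k) y)) _ (Gamma g C (p k)) _ _ kap
    (rho / 2)) => //.
  - have := has_jac_section GJ; congr has_jac.
    by apply: functional_extensionality => y; rewrite uncurry2_join.
  - by have [Cx _] := Sx; exact/(CK _ gB).
  - by lra.
  - move=> x1 e x1B Ke hB; apply: HR => //; rewrite /ball; try lra.
      by have := pr k; have := rk k; lra.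
    by have := vnorm_subv x1 (x k) xbar; have := tr k; have := rk k; rewrite /t; lra.
have [mus Hmus] := choice_fun mult.
have tl : ulim t 0.
  have := ulimZ r0 ulim_inv_succ; rewrite Rmult_0_r; apply: ulim_squeeze0.
  by apply: ult_all => k; rewrite Rabs_pos_eq; have := tr k; have := t0 k; lra.
have ql : vlim q vzero.
  apply/vlim_dist; apply: ulim_squeeze0 ulim_inv_succ; apply: ult_all => k.
  rewrite Rabs_pos_eq; last exact: vnorm_ge0.
  rewrite (_ : vsub _ vzero = q k); last by vring.
  rewrite /q vnormZ Rabs_pos_eq; last by have := ti k; lra.
  have [_ _ _ H] := Hpx k; have k1 : 0 < INR k + 1 by have := pos_INR k; lra.
  apply: (Rmult_le_reg_l ((INR k + 1) * t k)); first exact: Rmult_lt_0_compat.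
  rewrite (_ : _ * (/ t k * _) = (INR k + 1) * vnorm (vsub (p k) pbar)); last first.
    by field; have := t0 k; lra.
  rewrite (_ : _ * / (INR k + 1) = t k); last by field; lra.
  by rewrite /t /p /x; lra.
have u1 k : vnorm (us k) = 1.
  rewrite /us vnormZ Rabs_pos_eq; last by have := ti k; lra.
  by rewrite -/(t k); field; have := t0 k; lra.
have [u ul] : exists u, vlim us u.
  by apply: (@vlim_exists _ _ 1); apply: ult_all => k; rewrite u1; lra.
have vl := vlim_join ql ul.
have zl : vlim z zbar.
  by apply: vlim_eq (vlimD (vlim_cst zbar) (vlimZ tl vl)) => [k|]; [rewrite zE | vring].
pose fs k := f (p k) (x k).
have fl : vlim fs (f pbar xbar).
  by apply: vlim_eq (has_jac_cont fJ zl) => [k|]; rewrite uncurry2_join.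
have [mu ml] : exists mu, vlim mus mu.
  have fb := ulim_bound (ulim_vnorm fl).
  apply: (@vlim_exists _ _ (kap * (Rabs (vnorm (f pbar xbar)) + 1))).
  apply: ult_mono fb => k; rewrite Rabs_pos_eq; last exact: vnorm_ge0.
  move=> H; have [_ _ H1 _] := Hmus k; apply: (Rle_trans _ _ _ H1).
  by rewrite vnormN; exact: Rmult_le_compat_l.
exists u, mu, t, q, us, mus, (fun k => h (g (p k) (x k))), As, fs; split.
  move=> u0; have := ulim_uniq (ulim_vnorm ul) (_ : ulim _ 1).
  by rewrite u0 vnorm0 => /(_ (ulim_eq (fun k => esym (u1 k)) erefl (ulim_cst 1))); lra.
have ubar : uncurry2 g zbar = ybar by rewrite uncurry2_join.
have hJ2' : has_jac2 Dh (D2h ybar) (uncurry2 g zbar) by rewrite ubar.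
have compl tt vv v0 (tt0 : forall k : nat, 0 < tt k) (ttl : ulim tt 0) (vvl : vlim vv v0) :=
  comp_hess_lim hJ2' gJ1 gJ2 tt0 ttl vvl.
rewrite ubar in compl.
split=> //.
- move=> i j; have := compl _ _ _ t0 tl vl i (rshift m j).
  by apply: ulim_eq => // k; rewrite zE.
(* Expansion along the joint direction (q_k, us_k), which tends to (0, u): in the limit only the
   x-part of the second derivative remains. *)
- move=> i; have := @taylor2_lim _ _ (fun z => h (uncurry2 g z))
    (fun z => matmul (Dh (uncurry2 g z)) (Dg z))
    (comp_hess (D2h ybar) (D2g zbar) (Dh ybar) (Dg zbar)) zbar rG t _ _ i rG0
    (fun z zz => proj1 (HG z zz)) _ t0 tl vl.
  rewrite ubar -/ybar h0 => /(_ compl).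
  apply: ulim_eq => [k|]; last by rewrite /vscale mulmv_join0.
  rewrite zE uncurry2_join mulmv_join /vscale /vsub /vzero; congr (_ * (_ * _ - _)); ring.
- apply: vlim_eq (has_jac_lim fJ t0 tl vl) => [k|]; last exact: mulmv_join0.
  by rewrite /quot zE !uncurry2_join.
- move=> k; have [_ [Cx _] _ _] := Hpx k; have [_ gB] := HG _ (zG k).
  by rewrite uncurry2_join in gB; exact/(CK _ gB).
- by move=> k; have [] := Hmus k.
- by move=> k; have [] := Hmus k.
- by move=> k; have [] := Hmus k.
Qed.

Theorem theorem6p2
  (m n l d : nat)
  (g : vec m -> vec n -> vec l)
  (Dg : vec (m + n) -> mat l (m + n)) (D2g : vec (m + n) -> tensor l (m + n))
  (C : vec l -> Prop) (K : vec d -> Prop) (rV : R)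
  (h : vec l -> vec d) (Dh : vec l -> mat d l) (D2h : vec l -> tensor d l)
  (f : vec m -> vec n -> vec n) (Df : vec (m + n) -> mat n (m + n))
  (pbar : vec m) (xbar : vec n) :
  (* g is C^2 around zbar = (pbar, xbar), with derivatives Dg, D2g *)
  C2_around (uncurry2 g) Dg D2g (vjoin pbar xbar) ->
  (* C closed, C^2-cone reducible at g(zbar) to the closed convex cone K *)
  is_closed C ->
  closed_convex_cone K ->
  0 < rV ->
  C2_on h Dh D2h (ball (g pbar xbar) rV) ->
  h (g pbar xbar) = vzero ->
  (forall e : vec d, exists y : vec l, mulmv (Dh (g pbar xbar)) y = e) ->
  (forall y, ball (g pbar xbar) rV y -> (C y <-> K (h y))) ->
  (* f is C^1 around zbar *)
  C1_around (uncurry2 f) Df (vjoin pbar xbar) ->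
  (* xbar in S(pbar) *)
  Ssol g C f pbar xbar ->
  (* Robinson stability *)
  robinson_stable g C pbar xbar ->
  (let zbar := vjoin pbar xbar in
   let ybar := g pbar xbar in
   let Dgz := Dg zbar in
   let D2gz := D2g zbar in
   let Dhy := Dh ybar in
   let D2hy := D2h ybar in
   let fz := f pbar xbar in
   let Kcrit := critical_cone (Gamma g C pbar) xbar (vopp fz) in
   let F := Fop (Df zbar) Dgz D2gz Dhy D2hy in
   let DG := matmul Dhy Dgz in
   (* condition (C1) *)
   let C1cond :=
     forall u, u <> vzero -> Kcrit u ->
     forall lam, Lambar C ybar Dgz fz lam ->
     forall lamh, Lam_dir C ybar Dgz D2gz Dhy D2hy (mulTmv Dgz lam)
                    (vjoin vzero u) lamh ->
       vdot (F lamh u) u > 0 \/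
       exists ut, Kcrit ut /\ vdot (F lamh u) ut < 0 in
   (* condition (C2) *)
   let C2cond :=
     forall u, u <> vzero -> Kcrit u ->
     forall lam, Lambar C ybar Dgz fz lam ->
       vdot (F lam u) u > 0 \/
       exists ut, Kcrit ut /\ vdot (F lam u) ut < 0 in
   (* the set cal P equals P *)
   let Pfull :=
     forall q : vec m, exists (x' : vec n) (w : vec d),
       lin_space K w /\ mulmv (jac_p DG) q = vadd (mulmv (jac_x DG) x') w in
   (* strict complementarity for g(pbar, x) in C at (xbar, -f(zbar)) *)
   let strict_compl :=
     exists lam, rel_int (normal_cone C ybar) lam /\
       mulTmv (jac_x Dgz) lam = vopp fz in
   (C1cond /\ (Pfull \/ polyhedral K)) \/ (strict_compl /\ C2cond)) ->
  (* isolated calmness of S at (pbar, xbar) *)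
  exists ell rQ rU, 0 < ell /\ 0 < rQ /\ 0 < rU /\
    forall p x, ball pbar rQ p -> Ssol g C f p x -> ball xbar rU x ->
      vnorm (vsub x xbar) <= ell * vnorm (vsub p pbar).
Proof.
move=> gC2 _ KK rV0 hC2 h0 surj CK fC1 _ rob /=.
set zbar := vjoin pbar xbar; set ybar := g pbar xbar; set DG := matmul _ _.
move=> cond; apply: NNPP => nE.
have [u [mu [t [q [us [mus [G [As [fs [u0 S]]]]]]]]]] :=
  kkt_sequence_of_not_calm gC2 KK rV0 hC2 h0 surj CK fC1 rob nE.
rewrite -/zbar -/ybar -/DG in S.
have zz0 : vsub zbar zbar = vzero by vring.
have ubar : uncurry2 g zbar = ybar by rewrite uncurry2_join.
have hJ y : ball ybar rV y -> has_jac h (Dh y) y by move=> /hC2[].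
have ybB : ball ybar rV ybar by rewrite /ball (_ : vsub _ _ = vzero) ?vnorm0 //; vring.
have [_ [hJ2 _]] := hC2 _ ybB.
have [rG [rG0 HG]] := reduced_jac gC2 rV0 hC2; rewrite -/zbar -/ybar in HG.
have [GJ _] : has_jac (fun z => h (uncurry2 g z)) DG zbar /\ ball ybar rV (uncurry2 g zbar).
  by have := HG zbar; rewrite zz0 vnorm0 ubar => /(_ rG0).
have GJx : has_jac (fun y => h (g pbar y)) (jac_x DG) xbar.
  have := has_jac_section GJ; congr has_jac.
  by apply: functional_extensionality => y; rewrite uncurry2_join.
have gB x : vnorm (vsub x xbar) < rG -> ball ybar rV (g pbar x).
  move=> xB; have := HG (vjoin pbar x); rewrite uncurry2_join => H; apply: (proj2 (H _)).
  rewrite vjoinB (_ : vsub pbar pbar = vzero); last by vring.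
  by rewrite vnorm_join0.
have [rg [rg0 gJ]] := gC2.
have [gJ1 _] : has_jac (uncurry2 g) (Dg zbar) zbar /\ has_jac2 Dg (D2g zbar) zbar /\
    tensor_cont_at D2g zbar by apply: gJ; rewrite /ball zz0 vnorm0.
have [kap [rho [k0 rho0 HR]]] := robinson_reduced rV0 hJ hJ2 surj CK gJ1 rob.
have crit a : critical_cone (Gamma g C pbar) xbar (vopp (f pbar xbar)) a <->
    K (mulmv (jac_x DG) a) /\ vdot (f pbar xbar) a = 0.
  apply: (@critical_coneP _ _ _ _ g C K h (jac_x DG) kap rho rG rV) => // x e xB Ke he.
  by apply: HR => //; rewrite /ball (_ : vsub _ _ = vzero) ?vnorm0 //; vring.
have NK nu : polar K nu -> normal_cone C ybar (mulTmv (Dh ybar) nu).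
  by apply: normal_of_polar rV0 (hJ _ ybB) h0 _ CK; have [_ [_ []]] := KK.
have KN lam : normal_cone C ybar lam -> exists nu, polar K nu /\ mulTmv (Dh ybar) nu = lam.
  exact: polar_of_normal KK rV0 hJ hJ2 surj h0 CK.
have ucrit : critical_cone (Gamma g C pbar) xbar (vopp (f pbar xbar)) u.
  by apply/crit; split; [exact: kkt_dir_cone KK S | exact: kkt_dir_orth S].
set lam := mulTmv (Dh ybar) mu.
have Ax nu : mulTmv (jac_x DG) nu = mulTmv (jac_x (Dg zbar)) (mulTmv (Dh ybar) nu).
  by rewrite -mulTmv_matmul.
have lamL : Lambar C ybar (Dg zbar) (f pbar xbar) lam.
  split; first exact: NK (kkt_mu_polar S).
  by rewrite -Ax (kkt_mu_stat S); vring.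
have form a : vdot (Fop (Df zbar) (Dg zbar) (D2g zbar) (Dh ybar) (D2h ybar) lam u) a =
    lagrangian_form (jac_x (comp_hess (D2h ybar) (D2g zbar) (Dh ybar) (Dg zbar) (vjoin vzero u)))
      (mulmv (jac_x (Df zbar)) u) mu a.
  by rewrite Fop_comp.
have form_ge0 a : critical_cone (Gamma g C pbar) xbar (vopp (f pbar xbar)) a ->
    0 <= vdot (Fop (Df zbar) (Dg zbar) (D2g zbar) (Dh ybar) (D2h ybar) lam u) a.
  by move=> /crit[Ka fa]; rewrite form; exact: (kkt_form_ge0 S Ka fa).
have contra : vdot (Fop (Df zbar) (Dg zbar) (D2g zbar) (Dh ybar) (D2h ybar) lam u) u <= 0 ->
  ~ (vdot (Fop (Df zbar) (Dg zbar) (D2g zbar) (Dh ybar) (D2h ybar) lam u) u > 0 \/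
     exists ut, critical_cone (Gamma g C pbar) xbar (vopp (f pbar xbar)) ut /\
       vdot (Fop (Df zbar) (Dg zbar) (D2g zbar) (Dh ybar) (D2h ybar) lam u) ut < 0).
  by move=> le0 [|[ut [/form_ge0]]]; lra.
(* Prepares (C1) with the limit multiplier in the role of both lambda and its directional
   maximiser. *)
have dir : (forall nu, polar K nu -> (forall a b,
      vdot nu (vadd (mulmv (jac_p DG) a) (mulmv (jac_x DG) b)) =
      vdot mu (vadd (mulmv (jac_p DG) a) (mulmv (jac_x DG) b))) ->
      vdot nu (mulmv (jac_x (comp_hess (D2h ybar) (D2g zbar) (Dh ybar) (Dg zbar)
        (vjoin vzero u))) u) <=
      vdot mu (mulmv (jac_x (comp_hess (D2h ybar) (D2g zbar) (Dh ybar) (Dg zbar)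
        (vjoin vzero u))) u)) ->
    Lam_dir C ybar (Dg zbar) (D2g zbar) (Dh ybar) (D2h ybar) (mulTmv (Dg zbar) lam)
      (vjoin vzero u) lam.
  move=> maxi; split; first by split=> //; exact: NK (kkt_mu_polar S).
  (* A competitor is Dh^* nu with nu polar; equality under Dg^* means that nu and mu agree on the
     range of DG. *)
  move=> lam' [/KN[nu [Knu <-]] E]; rewrite !lam_obj_comp // !mulmv_join0.
  apply: maxi => // a b; rewrite -mulmv_join -!vdot_adj; congr vdot.
  by rewrite /DG !mulTmv_matmul E.
case: cond => [[C1 [full|poly]]|[[lams [ri lamsE]] C2]].
- have pl := kkt_param_range S full.
  apply: contra (C1 u u0 ucrit lam lamL lam (dir _)).
    rewrite form; apply: (kkt_form_le0 S (mut := fun _ => mu)) => // [_|_|].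
    + exact: kkt_mu_polar S.
    + exact: kkt_mu_stat S.
    + exact: vlim_cst.
  by move=> nu Knu E; exact: (kkt_maximal KK S Knu E pl).
- have face := polyhedral_limit_face KK poly (kkt_mu_lim S) (kkt_G S) (kkt_mu S) (kkt_compl S).
  apply: contra (C1 u u0 ucrit lam lamL lam (dir _)).
    rewrite form; apply: (kkt_error_bound S (kkt_mu_polar S) (kkt_mu_stat S)).
    exact: polyhedral_error_bound KK poly (kkt_mu_polar S).
  by move=> nu Knu E; exact: (kkt_maximal_face S Knu E face).
- apply: contra (C2 u u0 ucrit lam lamL).
  (* The limit multiplier may lie on the relative boundary, so the error bound is anchored at the
     one from strict complementarity, while (C2) is tested with the limit. *)
  have [nus [Knus E]] := KN _ (proj1 ri).
  have inj a b : mulTmv (Dh ybar) a = mulTmv (Dh ybar) b -> a = b.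
    by move=> ab; rewrite -(preimT_mulTmv a surj) ab preimT_mulTmv.
  rewrite -E in ri lamsE; have [e0 [e00 He]] := relint_pullback NK KN inj Knus ri.
  rewrite form; apply: (kkt_error_bound S Knus); first by rewrite Ax.
  exact: relint_error_bound e00 Knus He.
Qed.
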